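(* For every $q\in\mathbb Z$, the functors $W^q$, $\mathcal C(F_q,\cdot)$, $\Delta^q$ and $\mathcal{AP}^q$ (from the category of commutative rings with identity to the category of commutative rings, not necessarily with identity) are equivalent (naturally isomorphic), and each natural equivalence among them (the isomorphisms $H^q$, $T^q$, $\theta^q$ and their composites and inverses) is compatible with the Frobenius and Verschiebung operators.
   Context: Fix $q\in\mathbb Z$; $0^0=1$. $\mathbf{Gh}(R)=R^{\mathbb N}$ with componentwise operations; $[i,j]$, $(i,j)$ are lcm and gcd; $\mu$ is the classical Möbius function; $S(x,d)=\sum_{e\mid d}\mu(e)x^{d/e}$; sequence entries with non-integral index are $0$. The functor $W^q$. $W^q(R)$ is $R^{\mathbb N}$ as a set; $W^q(f)$ is $f$ applied componentwise; the operations are given by universal polynomials with integer coefficients, such that $\Phi_R^q:W^q(R)\to\mathbf{Gh}(R)$, $\mathbf a\mapsto(\sum_{d\mid n}dq^{\frac nd-1}a_d^{n/d})_{n\ge1}$, is a ring homomorphism for all $R$. For $r\ge 1$ the Verschiebung is $V_r(\mathbf a)=(a_{n/r})_n$, and the Frobenius $f_r$ is the operator given by universal integral polynomials with $\Phi^q_R(f_r\mathbf a)_n=\Phi^q_R(\mathbf a)_{rn}$ for all $n$, naturally in $R$. The functor $\mathcal C(F_q,\cdot)$. $F_q(X,Y)=X+Y-qXY$. $\mathcal C(F_q,R)$ is the set of power series in $R[[t]]$ with zero constant term, with formal group addition $\gamma+_{F_q}\delta=F_q(\gamma,\delta)$; a ring homomorphism acts coefficientwise. The map $H^q:W^q(R)\to\mathcal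 C(F_q,R)$, $\mathbf a\mapsto\sum^{F_q}_{n\ge1}a_nt^n$ (formal sum with respect to $F_q$), is a bijection and an additive isomorphism; the multiplication of $\mathcal C(F_q,R)$ is transported from $W^q(R)$ by $H^q$. Verschiebung: $V_r\gamma(t)=\gamma(t^r)$. Frobenius: $f_r\gamma(t)=\sum^{F_q}_{0\le i<r}\gamma(\zeta_r^it^{1/r})$, $\zeta_r$ a formal primitive $r$-th root of unity, for $R$ torsion-free; its coefficients are universal integral polynomials in those of $\gamma$, which define $f_r$ for every $R$. Numbers. $\zeta^q(d_1,d_2)=\frac{d_1}{d_2}q^{\frac{d_2}{d_1}-1}$ if $d_1\mid d_2$, $0$ otherwise; $\mu^q(d,n)$ is the $(d,n)$ entry of the inverse of the matrix $\zeta^q$ indexed by divisors of $n$; $\tau^q(i,n)=\sum_{d\mid i}\mu^q(1,d)\zeta^q(d,n)$; for $[i,j]\mid n$, $P_{n,i,j}(q)=\frac{j}{(i,j)q}\sum_{d\mid n/[i,j]}\tau^q(\frac{n}{[i,j]d},\frac ni)S(q^{[i,j]/j},d)$, a numerical polynomial in $q$ (evaluated at the given integer $q$). The functor $\Delta^q$ and the isomorphism $T^q:W^q(R)\to\Delta^q(R)$. Case 1, $R\supseteq\mathbb Q$: $\Delta^q(R)=\mathbf{Nr}^q(R)$ is $R^{\mathbb N}$ with componentwise addition and multiplication $(\mathbf x\mathbf y)_n=\sum_{[i,j]\mid n}(i,j)P_{n,i,j}(q)x_iy_j$. $V_r(\mathbf x)=(x_{n/r})_n$; $f_r^q(\mathbf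 x)=\big(r\sum_{d\mid rn}\tau^q(\frac{rn}{[r,d]},\frac{rn}{d})x_d\big)_n$. For $x\in R$, $M^q(x)=(M^q(x,n))_n$ with $M^q(x,n)=\sum_{d\mid n}\mu^q(d,n)\frac{q^{d-1}}{d}x^d$, and $T^q(\mathbf x)=\sum_{n\ge1}V_nM^q(x_n)$. Case 2, $R$ torsion-free and not containing $\mathbb Q$: with $R\mathbb Q=R\otimes_{\mathbb Z}\mathbb Q$, $\Delta^q(R)=T^q(W^q(R))\subset\Delta^q(R\mathbb Q)$; $T^q$, $V_r$, $f^q_r$ are restrictions of those for $R\mathbb Q$. Case 3, $R$ not torsion-free: choose a surjective ring homomorphism $\rho:R'\to R$ with $R'$ torsion-free (e.g. $R'=\mathbb Z[R]$ with $\mathbb Z$-basis $e_r$, $e_re_s=e_{rs}$, $\rho(e_r)=r$); $\Delta^q(\ker\rho)$ is the image under $T^q$ of the set of $\mathbf a\in W^q(R')$ with all entries in $\ker\rho$; $\Delta^q(R)=\Delta^q(R')/\Delta^q(\ker\rho)$; $T^q,V_r,f_r^q$ are the induced maps. For $f:A\to B$, $\Delta^q(f)$ sends $T^q(\mathbf x)$ to $T^q(W^q(f)(\mathbf x))$. The functor $\mathcal{AP}^q$ and the isomorphism $\theta^q_R:\Delta^q(R)\to\mathcal{AP}^q(R)$. Case 1, $R\supseteq\mathbb Q$: $\mathcal{AP}^q(R)$ is $R^{\mathbb N}$ with componentwise addition and multiplication $(\mathbf x\mathbf y)_n=\sum_{[i,j]\mid n}\frac{n}{[i,j]}P_{n,i,j}(q)x_iy_j$;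 $\theta_R^q(\mathbf x)=(nx_n)_n$; Verschiebung $\mathbf V_r(\mathbf x)=(rx_{n/r})_n$; Frobenius $\mathbf f_r^q(\mathbf x)=\big(r\sum_{d\mid rn}\tau^q(\frac{rn}{[r,d]},\frac{rn}{d})\frac nd x_d\big)_n$. Case 2: $\mathcal{AP}^q(R)=\theta^q_{R\mathbb Q}(\Delta^q(R))\subset\mathcal{AP}^q(R\mathbb Q)$, with restricted maps. Case 3: $\mathcal{AP}^q(R)=\mathcal{AP}^q(R')/\mathcal{AP}^q(\ker\rho)$, where $\mathcal{AP}^q(\ker\rho)=\theta^q_{R'}(\Delta^q(\ker\rho))$, with induced maps. For $f:A\to B$, $\mathcal{AP}^q(f)$ sends $\theta^q_A(T^q(\mathbf x))$ to $\theta^q_B(T^q(W^q(f)(\mathbf x)))$. *)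

(* Defs.v *)
From HB Require Import structures.
From mathcomp Require Import all_boot all_order all_algebra all_field.
From mathcomp Require Import mpoly.
From mathcomp Require finmap monalg.
From mathcomp Require Import zify.
From Stdlib Require Import ClassicalEpsilon.

Set Implicit Arguments.
Unset Strict Implicit.
Unset Printing Implicit Defensive.

Import GRing.Theory.
Local Open Scope ring_scope.
Local Open Scope quotient_scope.

(* Sequences (x_n)_{n >= 1} are functions nat -> R whose value at 0 is
   irrelevant: they are compared with eqseq. *)
Definition eqseq (R : Type) (x y : nat -> R) : Prop :=
  forall n, (0 < n)%N -> x n = y n.

Definition seqV (R : zmodType) (r : nat) (x : nat -> R) : nat -> R :=
  fun n => if (r %| n)%N then x (n %/ r)%N else 0.

Definition torsion_free (R : comPzRingType) : Prop :=
  forall (n : nat) (x : R), (0 < n)%N -> x *+ n = 0 -> x = 0.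

(* The operations of a ring, not necessarily with identity, and its operators
   V_r and f_r, on a subquotient: the elements are those of [dom] (a subset of
   the ambient type [car]), and their equality is [eqv].  The axioms are in
   is_comring. *)
Record fvring := FVRing {
  car :> Type;
  dom : car -> Prop;
  eqv : car -> car -> Prop;
  radd : car -> car -> car;
  rmul : car -> car -> car;
  rver : nat -> car -> car;
  rfrob : nat -> car -> car }.

Definition compatible1 (A B : fvring) (h : A -> B) : Prop :=
  (forall x, dom x -> dom (h x)) /\
  (forall x y, dom x -> dom y -> eqv x y -> eqv (h x) (h y)).

Definition compatible2 (A : fvring) (op : A -> A -> A) : Prop :=
  (forall x y, dom x -> dom y -> dom (op x y)) /\
  (forall x x' y y', dom x -> dom x' -> dom y -> dom y' ->
     eqv x x' -> eqv y y' -> eqv (op x y) (op x' y')).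

Record is_comring (A : fvring) : Prop := IsComRing {
  eqv_refl : forall x : A, dom x -> eqv x x;
  eqv_sym : forall x y : A, dom x -> dom y -> eqv x y -> eqv y x;
  eqv_trans : forall x y z : A, dom x -> dom y -> dom z ->
    eqv x y -> eqv y z -> eqv x z;
  radd_compatible : compatible2 (@radd A);
  rmul_compatible : compatible2 (@rmul A);
  raddA : forall x y z : A, dom x -> dom y -> dom z ->
    eqv (radd x (radd y z)) (radd (radd x y) z);
  raddC : forall x y : A, dom x -> dom y -> eqv (radd x y) (radd y x);
  radd_zero_opp : exists2 z : A, dom z &
    forall x, dom x ->
      eqv (radd z x) x /\ exists2 y : A, dom y & eqv (radd x y) z;
  rmulA : forall x y z : A, dom x -> dom y -> dom z ->
    eqv (rmul x (rmul y z)) (rmul (rmul x y) z);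
  rmulC : forall x y : A, dom x -> dom y -> eqv (rmul x y) (rmul y x);
  rmulDl : forall x y z : A, dom x -> dom y -> dom z ->
    eqv (rmul (radd x y) z) (radd (rmul x z) (rmul y z)) }.

Record is_hom (A B : fvring) (h : A -> B) : Prop := IsHom {
  hom_compatible : compatible1 h;
  hom_add : forall x y, dom x -> dom y -> eqv (h (radd x y)) (radd (h x) (h y));
  hom_mul : forall x y, dom x -> dom y -> eqv (h (rmul x y)) (rmul (h x) (h y)) }.

Record is_iso (A B : fvring) (h : A -> B) : Prop := IsIso {
  iso_hom : is_hom h;
  iso_inj : forall x y, dom x -> dom y -> eqv (h x) (h y) -> eqv x y;
  iso_surj : forall z, dom z -> exists2 x, dom x & eqv (h x) z }.

Definition is_inverse (A B : fvring) (h : A -> B) (k : B -> A) : Prop :=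
  (forall x, dom x -> eqv (k (h x)) x) /\
  (forall y, dom y -> dom (k y) /\ eqv (h (k y)) y).

Record fvfunctor := FVFunctor {
  fobj :> comPzRingType -> fvring;
  fmap : forall A B : comPzRingType, {rmorphism A -> B} -> fobj A -> fobj B }.

Arguments fmap F {A B} f x : rename.

Record is_functor (F : fvfunctor) : Prop := IsFunctor {
  functor_ring : forall R, is_comring (F R);
  functor_hom : forall (A B : comPzRingType) (f : {rmorphism A -> B}),
    is_hom (fmap F f);
  functor_id : forall (R : comPzRingType) (x : F R), dom x ->
    eqv (fmap F (idfun : {rmorphism R -> R}) x) x;
  functor_comp : forall (A B C : comPzRingType)
    (g : {rmorphism B -> C}) (f : {rmorphism A -> B}) (x : F A), dom x ->
    eqv (fmap F (g \o f : {rmorphism A -> C}) x) (fmap F g (fmap F f x));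
  functor_ver : forall R r, (0 < r)%N -> compatible1 (@rver (F R) r);
  functor_frob : forall R r, (0 < r)%N -> compatible1 (@rfrob (F R) r) }.

Definition transformation (F G : fvfunctor) := forall R, F R -> G R.

Record natural_equivalence (F G : fvfunctor) (eta : transformation F G) : Prop :=
  NaturalEquivalence {
  natural_iso : forall R, is_iso (@eta R);
  naturality : forall (A B : comPzRingType) (f : {rmorphism A -> B}) (x : F A),
    dom x -> eqv (eta B (fmap F f x)) (fmap G f (eta A x)) }.

Definition ver_compatible (F G : fvfunctor) (eta : transformation F G) : Prop :=
  forall R r (x : F R), (0 < r)%N -> dom x ->
    eqv (eta R (rver r x)) (rver r (eta R x)).

Definition frob_compatible (F G : fvfunctor) (eta : transformation F G) : Prop :=
  forall R r (x : F R), (0 < r)%N -> dom x ->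
    eqv (eta R (rfrob r x)) (rfrob r (eta R x)).

(* The value at v of an integral polynomial; this is mmap intr v p, which
   multinomials only provides for nonzero rings. *)
Definition upoly_eval (R : comPzRingType) k (v : 'I_k -> R)
    (p : {mpoly int[k]}) : R :=
  \sum_(m <- msupp p) (p@_m)%:~R * \prod_(i < k) v i ^+ m i.

(* The i-th variable (i < k) stands for a_{i+1}. *)
Definition vars1 (R : Type) k (a : nat -> R) : 'I_k -> R := fun i => a i.+1.

Definition vars2 (R : Type) k (a b : nat -> R) : 'I_(k + k) -> R :=
  fun i => match split i with inl j => a j.+1 | inr j => b j.+1 end.

Section Witt.
Variable q : int.

Definition ghost (R : comPzRingType) (a : nat -> R) (n : nat) : R :=
  \sum_(d <- divisors n) d%:R * q%:~R ^+ (n %/ d).-1 * a d ^+ (n %/ d).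

(* The n-th entry of a sum or product involves only the entries of index <= n,
   and the n-th entry of f_r a only those of index <= r n.  The conditions
   below determine the polynomials of index n >= 1, since the coefficient of
   a_n in ghost a n is n. *)
Definition witt_op_spec (op : forall R : comPzRingType, R -> R -> R)
    (p : forall n, {mpoly int[n + n]}) : Prop :=
  forall (R : comPzRingType) (a b : nat -> R) n, (0 < n)%N ->
    ghost (fun m => upoly_eval (vars2 a b) (p m)) n
      = op R (ghost a n) (ghost b n).

Definition witt_frob_spec (r : nat) (p : forall n, {mpoly int[r * n]}) : Prop :=
  forall (R : comPzRingType) (a : nat -> R) n, (0 < n)%N ->
    ghost (fun m => upoly_eval (vars1 a) (p m)) n = ghost a (r * n).

Definition witt_add_poly : forall n, {mpoly int[n + n]} :=
  epsilon (inhabits (fun n => 0)) (witt_op_spec (fun R => @GRing.add R)).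

Definition witt_mul_poly : forall n, {mpoly int[n + n]} :=
  epsilon (inhabits (fun n => 0)) (witt_op_spec (fun R => @GRing.mul R)).

Definition witt_frob_poly (r : nat) : forall n, {mpoly int[r * n]} :=
  epsilon (inhabits (fun n => 0)) (@witt_frob_spec r).

Section WittRing.
Variable R : comPzRingType.

Definition witt_add (a b : nat -> R) : nat -> R :=
  fun n => upoly_eval (vars2 a b) (witt_add_poly n).

Definition witt_mul (a b : nat -> R) : nat -> R :=
  fun n => upoly_eval (vars2 a b) (witt_mul_poly n).

Definition witt_frob (r : nat) (a : nat -> R) : nat -> R :=
  fun n => upoly_eval (vars1 a) (witt_frob_poly r n).

Definition witt_ring : fvring :=
  @FVRing (nat -> R) (fun _ => True) (@eqseq R)
    witt_add witt_mul (@seqV R) witt_frob.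

End WittRing.

Definition W_functor : fvfunctor :=
  @FVFunctor witt_ring (fun A B f a => f \o a).

(* A power series is its sequence of coefficients, from index 0 on; fgl is
   X + Y - q X Y. *)
Definition fgl (R : pzRingType) (f g : nat -> R) : nat -> R :=
  fun n => f n + g n - q%:~R * \sum_(i < n.+1) f i * g (n - i)%N.

Definition monomial (R : zmodType) (c : R) (n : nat) : nat -> R :=
  fun m => if m == n then c else 0.

(* The terms a_n t^n with n > N do not contribute to the coefficient of t^N. *)
Definition Hmap (R : pzRingType) (a : nat -> R) : nat -> R :=
  fun N => (\big[@fgl R / fun=> 0]_(1 <= n < N.+1) monomial (a n) n) N.

Definition Hinv (R : pzRingType) (g : nat -> R) : nat -> R :=
  epsilon (inhabits (fun=> 0)) (fun a => forall n, Hmap a n = g n).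

(* R[zeta_r] is R[X] modulo the r-th cyclotomic polynomial.  With
   u = t^{1/r}, the condition reads
   sum^F_{i < r} gamma(zeta_r^i u) = (f_r gamma)(u^r). *)
Definition curve_frob_spec (r : nat) (p : forall n, {mpoly int[r * n]}) : Prop :=
  forall (R : comNzRingType), torsion_free R ->
  let Phi : {poly R} := map_poly intr 'Phi_r in
  let zeta : {poly %/ Phi} := 'qX in
  forall g : nat -> R, g 0%N = 0 -> forall N,
    (\big[@fgl {poly %/ Phi} / fun=> 0]_(0 <= i < r)
       (fun n => qpolyC Phi (g n) * zeta ^+ (i * n))) N
    = if (r %| N)%N
      then qpolyC Phi (upoly_eval (vars1 g) (p (N %/ r)%N)) else 0.

Definition curve_frob_poly (r : nat) : forall n, {mpoly int[r * n]} :=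
  epsilon (inhabits (fun n => 0)) (@curve_frob_spec r).

Section CurveRing.
Variable R : comPzRingType.

Definition curve_mul (f g : nat -> R) : nat -> R :=
  Hmap (witt_mul (Hinv f) (Hinv g)).

Definition curve_frob (r : nat) (g : nat -> R) : nat -> R :=
  fun n => upoly_eval (vars1 g) (curve_frob_poly r n).

Definition curve_ring : fvring :=
  @FVRing (nat -> R) (fun g => g 0%N = 0) (fun f g => forall n, f n = g n)
    (@fgl R) curve_mul (@seqV R) curve_frob.

End CurveRing.

Definition C_functor : fvfunctor :=
  @FVFunctor curve_ring (fun A B f g => f \o g).

End Witt.

(* The classical Moebius function, for n >= 1. *)
Definition moebius (n : nat) : int :=
  if all (fun p => logn p n == 1%N) (primes n)
  then (-1) ^+ size (primes n) else 0.

(* K is rat with a numerical q, or {poly rat} with q = 'X. *)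
Section Numbers.
Variables (K : comUnitRingType) (q : K).

Definition necklaceS (x : K) (d : nat) : K :=
  \sum_(e <- divisors d) (moebius e)%:~R * x ^+ (d %/ e).

Definition zetaq (d1 d2 : nat) : K :=
  if (d1 %| d2)%N then d1%:R / d2%:R * q ^+ (d2 %/ d1).-1 else 0.

Definition muq (d n : nat) : K :=
  let D := divisors n in
  let k := (size D).-1 in
  let Z : 'M[K]_k.+1 := \matrix_(i, j) zetaq (nth 0%N D i) (nth 0%N D j) in
  invmx Z (inord (index d D)) (inord (index n D)).

Definition tauq (i n : nat) : K :=
  \sum_(d <- divisors i) muq 1 d * zetaq d n.

End Numbers.

(* The sum is divisible by 'X: every exponent in necklaceS 'X^k d is positive.
   The quotient is what makes P_{n,i,j}(q) meaningful at q = 0. *)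
Definition Ppoly (n i j : nat) : {poly rat} :=
  (j%:R / (gcdn i j)%:R *
   \sum_(d <- divisors (n %/ lcmn i j))
     tauq 'X (n %/ (lcmn i j * d)) (n %/ i)
       * necklaceS ('X ^+ (lcmn i j %/ j)) d) %/ 'X.

Definition Pnum (q : int) (n i j : nat) : rat := (Ppoly n i j).[q%:~R].

(* A ring A containing Q is given with its structural morphism phi. *)
Section QAlgebra.
Variables (q : int) (A : comPzRingType) (phi : {rmorphism rat -> A}).
Implicit Types x y a : nat -> A.

Let tau (i n : nat) : rat := tauq q%:~R i n.

Definition nr_mul x y : nat -> A := fun n =>
  \sum_(1 <= i < n.+1) \sum_(1 <= j < n.+1 | (lcmn i j %| n)%N)
    phi ((gcdn i j)%:R * Pnum q n i j) * x i * y j.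

Definition nr_frob (r : nat) x : nat -> A := fun n =>
  phi r%:R * \sum_(d <- divisors (r * n))
    phi (tau (r * n %/ lcmn r d) (r * n %/ d)) * x d.

Definition necklaceM (x : A) : nat -> A := fun n =>
  \sum_(d <- divisors n)
    phi (muq q%:~R d n * (q%:~R ^+ d.-1 / d%:R)) * x ^+ d.

(* V_n z vanishes at the index m >= 1 when n > m. *)
Definition Tmap a : nat -> A := fun m =>
  \sum_(1 <= n < m.+1) seqV n (necklaceM (a n)) m.

Definition ap_mul x y : nat -> A := fun n =>
  \sum_(1 <= i < n.+1) \sum_(1 <= j < n.+1 | (lcmn i j %| n)%N)
    phi ((n %/ lcmn i j)%:R * Pnum q n i j) * x i * y j.

Definition ap_ver (r : nat) x : nat -> A := fun n => seqV r x n *+ r.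

Definition ap_frob (r : nat) x : nat -> A := fun n =>
  phi r%:R * \sum_(d <- divisors (r * n))
    phi (tau (r * n %/ lcmn r d) (r * n %/ d) * (n%:R / d%:R)) * x d.

Definition thetamap x : nat -> A := fun n => x n *+ n.

Definition nr_subquotient (D : (nat -> A) -> Prop)
    (E : (nat -> A) -> (nat -> A) -> Prop) : fvring :=
  @FVRing (nat -> A) D E (fun x y n => x n + y n) nr_mul (@seqV A) nr_frob.

Definition ap_subquotient (D : (nat -> A) -> Prop)
    (E : (nat -> A) -> (nat -> A) -> Prop) : fvring :=
  @FVRing (nat -> A) D E (fun x y n => x n + y n) ap_mul ap_ver ap_frob.

Section Image.
Variables (R : comPzRingType) (iota : {rmorphism R -> A}).

Definition T_image (P : (nat -> R) -> Prop) (x : nat -> A) : Prop :=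
  exists2 a : nat -> R, P a & eqseq x (Tmap (iota \o a)).

Definition thetaT_image (P : (nat -> R) -> Prop) (x : nat -> A) : Prop :=
  exists2 y : nat -> A, T_image P y & eqseq x (thetamap y).

End Image.

End QAlgebra.

(* R (x) Q for R torsion-free: the pair (x, m) stands for x / (m + 1). *)
Section Rationalization.
Variables (R : comPzRingType) (tfR : torsion_free R).

Definition qfrac_equiv (x y : R * nat) : bool :=
  x.1 *+ y.2.+1 == y.1 *+ x.2.+1.

Lemma qfrac_refl : reflexive qfrac_equiv.
Proof. by move=> x; apply/eqP. Qed.

Lemma qfrac_sym : ssrbool.symmetric qfrac_equiv.
Proof. by move=> x y; rewrite /qfrac_equiv eq_sym. Qed.

Lemma qfrac_trans : transitive qfrac_equiv.
Proof.
move=> [y n] [x m] [z p] /eqP /= xy /eqP /= yz; apply/eqP => /=.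
apply/eqP; rewrite -subr_eq0; apply/eqP; apply: (tfR (n := n.+1)) => //.
by rewrite mulrnBl mulrnAC xy mulrnAC yz -!mulrnA mulnC subrr.
Qed.

Canonical qfrac_equivRel := EquivRel qfrac_equiv qfrac_refl qfrac_sym qfrac_trans.

Definition tensQ := {eq_quot qfrac_equiv}.
HB.instance Definition _ := Choice.on tensQ.

Definition qfrac (x : R) (m : nat) : tensQ := \pi_tensQ (x, m).

Lemma qfracP x m y n :
  reflect (x *+ n.+1 = y *+ m.+1) (qfrac x m == qfrac y n).
Proof. by rewrite /qfrac eqmodE; apply: eqP. Qed.

Lemma qfracW (P : tensQ -> Prop) : (forall x m, P (qfrac x m)) -> forall a, P a.
Proof. by move=> H; elim/quotW => -[x m]; exact: H. Qed.

Lemma qfrac_eq x m y n : x *+ n.+1 = y *+ m.+1 -> qfrac x m = qfrac y n.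
Proof. by move/qfracP/eqP. Qed.

Definition qdenM (m n : nat) : nat := (m.+1 * n.+1).-1.

Lemma qdenME m n : (qdenM m n).+1 = (m.+1 * n.+1)%N.
Proof. by []. Qed.

Definition tensQ_add (a b : tensQ) : tensQ :=
  let: (x, m) := repr a in let: (y, n) := repr b in
  qfrac (x *+ n.+1 + y *+ m.+1) (qdenM m n).

Definition tensQ_opp (a : tensQ) : tensQ :=
  let: (x, m) := repr a in qfrac (- x) m.

Definition tensQ_mul (a b : tensQ) : tensQ :=
  let: (x, m) := repr a in let: (y, n) := repr b in qfrac (x * y) (qdenM m n).

Lemma repr_qfrac x m : (repr (qfrac x m)).1 *+ m.+1
  = x *+ (repr (qfrac x m)).2.+1.
Proof.
have: qfrac (repr (qfrac x m)).1 (repr (qfrac x m)).2 == qfrac x m.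
  by rewrite /qfrac -surjective_pairing reprK.
by move/qfracP.
Qed.

Lemma qfracD x m y n : tensQ_add (qfrac x m) (qfrac y n) =
  qfrac (x *+ n.+1 + y *+ m.+1) (qdenM m n).
Proof.
rewrite /tensQ_add; move: (repr_qfrac x m) (repr_qfrac y n).
case: (repr _) => x' m' /= e; case: (repr _) => y' n' /= e'.
apply: qfrac_eq; rewrite !qdenME !mulrnDl -!mulrnA; congr (_ + _).
  have -> : (n'.+1 * (m.+1 * n.+1) = m.+1 * (n'.+1 * n.+1))%N by lia.
  by rewrite mulrnA e -mulrnA; congr (_ *+ _); lia.
have -> : (m'.+1 * (m.+1 * n.+1) = n.+1 * (m'.+1 * m.+1))%N by lia.
by rewrite mulrnA e' -mulrnA; congr (_ *+ _); lia.
Qed.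

Lemma qfracN x m : tensQ_opp (qfrac x m) = qfrac (- x) m.
Proof.
rewrite /tensQ_opp; move: (repr_qfrac x m); case: (repr _) => x' m' /= e.
by apply: qfrac_eq; rewrite !mulNrn e.
Qed.

Lemma qfracM x m y n :
  tensQ_mul (qfrac x m) (qfrac y n) = qfrac (x * y) (qdenM m n).
Proof.
rewrite /tensQ_mul; move: (repr_qfrac x m) (repr_qfrac y n).
case: (repr _) => x' m' /= e; case: (repr _) => y' n' /= e'.
apply: qfrac_eq; rewrite !qdenME mulrnA -mulrnAl e -mulrnAr e'.
by rewrite mulrnAl mulrnAr -mulrnA mulnC.
Qed.

Lemma tensQ_addA : associative tensQ_add.
Proof.
elim/qfracW => x m; elim/qfracW => y n; elim/qfracW => z p.
rewrite !qfracD; apply: qfrac_eq; rewrite !qdenME !mulrnDl -!mulrnA addrA.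
by congr (_ *+ _ + _ *+ _ + _ *+ _); lia.
Qed.

Lemma tensQ_addC : commutative tensQ_add.
Proof.
elim/qfracW => x m; elim/qfracW => y n; rewrite !qfracD.
by apply: qfrac_eq; rewrite !qdenME addrC mulnC.
Qed.

Lemma tensQ_add0 : left_id (qfrac 0 0) tensQ_add.
Proof.
elim/qfracW => x m; rewrite qfracD mul0rn add0r.
by apply: qfrac_eq; rewrite qdenME mul1n.
Qed.

Lemma tensQ_addN : left_inverse (qfrac 0 0) tensQ_opp tensQ_add.
Proof.
elim/qfracW => x m; rewrite qfracN qfracD; apply: qfrac_eq.
by rewrite mulNrn addNr !mul0rn.
Qed.

HB.instance Definition _ :=
  GRing.isZmodule.Build tensQ tensQ_addA tensQ_addC tensQ_add0 tensQ_addN.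

Lemma tensQ_mulA : associative tensQ_mul.
Proof.
elim/qfracW => x m; elim/qfracW => y n; elim/qfracW => z p.
by rewrite !qfracM; apply: qfrac_eq; rewrite !qdenME mulrA mulnA.
Qed.

Lemma tensQ_mulC : commutative tensQ_mul.
Proof.
elim/qfracW => x m; elim/qfracW => y n; rewrite !qfracM.
by apply: qfrac_eq; rewrite !qdenME mulrC mulnC.
Qed.

Lemma tensQ_mul1 : left_id (qfrac 1 0) tensQ_mul.
Proof.
elim/qfracW => x m; rewrite qfracM mul1r.
by apply: qfrac_eq; rewrite qdenME mul1n.
Qed.

Lemma tensQ_mulDl : left_distributive tensQ_mul tensQ_add.
Proof.
elim/qfracW => x m; elim/qfracW => y n; elim/qfracW => z p.
rewrite !(qfracM, qfracD); apply: qfrac_eq; rewrite !qdenME.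
rewrite mulrDl !mulrnDl !mulrnAl -!mulrnA.
by congr (_ *+ _ + _ *+ _); lia.
Qed.

HB.instance Definition _ := GRing.Zmodule_isComPzRing.Build tensQ
  tensQ_mulA tensQ_mulC tensQ_mul1 tensQ_mulDl.

Lemma qfrac_add x m y n :
  qfrac x m + qfrac y n = qfrac (x *+ n.+1 + y *+ m.+1) (qdenM m n).
Proof. exact: qfracD. Qed.

Lemma qfrac_opp x m : - qfrac x m = qfrac (- x) m.
Proof. exact: qfracN. Qed.

Lemma qfrac_mul x m y n : qfrac x m * qfrac y n = qfrac (x * y) (qdenM m n).
Proof. exact: qfracM. Qed.

Definition tensQ_in (x : R) : tensQ := qfrac x 0.

Lemma tensQ_in_zmod : zmod_morphism tensQ_in.
Proof. by move=> x y; rewrite /tensQ_in qfrac_opp qfrac_add. Qed.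

Lemma tensQ_in_monoid : monoid_morphism tensQ_in.
Proof. by split=> // x y; rewrite /tensQ_in qfrac_mul. Qed.

HB.instance Definition _ :=
  GRing.isZmodMorphism.Build R tensQ tensQ_in tensQ_in_zmod.
HB.instance Definition _ :=
  GRing.isMonoidMorphism.Build R tensQ tensQ_in tensQ_in_monoid.

Definition tensQ_rat (r : rat) : tensQ := qfrac (numq r)%:~R `|denq r|.-1.

Lemma tensQ_ratP (r : rat) : r * (`|denq r|.-1).+1%:R = (numq r)%:~R.
Proof.
rewrite prednK ?absz_gt0 ?denq_neq0 // numqE; congr (_ * _).
by rewrite -[LHS]/(`|denq r|%:Z%:~R) absz_denq.
Qed.

Lemma tensQ_ratE (r : rat) (z : int) (m : nat) :
  r * m.+1%:R = z%:~R -> tensQ_rat r = qfrac z%:~R m.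
Proof.
move=> e; apply: qfrac_eq; have := tensQ_ratP r; move: (`|_|.-1) => d e'.
have E : numq r * m.+1%:Z = z * d.+1%:Z.
  by apply: (@intr_inj rat); rewrite !intrM -!pmulrn -e -e' mulrAC.
by rewrite -[LHS]mulr_natr -[RHS]mulr_natr !pmulrn -!intrM E.
Qed.

Lemma tensQ_rat_zmod : zmod_morphism tensQ_rat.
Proof.
move=> r s; rewrite {2 3}/tensQ_rat; move: (tensQ_ratP r) (tensQ_ratP s).
move: (`|_|.-1) (`|_|.-1) => n m er es.
rewrite qfrac_opp qfrac_add.
rewrite (@tensQ_ratE _ (numq r * n.+1%:Z - numq s * m.+1%:Z) (qdenM m n)).
  by rewrite intrB !intrM -!pmulrn !mulr_natr mulNrn.
rewrite intrB !intrM -!pmulrn -er -es qdenME natrM mulrBl !mulrA.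
by congr (_ - _); rewrite mulrAC.
Qed.

Lemma tensQ_rat_monoid : monoid_morphism tensQ_rat.
Proof.
split=> [|r s]; first exact: (@tensQ_ratE 1 1 0%N).
rewrite {2 3}/tensQ_rat; move: (tensQ_ratP r) (tensQ_ratP s).
move: (`|_|.-1) (`|_|.-1) => n m er es.
rewrite qfrac_mul (@tensQ_ratE _ (numq r * numq s) (qdenM m n)) ?intrM //.
by rewrite -er -es qdenME natrM mulrACA.
Qed.

HB.instance Definition _ :=
  GRing.isZmodMorphism.Build rat tensQ tensQ_rat tensQ_rat_zmod.
HB.instance Definition _ :=
  GRing.isMonoidMorphism.Build rat tensQ tensQ_rat tensQ_rat_monoid.

End Rationalization.

(* Surjections R' -> R with R' torsion-free; cov_exists shows that every R has
   one (the polynomial ring over Z with one variable for each element of R). *)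
Record tf_cover (R : comPzRingType) := TFCover {
  cov_ring : comPzRingType;
  cov_tf : torsion_free cov_ring;
  cov_map : {rmorphism cov_ring -> R};
  cov_surj : forall y, exists x, cov_map x = y }.

Section CoverExists.
Import finmap monalg.
Variable S : comNzRingType.

Definition cov_monom (m : cmonom S) : S := \prod_(x <- finsupp m) x ^+ m x.

Lemma cov_monomE (m : cmonom S) (d : {fset S}) :
  fsubset (finsupp m) d -> cov_monom m = \prod_(x <- d) x ^+ m x.
Proof.
move=> le; rewrite /cov_monom (big_fset_incl _ le) //.
by move=> x _; rewrite -cmE_eq0 => /eqP ->.
Qed.

Lemma cov_monom_mmorphism : mmorphism cov_monom.
Proof.
split=> [m1 m2|]; last by rewrite /cov_monom mdom1 big_seq_fset0.
rewrite (@cov_monomE (mul m1 m2) (fsetU (finsupp m1) (finsupp m2))).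
  rewrite (cov_monomE (fsubsetUl _ (finsupp m2))).
  rewrite (cov_monomE (fsubsetUr (finsupp m1) _)).
  by rewrite -big_split /=; apply: eq_bigr => x _; rewrite cmM exprD.
by rewrite mdomD fsubset_refl.
Qed.

HB.instance Definition _ :=
  isMultiplicative.Build (cmonom S) S cov_monom cov_monom_mmorphism.

Definition cov_eval : {malg int[cmonom S]} -> S := mmap intr cov_monom.

HB.instance Definition _ := GRing.RMorphism.copy cov_eval (mmap intr cov_monom).

Lemma cov_exists_nz : inhabited (tf_cover S).
Proof.
constructor; apply: (@TFCover S {malg int[cmonom S]} _ cov_eval) => [n g n0 g0|x].
  apply/malgP => k; have /eqP := congr1 (mcoeff k) g0.
  by rewrite mcoeffMn mcoeff0 Num.Theory.mulrn_eq0 -[n == 0%N]negbK -lt0n n0 => /eqP.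
exists (mkmalgU (ucm x) 1); rewrite /= /cov_eval mmapU mul1r.
by rewrite /cov_monom mdomU big_seq_fset1 cmUU expr1.
Qed.
End CoverExists.

Lemma cov_exists (R : comPzRingType) : inhabited (tf_cover R).
Proof.
have [e|ne] := eqVneq (1 : R) 0; last first.
  case: R ne => T c; destruct c => ne.
  pose S : comNzRingType :=
    HB.pack T (GRing.ComPzRing.Pack (GRing.ComPzRing.Class _ _))
      (GRing.PzSemiRing_isNonZero.Build _ ne).
  exact: (cov_exists_nz S).
have z0 (x : R) : x = 0 by rewrite -[x]mulr1 e mulr0.
pose f (x : int) : R := 0.
have fa : zmod_morphism f by move=> x y; rewrite subr0.
have fm : monoid_morphism f by split=> [|x y]; rewrite /f ?e ?mulr0.
pose F : {rmorphism int -> R} := HB.pack f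
  (GRing.isZmodMorphism.Build int R f fa) (GRing.isMonoidMorphism.Build int R f fm).
constructor; apply: (@TFCover R int _ F) => [n x n0 /eqP|y].
  by rewrite Num.Theory.mulrn_eq0 -[n == 0%N]negbK -lt0n n0 => /eqP.
by exists 0; rewrite [RHS]z0.
Qed.

(* For R nonzero, a morphism rat -> R is injective, so that it embeds Q in R;
   the zero ring also falls in the first case. *)
Inductive ring_case (R : comPzRingType) : Type :=
  | ContainsQ of {rmorphism rat -> R}
  | TorsionFree of torsion_free R & ~ inhabited {rmorphism rat -> R}
  | HasTorsion of ~ torsion_free R.

Definition ring_caseP (R : comPzRingType) : ring_case R :=
  match excluded_middle_informative (inhabited {rmorphism rat -> R}) with
  | left h => ContainsQ (epsilon h (fun _ => True))
  | right notQ =>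
      match excluded_middle_informative (torsion_free R) with
      | left tf => TorsionFree tf notQ
      | right ntf => HasTorsion ntf
      end
  end.

Section Necklace.
Variables (q : int) (cover : forall R : comPzRingType, tf_cover R).

Definition tensQ_inR (R : comPzRingType) (tf : torsion_free R) :
  {rmorphism R -> tensQ tf} := tensQ_in tf.

Definition tensQ_ratR (R : comPzRingType) (tf : torsion_free R) :
  {rmorphism rat -> tensQ tf} := tensQ_rat tf.

Section Objects.
Variable R : comPzRingType.

(* The class of T^q(a') does not depend on the lift a' of a. *)
Definition cov_lift (y : R) : cov_ring (cover R) :=
  proj1_sig (constructive_indefinite_description _ (cov_surj (cover R) y)).

Let tfR' := @cov_tf R (cover R).
Let iota' := tensQ_inR tfR'.
Let phi' := tensQ_ratR tfR'.

Let in_ker (a : nat -> cov_ring (cover R)) : Prop :=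
  forall n, (0 < n)%N -> cov_map (cover R) (a n) = 0.

Definition delta_case (c : ring_case R) : fvring :=
  match c with
  | ContainsQ phi => nr_subquotient q phi (fun _ => True) (@eqseq R)
  | TorsionFree tf _ =>
      nr_subquotient q (tensQ_ratR tf)
        (T_image q (tensQ_ratR tf) (tensQ_inR tf) (fun _ => True))
        (@eqseq (tensQ tf))
  | HasTorsion _ =>
      nr_subquotient q phi'
        (T_image q phi' iota' (fun _ => True))
        (fun x y => T_image q phi' iota' in_ker (fun n => x n - y n))
  end.

Definition T_case (c : ring_case R) : (nat -> R) -> delta_case c :=
  match c with
  | ContainsQ phi => fun a => Tmap q phi a
  | TorsionFree tf _ => fun a => Tmap q (tensQ_ratR tf) (tensQ_inR tf \o a)
  | HasTorsion _ => fun a => Tmap q phi' (iota' \o (cov_lift \o a))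
  end.

Definition ap_case (c : ring_case R) : fvring :=
  match c with
  | ContainsQ phi => ap_subquotient q phi (fun _ => True) (@eqseq R)
  | TorsionFree tf _ =>
      ap_subquotient q (tensQ_ratR tf)
        (thetaT_image q (tensQ_ratR tf) (tensQ_inR tf) (fun _ => True))
        (@eqseq (tensQ tf))
  | HasTorsion _ =>
      ap_subquotient q phi'
        (thetaT_image q phi' iota' (fun _ => True))
        (fun x y => thetaT_image q phi' iota' in_ker (fun n => x n - y n))
  end.

Definition theta_case (c : ring_case R) : delta_case c -> ap_case c :=
  match c with
  | ContainsQ phi => fun x => thetamap x
  | TorsionFree tf _ => fun x => thetamap x
  | HasTorsion _ => fun x => thetamap x
  end.

Definition delta_ring : fvring := delta_case (ring_caseP R).
Definition ap_ring : fvring := ap_case (ring_caseP R).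

Definition T_map : witt_ring q R -> delta_ring := @T_case (ring_caseP R).
Definition theta_map : delta_ring -> ap_ring := @theta_case (ring_caseP R).

End Objects.

Definition Delta_functor : fvfunctor :=
  @FVFunctor delta_ring (fun A B f y =>
    T_map (f \o epsilon (inhabits (fun=> 0)) (fun a => eqv y (T_map a)))).

Definition AP_functor : fvfunctor :=
  @FVFunctor ap_ring (fun A B f y =>
    theta_map (T_map
      (f \o epsilon (inhabits (fun=> 0))
              (fun a => eqv y (theta_map (T_map a)))))).

Inductive functor_name := FW | FC | FDelta | FAP.

Definition named_functor (X : functor_name) : fvfunctor :=
  match X with
  | FW => W_functor q
  | FC => C_functor q
  | FDelta => Delta_functor
  | FAP => AP_functor
  end.

(* H^q, T^q, theta^q, their composites and their inverses. *)
Inductive canonical_equivalence : forall X Y : functor_name,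
    transformation (named_functor X) (named_functor Y) -> Prop :=
  | canonical_H : @canonical_equivalence FW FC (@Hmap q)
  | canonical_T : @canonical_equivalence FW FDelta T_map
  | canonical_theta : @canonical_equivalence FDelta FAP theta_map
  | canonical_comp X Y Z eta eps :
      @canonical_equivalence X Y eta -> @canonical_equivalence Y Z eps ->
      @canonical_equivalence X Z (fun R x => eps R (eta R x))
  | canonical_inv X Y eta eps :
      @canonical_equivalence X Y eta ->
      (forall R, is_inverse (eta R) (eps R)) ->
      @canonical_equivalence Y X eps.

End Necklace.

(* Main.v *)
(* Everything is pulled back to W^q along the canonical isomorphisms, and W^q is
   controlled by the ghost map Phi: over a torsion-free ring Phi is injective,
   and every ring is the quotient of a torsion-free one.

   - The universal polynomials of W^q exist by a form of Dwork's lemma. Since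
     q * Phi(a)_n = sum_(d | n) d (q a_d)^(n/d), for a prime p not dividing q the
     congruences are the classical ones; for p dividing q the factor
     q^(n/d - 1) makes every Phi(a)_n divisible by p^(v_p(n)), and this is the
     only condition at p.
   - The derivation t d/dt of the logarithm -log(1 - q X)/q of F_q sends H^q(a)
     to sum_n Phi(a)_n t^n. Hence H^q is additive, and the sum of the
     gamma(zeta_r^i t^(1/r)) has the ghost vector of f_r a.
   - T^q is Phi followed by the inverse of the linear map
     Psi(x)_n = sum_(d | n) d q^(n/d - 1) x_d. The numbers P_(n,i,j) and tau^q
     are such that Psi turns the multiplication and the Frobenius of Nr^q into
     the componentwise product and x |-> (x_(r n))_n. All these identities are
     Dirichlet convolution with the inverse nu of n |-> q^(n - 1), because
     mu^q(d, n) = (d/n) nu(n/d).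
   - The cases 2 and 3 of Delta^q and AP^q are subquotients of W^q(R'), and in
     all cases an element z is represented by a Witt vector a, unique up to
     equality in W^q(R). The operations, the functorial maps and all canonical
     equivalences preserve "a represents z", which gives the theorem. *)

Require Import Defs.
From HB Require Import structures.
From mathcomp Require Import all_boot all_order all_algebra all_field.
From mathcomp Require Import mpoly.
From mathcomp Require Import zify ring.
From Stdlib Require Import FunctionalExtensionality ClassicalEpsilon.
(* seq.eqseq would otherwise hide Defs.eqseq. *)
Import Defs.

Set Implicit Arguments.
Unset Strict Implicit.
Unset Printing Implicit Defensive.

Import GRing.Theory.
Local Open Scope ring_scope.

(** * Recursive sequences and the zero ring *)

(** The iterates of F on a constant sequence become stationary at index n after n + 1 steps, so
    their diagonal is a fixed point. It serves to solve triangular systems in which the entry n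
    depends on the earlier ones. *)
Lemma seq_recursion (T : Type) (x0 : T) (F : (nat -> T) -> nat -> T) :
  (forall a b n, (forall m, (m < n)%N -> a m = b m) -> F a n = F b n) ->
  exists a, forall n, a n = F a n.
Proof.
move=> Floc; pose it k := iter k F (fun=> x0).
have itE n : forall k, (n < k)%N -> it k n = it n.+1 n.
  elim/ltn_ind: n => n IHn [|k] // lt_nk; apply: Floc => m lt_mn.
  by transitivity (it m.+1 m); [apply: IHn|symmetry; apply: IHn] => //;
    exact: leq_trans lt_mn lt_nk.
exists (fun n => it n.+1 n) => n; apply: Floc => m lt_mn.
exact: itE.
Qed.

(** Separates off the zero ring, where every equation holds, from the nonzero rings, over which
    polynomial rings and their evaluation morphisms are formed. *)
Lemma comPz_ind (P : comPzRingType -> Prop) :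
  (forall S : comNzRingType, P S) ->
  (forall R : comPzRingType, (forall x y : R, x = y) -> P R) ->
  forall R, P R.
Proof.
move=> Pnz Pz R; have [e|ne] := eqVneq (1 : R) 0.
  by apply: Pz => x y; rewrite -[x]mulr1 -[y]mulr1 e !mulr0.
case: R ne => T c; destruct c => ne.
pose S : comNzRingType :=
  HB.pack T (GRing.ComPzRing.Pack (GRing.ComPzRing.Class _ _))
    (GRing.PzSemiRing_isNonZero.Build _ ne).
exact: (Pnz S).
Qed.

(** * Sums over divisors *)

Lemma dvdn_div_gt0 n d : (0 < n)%N -> (d %| n)%N -> (0 < n %/ d)%N.
Proof. by move=> n0 dn; rewrite divn_gt0 ?(dvdn_gt0 n0 dn) // dvdn_leq. Qed.

Section DivisorSums.
Variable V : nmodType.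
Implicit Types F : nat -> V.

Lemma sum_divisors_nat F n B : (0 < n)%N -> (n <= B)%N ->
  \sum_(d <- divisors n) F d = \sum_(1 <= d < B.+1 | (d %| n)%N) F d.
Proof.
move=> n0 le_nB; rewrite -[RHS]big_filter; apply: perm_big.
apply: uniq_perm; rewrite ?divisors_uniq ?filter_uniq ?iota_uniq // => d.
rewrite -dvdn_divisors // mem_filter mem_index_iota.
case: (boolP (d %| n)%N) => //= dn.
by rewrite (dvdn_gt0 n0 dn) ltnS (leq_trans (dvdn_leq n0 dn)).
Qed.

Lemma eq_sum_divisors F G n : (0 < n)%N -> (forall d, (d %| n)%N -> F d = G d) ->
  \sum_(d <- divisors n) F d = \sum_(d <- divisors n) G d.
Proof.
by move=> n0 FG; apply: eq_big_seq => d; rewrite -dvdn_divisors //; apply: FG.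
Qed.

Lemma sum_divisors_mul F l n : (0 < l)%N -> (0 < n)%N ->
  \sum_(d <- divisors (l * n) | (l %| d)%N) F d
    = \sum_(d <- divisors n) F (l * d)%N.
Proof.
move=> l0 n0; rewrite -(big_map (muln l) xpredT F) -[LHS]big_filter; apply: perm_big.
apply: uniq_perm.
- by rewrite filter_uniq ?divisors_uniq.
- by rewrite map_inj_uniq ?divisors_uniq // => x y /eqP; rewrite eqn_pmul2l // => /eqP.
move=> d; rewrite mem_filter -dvdn_divisors ?muln_gt0 ?l0 //.
apply/andP/mapP => [[/dvdnP[k ->]]|[k kn ->]].
  by rewrite mulnC dvdn_pmul2l // => kn; exists k; rewrite // -dvdn_divisors.
by rewrite dvdn_mulr ?dvdn_pmul2l // dvdn_divisors.
Qed.

Lemma sum_divisors_inv F n : (0 < n)%N ->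
  \sum_(d <- divisors n) F (n %/ d)%N = \sum_(d <- divisors n) F d.
Proof.
move=> n0; rewrite -(big_map (divn n) xpredT F); apply: perm_big.
have in_div d : (d \in divisors n) = (d %| n)%N by rewrite dvdn_divisors.
have divK d : (d %| n)%N -> (n %/ (n %/ d))%N = d.
  case/dvdnP=> k en; move: n0; rewrite en muln_gt0 => /andP[k0 d0].
  by rewrite mulnK // mulKn.
apply: uniq_perm; rewrite ?divisors_uniq //.
  rewrite map_inj_in_uniq ?divisors_uniq // => x y.
  by rewrite !in_div => xn yn e; rewrite -(divK x) // e divK.
move=> d; apply/mapP/idP => [[k]|]; rewrite in_div => dn.
  by move=> ->; rewrite in_div dvdn_div.
by exists (n %/ d)%N; rewrite ?in_div ?dvdn_div ?divK.
Qed.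

Lemma sum_divisors_dvd F m n : (0 < n)%N -> (m %| n)%N ->
  \sum_(d <- divisors n | (d %| m)%N) F d = \sum_(d <- divisors m) F d.
Proof.
move=> n0 mn; have m0 := dvdn_gt0 n0 mn.
rewrite big_mkcond (@sum_divisors_nat _ n n) // -big_mkcondr /=.
rewrite (@sum_divisors_nat _ m n) //; last exact: dvdn_leq.
by apply: eq_bigl => e; case: (boolP (e %| m)%N) => em; rewrite ?andbF // (dvdn_trans em mn).
Qed.

(* Associativity of Dirichlet convolution: both sides run over the
   factorizations n = e k m, with d = e k. *)
Lemma sum_divisorsA (F : nat -> nat -> V) n : (0 < n)%N ->
  \sum_(d <- divisors n) \sum_(e <- divisors d) F d e
    = \sum_(e <- divisors n) \sum_(k <- divisors (n %/ e)) F (e * k)%N e.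
Proof.
move=> n0.
transitivity (\sum_(d <- divisors n) \sum_(e <- divisors n | (e %| d)%N) F d e).
  by apply: eq_sum_divisors => // d dn; rewrite sum_divisors_dvd.
rewrite (exchange_big_dep xpredT) //=; apply: eq_sum_divisors => // e en.
have e0 := dvdn_gt0 n0 en; have le_en := dvdn_leq n0 en.
rewrite -(sum_divisors_mul (fun d => F d e)) ?divn_gt0 //.
by rewrite [(e * _)%N]mulnC divnK.
Qed.

Lemma sum_divisorsC (F : nat -> nat -> V) n : (0 < n)%N ->
  \sum_(d <- divisors n) F d (n %/ d)%N = \sum_(d <- divisors n) F (n %/ d)%N d.
Proof.
move=> n0; rewrite -[RHS]sum_divisors_inv //; apply: eq_sum_divisors => // d dn.
have [k ek] := dvdnP dn; move: n0; rewrite ek muln_gt0 => /andP[k0 d0].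
by rewrite mulnK // mulKn.
Qed.

(** Associativity in the form used for products of three arithmetic functions: the arguments of F
    are the factors of n = e k m. *)
Lemma sum_divisors3 (F : nat -> nat -> nat -> V) n : (0 < n)%N ->
  \sum_(d <- divisors n) \sum_(e <- divisors d) F e (d %/ e)%N (n %/ d)%N
    = \sum_(e <- divisors n) \sum_(k <- divisors (n %/ e)) F e k (n %/ e %/ k)%N.
Proof.
move=> n0; rewrite (sum_divisorsA (fun d e => F e (d %/ e)%N (n %/ d)%N)) //.
apply: eq_sum_divisors => // e en; apply: eq_sum_divisors => [|k kn].
  exact: dvdn_div_gt0.
by rewrite mulKn ?(dvdn_gt0 n0 en) // divnMA.
Qed.

Lemma sum_divisors_lt F n : (0 < n)%N ->
  \sum_(d <- divisors n) F d = F n + \sum_(d <- divisors n | (d < n)%N) F d.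
Proof.
move=> n0; rewrite (bigD1_seq n) ?divisors_uniq -?dvdn_divisors //=; congr (_ + _).
rewrite big_seq_cond [RHS]big_seq_cond; apply: eq_bigl => d.
rewrite -dvdn_divisors //; case: (boolP (d %| n)%N) => //= dn.
by rewrite ltn_neqAle dvdn_leq // andbT.
Qed.
End DivisorSums.

(** The indicator of 1 is the unit of Dirichlet convolution. *)
Lemma sum_divisors_delta (K : pzRingType) (F : nat -> K) n : (0 < n)%N ->
  \sum_(d <- divisors n) F d * (n %/ d == 1)%N%:R = F n.
Proof.
move=> n0; rewrite sum_divisors_lt // divnn n0 mulr1 big_seq_cond big1 ?addr0 // => d.
rewrite -dvdn_divisors // => /andP[dn lt_dn].
have [e|_] := eqVneq (n %/ d)%N 1%N; last by rewrite mulr0.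
by move: lt_dn; rewrite -[X in (_ < X)%N](divnK dn) e mul1n ltnn.
Qed.

(** * Dwork's lemma *)

Section Congruences.
Variable S : comPzRingType.
Implicit Types x y z : S.

Definition eqmodn (m : nat) x y : Prop := exists z, x = y + z *+ m.

Lemma eqmodn_refl m x : eqmodn m x x.
Proof. by exists 0; rewrite mul0rn addr0. Qed.

Lemma eqmodn_sym m x y : eqmodn m x y -> eqmodn m y x.
Proof. by case=> z ->; exists (- z); rewrite mulNrn addrK. Qed.

Lemma eqmodn_trans m x y z : eqmodn m x y -> eqmodn m y z -> eqmodn m x z.
Proof. by case=> u -> [v ->]; exists (v + u); rewrite mulrnDl addrA. Qed.

Lemma eqmodnD m x y x' y' : eqmodn m x y -> eqmodn m x' y' -> eqmodn m (x + x') (y + y').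
Proof. by case=> u -> [v ->]; exists (u + v); rewrite mulrnDl addrACA. Qed.

Lemma eqmodnN m x y : eqmodn m x y -> eqmodn m (- x) (- y).
Proof. by case=> u ->; exists (- u); rewrite mulNrn opprD. Qed.

Lemma eqmodnMl m z x y : eqmodn m x y -> eqmodn m (z * x) (z * y).
Proof. by case=> u ->; exists (z * u); rewrite mulrDr mulrnAr. Qed.

Lemma eqmodnM m x y x' y' : eqmodn m x y -> eqmodn m x' y' -> eqmodn m (x * x') (y * y').
Proof.
move=> xy xy'; apply: (@eqmodn_trans _ _ (x * y')); first exact: eqmodnMl.
by rewrite ![_ * y']mulrC; apply: eqmodnMl.
Qed.

Lemma eqmodnX m x y k : eqmodn m x y -> eqmodn m (x ^+ k) (y ^+ k).
Proof.
move=> xy; elim: k => [|k IHk]; first by rewrite !expr0; apply: eqmodn_refl.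
by rewrite !exprS; apply: eqmodnM.
Qed.

Lemma eqmodn_sum m (I : eqType) (r : seq I) (P : pred I) (F G : I -> S) :
  (forall i, i \in r -> P i -> eqmodn m (F i) (G i)) ->
  eqmodn m (\sum_(i <- r | P i) F i) (\sum_(i <- r | P i) G i).
Proof.
move=> FG; rewrite big_seq_cond [X in eqmodn _ _ X]big_seq_cond.
elim/big_ind2: _ => [||i /andP[ri Pi]]; first exact: eqmodn_refl.
  by move=> *; apply: eqmodnD.
exact: FG.
Qed.

Lemma eqmodn_sum0 m (I : eqType) (r : seq I) (P : pred I) (F : I -> S) :
  (forall i, i \in r -> P i -> eqmodn m (F i) 0) ->
  eqmodn m (\sum_(i <- r | P i) F i) 0.
Proof. by move/eqmodn_sum; rewrite big1_eq. Qed.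

Lemma eqmodn_dvd m n x y : (n %| m)%N -> eqmodn m x y -> eqmodn n x y.
Proof. by case/dvdnP=> k -> [z ->]; exists (z *+ k); rewrite mulrnA. Qed.

Lemma eqmodn_scale m d x y : eqmodn m x y -> eqmodn (d * m) (x *+ d) (y *+ d).
Proof. by case=> z ->; exists z; rewrite mulrnDl mulnC mulrnA. Qed.

Lemma eqmodn_subr0 m x y : eqmodn m x y <-> eqmodn m (x - y) 0.
Proof.
split=> [[z ->]|[z e]]; exists z; first by rewrite addrC addKr add0r.
by rewrite -(subrK y x) e add0r addrC.
Qed.

Lemma eqmodn_cancel a b x : coprime a b -> (0 < a)%N ->
  eqmodn b (x *+ a) 0 -> eqmodn b x 0.
Proof.
move=> cab a0 [z]; rewrite add0r => e; case: (egcdnP b a0) => u v euv _.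
exists (z *+ u - x *+ v); rewrite add0r mulrnBl -!mulrnA.
have -> : z *+ (u * b) = x *+ (u * a) by rewrite mulnC mulrnA -e -mulrnA mulnC.
by rewrite euv (eqP cab) mulrnDr addrC addKr.
Qed.

Lemma eqmodn_coprime m n x : coprime m n -> (0 < m)%N ->
  eqmodn m x 0 -> eqmodn n x 0 -> eqmodn (m * n) x 0.
Proof.
move=> cmn m0 [z]; rewrite add0r => -> [w e].
have [t] : eqmodn n z 0 by apply: (eqmodn_cancel cmn m0); exists w.
by rewrite add0r => ->; exists t; rewrite add0r -mulrnA mulnC.
Qed.

(** By induction on n: the part of n at its least prime divisor is coprime to the cofactor, and the
    cofactor has the valuations of n at its own primes. *)
Lemma eqmodn_local n x : (0 < n)%N ->
  (forall p, prime p -> (p %| n)%N -> eqmodn (p ^ logn p n) x 0) -> eqmodn n x 0.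
Proof.
elim/ltn_ind: n => n IHn n0 xp; case: (ltngtP n 1%N) => [|n1|->].
- by case: n n0 {IHn xp}.
- have pp := pdiv_prime n1; have pn := pdiv_dvd n; set p := pdiv n in pp pn.
  have [m cpm en] := pfactor_coprime pp n0.
  have v0 : (0 < logn p n)%N by rewrite logn_gt0 mem_primes pp n0 pn.
  have m0 : (0 < m)%N by move: n0; rewrite en muln_gt0 => /andP[].
  have cmp : coprime m (p ^ logn p n) by rewrite coprime_sym coprimeXl.
  rewrite [X in eqmodn X]en; apply: eqmodn_coprime => //; last exact: xp.
  apply: IHn => // [|r rp rm].
    by rewrite en ltn_Pmulr // -(expn0 p) ltn_exp2l ?prime_gt1.
  have -> : logn r m = logn r n.
    rewrite [in RHS]en lognM ?expn_gt0 ?(prime_gt0 pp) // lognX (logn_prime _ pp).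
    have [e|_] := eqVneq r p; last by rewrite muln0 addn0.
    by move: rm cpm; rewrite e prime_coprime // => ->.
  by apply: xp => //; rewrite en dvdn_mulr.
- by exists x; rewrite add0r.
Qed.

(** In x^p - y^p = (x - y) sum_i x^(p-1-i) y^i the first factor is divisible by p^k. Modulo p all p
    terms of the sum equal y^(p-1), so the second factor is divisible by p. *)
Lemma eqmodn_prime_exp p k x y : (0 < k)%N ->
  eqmodn (p ^ k) x y -> eqmodn (p ^ k.+1) (x ^+ p) (y ^+ p).
Proof.
case: p => [|p] k0 xy; first by rewrite !expr0; apply: eqmodn_refl.
apply/eqmodn_subr0; rewrite subrXX; move: xy => /eqmodn_subr0 [z]; rewrite add0r => e.
have [w ew] : eqmodn p.+1 (\sum_(i < p.+1) x ^+ (p.+1.-1 - i) * y ^+ i) 0.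
  have /eqmodn_sum H (i : 'I_p.+1) : i \in index_enum 'I_p.+1 -> xpredT i ->
     eqmodn p.+1 (x ^+ (p.+1.-1 - i) * y ^+ i) (y ^+ (p.+1.-1 - i) * y ^+ i).
    move=> _ _; apply: eqmodnM; last exact: eqmodn_refl.
    apply: eqmodnX; apply: (@eqmodn_dvd (p.+1 ^ k)); first by rewrite dvdn_exp.
    by apply/eqmodn_subr0; exists z; rewrite add0r.
  apply: (eqmodn_trans H); exists (y ^+ p); rewrite add0r.
  rewrite (eq_bigr (fun=> y ^+ p)) ?sumr_const ?card_ord // => i _.
  by rewrite -exprD subnK // -ltnS.
by exists (z * w); rewrite e ew !add0r mulrnAl mulrnAr -mulrnA expnS.
Qed.

(** With v = v_p(m), the power m is made of v successive p-th powers, each of which gains a factor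
    p, followed by one power prime to p. *)
Lemma eqmodn_ppow_exp p x y m : prime p -> (0 < m)%N -> eqmodn p x y ->
  eqmodn (p ^ (logn p m).+1) (x ^+ m) (y ^+ m).
Proof.
move=> pp m0 xy; have [k cpk em] := pfactor_coprime pp m0.
rewrite [X in _ ^+ X]em [X in eqmodn _ _ (_ ^+ X)]em mulnC !exprM; apply: eqmodnX.
elim: (logn p m) => [|j IHj]; first by rewrite expn0 expn1 !expr1.
by rewrite [(p ^ j.+1)%N]expnSr !exprM; apply: eqmodn_prime_exp.
Qed.

End Congruences.

Lemma eqmodn_rmorph (S T : comPzRingType) (f : {rmorphism S -> T}) m x y :
  eqmodn m x y -> eqmodn m (f x) (f y).
Proof. by case=> z ->; exists (f z); rewrite rmorphD rmorphMn. Qed.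

Definition frobenius_lift (S : comPzRingType) (p : nat) (psi : {rmorphism S -> S}) :=
  forall x, eqmodn p (psi x) (x ^+ p).

(** * Ghost components and their congruences *)

Section Dwork.
Variable q : int.

Section Ghost.
Variable R : comPzRingType.
Implicit Types a b : nat -> R.

(** The part of the ghost component that does not involve a_n; what remains is n a_n, so ghost
    equations are solved recursively. *)
Definition ghost_low a n : R :=
  \sum_(d <- divisors n | (d < n)%N) d%:R * q%:~R ^+ (n %/ d).-1 * a d ^+ (n %/ d).

Lemma ghost_lowE a n : (0 < n)%N -> ghost q a n = a n *+ n + ghost_low a n.
Proof.
move=> n0; rewrite /ghost sum_divisors_lt // divnn n0 expr0 expr1 mulr1.
by rewrite mulr_natl.
Qed.

Lemma eq_ghost_low a b n : (forall m, (0 < m < n)%N -> a m = b m) ->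
  ghost_low a n = ghost_low b n.
Proof.
move=> ab; case: n ab => [_|n ab]; first by rewrite /ghost_low !big_pred0.
rewrite /ghost_low big_seq_cond [RHS]big_seq_cond; apply: eq_bigr => d.
by rewrite -dvdn_divisors // => /andP[dn lt_dn]; rewrite ab // lt_dn (dvdn_gt0 _ dn).
Qed.

Lemma eq_ghost a b n : (forall m, (0 < m <= n)%N -> a m = b m) ->
  ghost q a n = ghost q b n.
Proof.
(* At the irrelevant index 0 all exponents vanish, and the entries do not matter. *)
case: n => [_|n ab]; first by apply: eq_bigr => d _; rewrite div0n !expr0.
rewrite !ghost_lowE // ab ?ltnS ?leqnn //; congr (_ + _); apply: eq_ghost_low => m /andP[m0 mn].
by apply: ab; rewrite m0 ltnW.
Qed.

(** Once the earlier entries agree, the equation at n reduces to n a_n = n b_n. The bound N allows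
    its use inside inductions where the ghost equations are known only up to some index. *)
Lemma ghost_inj_upto a b N : torsion_free R ->
  (forall n, (0 < n <= N)%N -> ghost q a n = ghost q b n) ->
  forall n, (0 < n <= N)%N -> a n = b n.
Proof.
move=> tf ab; elim/ltn_ind=> n IHn /andP[n0 nN].
have := ab n; rewrite n0 nN => /(_ isT); rewrite !ghost_lowE // (@eq_ghost_low a b).
  by move/addIr/eqP; rewrite -subr_eq0 -mulrnBl => /eqP/(tf _ _ n0)/eqP; rewrite subr_eq0 => /eqP.
by move=> m /andP[m0 mn]; apply: IHn; rewrite // m0 ltnW // (leq_trans mn).
Qed.

Lemma ghost_inj a b : torsion_free R ->
  (forall n, (0 < n)%N -> ghost q a n = ghost q b n) -> eqseq a b.
Proof.
move=> tf ab n n0; apply: (@ghost_inj_upto a b n) => //; last by rewrite n0 leqnn.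
by move=> m /andP[m0 _]; apply: ab.
Qed.

Lemma ghostMq a n : (0 < n)%N ->
  q%:~R * ghost q a n = \sum_(d <- divisors n) (q%:~R * a d) ^+ (n %/ d) *+ d.
Proof.
move=> n0; rewrite mulr_sumr; apply: eq_sum_divisors => // d dn.
have k0 := dvdn_div_gt0 n0 dn.
rewrite exprMn -[in q%:~R ^+ (n %/ d)%N](prednK k0) exprS -[RHS]mulr_natl.
by rewrite -!mulrA [LHS]mulrCA.
Qed.

End Ghost.

Lemma rmorph_ghost (R T : comPzRingType) (f : {rmorphism R -> T}) a n :
  f (ghost q a n) = ghost q (f \o a) n.
Proof.
rewrite /ghost rmorph_sum; apply: eq_bigr => d _.
by rewrite !rmorphM !rmorphXn /= rmorph_nat rmorph_int.
Qed.

Lemma int_mul_absz (S : comPzRingType) (x : S) :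
  q%:~R * x = x *+ `|q|%N \/ q%:~R * x = - (x *+ `|q|%N).
Proof.
case: (intP q) => [|n|n]; first by left; rewrite mul0r.
  by left; rewrite mulr_natl.
by right; rewrite abszN mulrNz mulNr mulr_natl.
Qed.

(** Dwork's congruences adapted to q; for q = 0 every prime falls under the divisibility condition.
    They are preserved by any operation that respects congruences, commutes with ring morphisms and
    sends (0, 0) to 0. *)
Definition ghost_like (S : comPzRingType) (G : nat -> S) : Prop :=
  forall (p n : nat) (psi : {rmorphism S -> S}), frobenius_lift p psi ->
    prime p -> (0 < n)%N -> (p %| n)%N ->
    eqmodn (p ^ logn p n) (G n) (if (p %| `|q|)%N then 0 else psi (G (n %/ p)%N)).

Lemma ghost_ghost_like (S : comPzRingType) (a : nat -> S) : ghost_like (ghost q a).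
Proof.
move=> p n psi lift pp n0 pn; have p1 := prime_gt1 pp.
have v0 : (0 < logn p n)%N by rewrite logn_gt0 mem_primes pp n0 pn.
have np0 := dvdn_div_gt0 n0 pn.
case: ifP => pq.
  have {pq} /dvdnP[c eqc] := pq.
  have [w ew] : exists w : S, q%:~R = w *+ p.
    have := int_mul_absz (1 : S); rewrite mulr1 eqc => -[] ->.
      by exists (1 *+ c); rewrite mulrnA.
    by exists (- (1 *+ c)); rewrite mulrnA mulNrn.
  apply: eqmodn_sum0 => d; rewrite -dvdn_divisors // => dn _.
  have d0 := dvdn_gt0 n0 dn.
  have k0 := dvdn_div_gt0 n0 dn.
  have lognE : (logn p n = logn p d + logn p (n %/ d))%N.
    by rewrite -lognM // mulnC divnK.
  (* The coefficient d provides p^(v_p(d)) and the power of q provides p^(n/d - 1); this is enough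
     because v_p(n/d) <= n/d - 1. *)
  apply: (@eqmodn_dvd _ (d * p ^ (n %/ d).-1)).
    rewrite lognE expnD dvdn_mul ?pfactor_dvdnn // dvdn_exp2l //.
    have: (p ^ logn p (n %/ d) <= n %/ d)%N by apply: dvdn_leq; rewrite ?pfactor_dvdnn.
    by have := ltn_expl (logn p (n %/ d)) p1; lia.
  exists (w ^+ (n %/ d).-1 * a d ^+ (n %/ d)); rewrite add0r ew exprMn_n.
  by rewrite mulr_natl mulnC mulrnA -mulrnAl -mulrnAl.
move/negbT: pq => pq.
have cqp : coprime `|q|%N (p ^ logn p n) by rewrite coprime_sym coprimeXl // prime_coprime.
have q0 : (0 < `|q|)%N by rewrite lt0n; apply: contra pq => /eqP ->.
(* Since q is prime to p, both sides may be multiplied by q, which produces the classical ghost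
   components of q a. *)
apply/eqmodn_subr0; apply: (eqmodn_cancel cqp q0).
suff: eqmodn (p ^ logn p n) (q%:~R * (ghost q a n - psi (ghost q a (n %/ p)%N))) 0.
  have [->//|-> /eqmodnN] := int_mul_absz (ghost q a n - psi (ghost q a (n %/ p)%N)).
  by rewrite opprK oppr0.
rewrite mulrBr; apply: (proj1 (eqmodn_subr0 _ _ _)).
have -> : q%:~R * psi (ghost q a (n %/ p)%N) = psi (q%:~R * ghost q a (n %/ p)%N).
  by rewrite rmorphM rmorph_int.
(* A divisor d of n that does not divide n/p has v_p(d) = v_p(n), so its term vanishes modulo the
   prime power. The other divisors are exactly those of n/p, and they are compared term by term. *)
rewrite !ghostMq // rmorph_sum (bigID (fun d => d %| n %/ p)%N) /=.
rewrite -[X in eqmodn _ _ X]addr0; apply: eqmodnD; last first.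
  apply: eqmodn_sum0 => d; rewrite -dvdn_divisors // => dn dnp.
  apply: (@eqmodn_dvd _ d); last by exists ((q%:~R * a d) ^+ (n %/ d)); rewrite add0r.
  have d0 := dvdn_gt0 n0 dn.
  have k0 := dvdn_div_gt0 n0 dn.
  have <- : logn p d = logn p n; last exact: pfactor_dvdnn.
  rewrite -[in RHS](divnK dn) lognM //.
  suff -> : logn p (n %/ d) = 0%N by [].
  apply/eqP; rewrite -leqn0 leqNgt logn_gt0 mem_primes pp k0 /=.
  apply: contra dnp => /dvdnP[c ec]; apply/dvdnP; exists c.
  by rewrite -[n in (n %/ p)%N](divnK dn) ec mulnAC mulnK // prime_gt0.
rewrite -(@sum_divisors_dvd _ _ (n %/ p) n) ?dvdn_div //.
apply: eqmodn_sum => d; rewrite -dvdn_divisors // => dn dnp.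
have d0 := dvdn_gt0 n0 dn.
rewrite rmorphMn rmorphXn.
have k0 := dvdn_div_gt0 np0 dnp.
have -> : (n %/ d = p * (n %/ p %/ d))%N.
  by apply/eqP; rewrite -(eqn_pmul2r d0) -mulnA !divnK // mulnC divnK.
(* With y = q a_d and k = n/(p d), the congruence between y^p and psi(y) modulo p becomes one modulo
   p^(v_p(k) + 1) after raising to the power k; the coefficient d supplies the remaining powers of
   p. *)
rewrite exprM; apply: (@eqmodn_dvd _ (d * p ^ (logn p (n %/ p %/ d)).+1)).
  have -> : logn p n = (logn p d + (logn p (n %/ p %/ d)).+1)%N.
    rewrite -[in LHS](divnK pn) -[in LHS](divnK dnp) !lognM // ?muln_gt0 ?k0 ?(prime_gt0 pp) //.
    by rewrite (logn_prime _ pp) eqxx; lia.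
  by rewrite expnD dvdn_mul ?pfactor_dvdnn.
apply: eqmodn_scale; apply: eqmodn_ppow_exp => //.
exact/eqmodn_sym/lift.
Qed.

(** The entries are found one after the other. At each prime dividing n, [G] and the ghost vector of
    the solution satisfy congruences with the same right-hand side, the earlier components being
    equal, so the difference is divisible by n. *)
Lemma dwork (S : comPzRingType) (G : nat -> S) : torsion_free S ->
  (forall p, prime p -> exists psi : {rmorphism S -> S}, frobenius_lift p psi) ->
  ghost_like G -> exists a, forall n, (0 < n)%N -> ghost q a n = G n.
Proof.
move=> tf lifts likeG.
(* A chosen quotient by n; that the quotient exists is proved only afterwards, along the
   induction. *)
pose step (a : nat -> S) n : S :=
  epsilon (inhabits 0) (fun y => y *+ n = G n - ghost_low a n).
have loc a b n : (forall m, (m < n)%N -> a m = b m) -> step a n = step b n.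
  by move=> ab; rewrite /step (@eq_ghost_low _ a b) // => m /andP[_]; apply: ab.
have [a aE] := seq_recursion 0 loc.
exists a; elim/ltn_ind => n IHn n0; rewrite ghost_lowE //.
suff ex : exists y, y *+ n = G n - ghost_low a n.
  by rewrite aE (epsilon_spec (inhabits 0) _ ex) subrK.
(* Whatever the value of [a n], it enters the component of index n through the multiple n a_n only,
   so divisibility of this difference gives that of [G n - ghost_low a n]. *)
have [z] : eqmodn n (G n - ghost q a n) 0.
  apply: eqmodn_local => // p pp pn; apply: (proj1 (eqmodn_subr0 _ _ _)).
  have [psi lift] := lifts p pp.
  apply: (eqmodn_trans (likeG _ _ _ lift pp n0 pn)); apply: eqmodn_sym.
  have := ghost_ghost_like a lift pp n0 pn; case: ifP => // _.
  by rewrite (IHn (n %/ p)%N) ?ltn_Pdiv ?prime_gt1 // dvdn_div_gt0.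
rewrite add0r ghost_lowE // => e; exists (z + a n).
by rewrite mulrnDl -e opprD addrA addrAC subrK.
Qed.
End Dwork.

(** * Frobenius lifts on integral polynomial rings *)

Section FrobeniusLiftMpoly.
Variable k : nat.
Notation S := {mpoly int[k]}.

Lemma mpoly_int_torsion_free : torsion_free S.
Proof.
move=> n x n0 xn0; apply/mpolyP => m.
have /eqP := congr1 (mcoeff m) xn0; rewrite mcoeffMn mcoeff0.
by rewrite Num.Theory.mulrn_eq0 eqn0Ngt n0 => /eqP.
Qed.

Lemma eqmodn_exprD (R : comPzRingType) p (x y : R) : prime p ->
  eqmodn p ((x + y) ^+ p) (x ^+ p + y ^+ p).
Proof.
move=> pp; case: p pp => // p pp.
rewrite exprDn big_ord_recl big_ord_recr /= /bump /= add1n subnn subn0 expr0 bin0 binn.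
rewrite mulr1 mul1r !mulr1n -[x ^+ _ + y ^+ _]addr0 addrCA addrA [_ + x ^+ _]addrC -addrA.
rewrite -[X in eqmodn _ _ X]addrA; apply: eqmodnD; first exact: eqmodn_refl.
rewrite addrC; apply: eqmodnD; first exact: eqmodn_refl.
apply: eqmodn_sum0 => i _ _; have /dvdnP[c ->] : (p.+1 %| 'C(p.+1, bump 0 i))%N.
  by apply: prime_dvd_bin; rewrite // /bump /= add1n ltnS ltn_ord.
by exists (x ^+ (p.+1 - bump 0 i) * y ^+ bump 0 i *+ c); rewrite add0r mulrnA.
Qed.

(** Fermat's little theorem, by induction on c through [eqmodn_exprD]. *)
Lemma eqmodn_int p (c : int) : prime p -> eqmodn p (c ^+ p) c.
Proof.
move=> pp; case: p pp => // p pp.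
elim/int_ind: c => [|n IHn|n IHn]; first by rewrite expr0n; apply: eqmodn_refl.
  rewrite intS; apply: eqmodn_trans (eqmodn_exprD _ _ pp) _.
  by rewrite expr1n; apply: eqmodnD; first exact: eqmodn_refl.
have -> : - n.+1%:Z = - 1 + - n%:Z by rewrite intS opprD.
apply: eqmodn_trans (eqmodn_exprD _ _ pp) _; apply: eqmodnD => //.
(* For p = 2 the signs differ, and 1 = -1 + 2. *)
have [->|odd_p] := even_prime pp; first by exists 1.
by rewrite -signr_odd odd_p; apply: eqmodn_refl.
Qed.

(** The substitution of X_i^p for X_i fixes the coefficients. It lifts the Frobenius by Fermat's
    theorem on coefficients and by additivity of the p-th power modulo p. *)
Lemma mpoly_frobenius_lift p : prime p ->
  exists psi : {rmorphism S -> S}, frobenius_lift p psi.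
Proof.
move=> pp; exists (mmap (@mpolyC k int) (fun i => 'X_i ^+ p) : {rmorphism S -> S}).
move=> x; elim/mpolyind: x => [|c m x _ _ IHx].
  by rewrite raddf0 expr0n; case: p pp => // p _; apply: eqmodn_refl.
rewrite raddfD /=; apply: eqmodn_trans (eqmodn_sym (eqmodn_exprD _ _ pp)).
apply: eqmodnD; last exact: IHx.
rewrite mmapZ mmapX -mul_mpolyC exprMn; apply: eqmodnM.
  by rewrite -rmorphXn; apply: eqmodn_rmorph; apply/eqmodn_sym/eqmodn_int.
rewrite /mmap1 mpolyXE_id -prodrXl -(eq_bigr _ (fun i _ => exprAC _ _ _)).
exact: eqmodn_refl.
Qed.
End FrobeniusLiftMpoly.

(** * Universal polynomials *)

Lemma rmorph_upoly_eval (R T : comPzRingType) (f : {rmorphism R -> T}) k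
    (v : 'I_k -> R) p : f (upoly_eval v p) = upoly_eval (f \o v) p.
Proof.
rewrite /upoly_eval rmorph_sum; apply: eq_bigr => m _.
rewrite rmorphM rmorph_int rmorph_prod; congr (_ * _).
by apply: eq_bigr => i _; rewrite rmorphXn.
Qed.

Lemma eq_upoly_eval (R : comPzRingType) k (v w : 'I_k -> R) p :
  v =1 w -> upoly_eval v p = upoly_eval w p.
Proof.
by move=> vw; apply: eq_bigr => m _; congr (_ * _); apply: eq_bigr => i _; rewrite vw.
Qed.

Lemma upoly_evalX k (p : {mpoly int[k]}) :
  upoly_eval (fun i => 'X_i : {mpoly int[k]}) p = p.
Proof.
rewrite [RHS]mpolyE; apply: eq_bigr => m _.
rewrite mpolyXE_id -mul_mpolyC; congr (_ * _).
by rewrite -[in RHS](intz p@_m) rmorph_int.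
Qed.

Lemma upoly_eval_morphism (S : comNzRingType) k (v : 'I_k -> S) :
  exists h : {rmorphism {mpoly int[k]} -> S},
    (forall p, h p = upoly_eval v p) /\ (forall i, h 'X_i = v i).
Proof.
exists (mmap intr v : {rmorphism {mpoly int[k]} -> S}); split=> [p|i]; first by [].
by rewrite /= mmapX mmap1U.
Qed.

Section UniversalWitt.
Variable q : int.

(* It suffices to solve the ghost equations for one generic input x in
   int[X_1 .. X_(k n)] for each n: the polynomial of index n is the n-th entry
   of the solution, and the uniqueness of the solution over a torsion-free ring
   makes the polynomials obtained for different n compatible. *)
Lemma universal_witt (k : nat -> nat) (I : comPzRingType -> Type)
    (var : forall R, I R -> forall n, 'I_(k n) -> R)
    (G : forall R, I R -> nat -> R) :
  (forall n, (0 < n)%N -> exists x : I {mpoly int[k n]},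
    [/\ forall i, var _ x n i = 'X_i, ghost_like q (G _ x) &
     forall (R : comNzRingType) (y : I R) (h : {rmorphism {mpoly int[k n]} -> R}),
       (forall i, h 'X_i = var _ y n i) -> forall m, (0 < m <= n)%N ->
       h (G _ x m) = G _ y m /\ forall i, h (var _ x m i) = var _ y m i]) ->
  exists p : forall n, {mpoly int[k n]}, forall R (y : I R) n, (0 < n)%N ->
    ghost q (fun m => upoly_eval (var _ y m) (p m)) n = G _ y n.
Proof.
move=> gen.
have sol n : exists p : {mpoly int[k n]}, (0 < n)%N ->
    exists (x : I {mpoly int[k n]}) (a : nat -> {mpoly int[k n]}),
    [/\ forall i, var _ x n i = 'X_i, forall m, (0 < m)%N -> ghost q a m = G _ x m,
     p = a n &
     forall (R : comNzRingType) (y : I R) (h : {rmorphism {mpoly int[k n]} -> R}),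
       (forall i, h 'X_i = var _ y n i) -> forall m, (0 < m <= n)%N ->
       h (G _ x m) = G _ y m /\ forall i, h (var _ x m i) = var _ y m i].
  case: (posnP n) => [->|n0]; first by exists 0.
  have [x [xX likeG xh]] := gen n n0.
  have [a aG] := dwork (@mpoly_int_torsion_free _) (@mpoly_frobenius_lift _) likeG.
  by exists (a n) => _; exists x, a.
pose p n := proj1_sig (constructive_indefinite_description _ (sol n)).
exists p => R y n; elim/ltn_ind: n R y => n IHn; elim/comPz_ind => [R y n0|R zR *]; last exact: zR.
have := proj2_sig (constructive_indefinite_description _ (sol n)).
rewrite -/(p n) => /(_ n0) [x [a [xX aG pa xh]]].
have [h [hE hX]] := upoly_eval_morphism (var _ y n).
have pE m : (0 < m <= n)%N -> upoly_eval (var _ x m) (p m) = a m.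
  move=> /andP[m0]; rewrite leq_eqVlt => /orP[/eqP ->|mn].
    by rewrite -pa -[RHS]upoly_evalX; apply: eq_upoly_eval.
  apply: (@ghost_inj_upto q _ (fun j => upoly_eval (var _ x j) (p j)) a m).
  - exact: mpoly_int_torsion_free.
  - move=> j /andP[j0 jm]; rewrite aG // IHn //; exact: leq_ltn_trans jm mn.
  - by rewrite m0 leqnn.
have nn : (0 < n <= n)%N by rewrite n0 leqnn.
have [<- _] := xh _ y h hX n nn.
rewrite -aG // rmorph_ghost; apply: eq_ghost => m mn /=.
have [_ xhm] := xh _ y h hX m mn.
by rewrite -pE // rmorph_upoly_eval; apply: eq_upoly_eval => i /=.
Qed.

(** A generic vector with finitely many variables, indexed with the same shift as [vars1]. The
    entries beyond n, set to 0, do not enter the ghost components of index at most n. *)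
Definition generic_seq k n (v : 'I_n -> 'I_k) (i : nat) : {mpoly int[k]} :=
  if i is i'.+1 then if insub i' is Some j then 'X_(v j) else 0 else 0.

Lemma generic_seqS k n (v : 'I_n -> 'I_k) (i : 'I_n) : generic_seq v i.+1 = 'X_(v i).
Proof.
rewrite /generic_seq; case: insubP => [j _ ji|]; last by rewrite ltn_ord.
by congr 'X_(v _); apply: val_inj.
Qed.

Lemma generic_seqE k n (v : 'I_n -> 'I_k) m (mn : (m < n)%N) :
  generic_seq v m.+1 = 'X_(v (Ordinal mn)).
Proof. by rewrite -generic_seqS. Qed.

(** The generic input is a pair of vectors in n + n independent variables. The three hypotheses say
    that [op], applied componentwise, keeps sequences ghost-like. *)
Lemma witt_op_exists (op : forall R : comPzRingType, R -> R -> R) :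
  (forall (R T : comPzRingType) (f : {rmorphism R -> T}) x y,
     f (op R x y) = op T (f x) (f y)) ->
  (forall (R : comPzRingType) m (x x' y y' : R), eqmodn m x x' -> eqmodn m y y' ->
     eqmodn m (op R x y) (op R x' y')) ->
  (forall R : comPzRingType, op R 0 0 = 0) ->
  exists p, witt_op_spec q op p.
Proof.
move=> opf opm op0.
have [|p pP] := @universal_witt (fun n => n + n)%N
  (fun R => ((nat -> R) * (nat -> R))%type) (fun R y n => vars2 y.1 y.2)
  (fun R y n => op R (ghost q y.1 n) (ghost q y.2 n)).
  move=> n n0; exists (generic_seq (@lshift n n), generic_seq (@rshift n n)); split.
  - move=> i; rewrite -[in RHS](splitK i) /vars2.
    by case: (split i) => j; apply: generic_seqS.
  - move=> p m psi lift pp m0 pm.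
    have ha := @ghost_ghost_like q _ (generic_seq (@lshift n n)) _ _ _ lift pp m0 pm.
    have hb := @ghost_ghost_like q _ (generic_seq (@rshift n n)) _ _ _ lift pp m0 pm.
    move: ha hb.
    case: (p %| `|q|)%N => ha hb.
      by have := opm _ _ _ _ _ _ ha hb; rewrite (op0 {mpoly int[n + n]}).
    by have := opm _ _ _ _ _ _ ha hb; rewrite -(opf _ _ psi).
  move=> R y h hX m /andP[m0 mn].
  have hl j : (0 < j <= m)%N -> h (generic_seq (@lshift n n) j) = y.1 j.
    case: j => // j /andP[_ jm]; rewrite (generic_seqE _ (leq_trans jm mn)) hX /vars2.
    by rewrite (unsplitK (inl _)).
  have hr j : (0 < j <= m)%N -> h (generic_seq (@rshift n n) j) = y.2 j.
    case: j => // j /andP[_ jm]; rewrite (generic_seqE _ (leq_trans jm mn)) hX /vars2.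
    by rewrite (unsplitK (inr _)).
  split.
    have gl : h (ghost q (generic_seq (@lshift n n)) m) = ghost q y.1 m.
      by rewrite (rmorph_ghost q h); apply: eq_ghost.
    have gr : h (ghost q (generic_seq (@rshift n n)) m) = ghost q y.2 m.
      by rewrite (rmorph_ghost q h); apply: eq_ghost.
    by rewrite -gl -gr; apply: opf.
  by move=> i; rewrite /vars2; case: (split i) => j;
    [exact: hl j.+1 (ltn_ord j)|exact: hr j.+1 (ltn_ord j)].
by exists p => R a b n n0; exact: (pP R (a, b) n n0).
Qed.

(** The shifted sequence m |-> Phi(a)_(r m) is again ghost-like, because v_p(m) <= v_p(r m) and (r
    m)/p = r (m/p). *)
Lemma witt_frob_exists r : (0 < r)%N -> exists p, @witt_frob_spec q r p.
Proof.
move=> r0; have [|p pP] := @universal_witt (fun n => r * n)%N (fun R => nat -> R)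
  (fun R y n => vars1 y) (fun R y n => ghost q y (r * n)).
  move=> n n0; exists (generic_seq id); split.
  - by move=> i; rewrite /vars1 generic_seqS.
  - move=> p m psi lift pp m0 pm.
    have rm0 : (0 < r * m)%N by rewrite muln_gt0 r0.
    have := @ghost_ghost_like q _ (generic_seq id) _ _ _ lift pp rm0 (dvdn_mull r pm).
    rewrite muln_divA //; apply: eqmodn_dvd.
    by rewrite dvdn_exp2l // lognM // leq_addl.
  move=> R y h hX m /andP[m0 mn].
  have hj j : (0 < j <= r * m)%N -> h (generic_seq id j) = y j.
    have le_rm : (r * m <= r * n)%N by rewrite leq_mul2l mn orbT.
    by case: j => // j /andP[_ jm]; rewrite (generic_seqE _ (leq_trans jm le_rm)) hX.
  split; first by rewrite rmorph_ghost; apply: eq_ghost.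
  by move=> i; exact: hj i.+1 (ltn_ord i).
by exists p => R a n n0; exact: (pP R a n n0).
Qed.

Lemma witt_add_polyP : witt_op_spec q (fun R => @GRing.add R) (witt_add_poly q).
Proof.
apply: epsilon_spec; apply: witt_op_exists => [R T f x y|R *|R]; last exact: addr0.
  exact: rmorphD.
exact: eqmodnD.
Qed.

Lemma witt_mul_polyP : witt_op_spec q (fun R => @GRing.mul R) (witt_mul_poly q).
Proof.
apply: epsilon_spec; apply: witt_op_exists => [R T f x y|R *|R]; last exact: mulr0.
  exact: rmorphM.
exact: eqmodnM.
Qed.

Lemma witt_frob_polyP r : (0 < r)%N -> witt_frob_spec q (witt_frob_poly q r).
Proof. by move=> r0; apply: epsilon_spec; apply: witt_frob_exists. Qed.

(** Negation is treated as a binary operation that ignores its second argument, so that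
    [witt_op_exists] applies. *)
Lemma witt_opp_exists : exists p, witt_op_spec q (fun R (x _ : R) => - x) p.
Proof.
apply: witt_op_exists => [R T f x _|R m x x' y y' xx' _|R]; last exact: oppr0.
  exact: rmorphN.
exact: eqmodnN.
Qed.

End UniversalWitt.

(** * The ring of q-Witt vectors *)

Lemma lift_seq (S R : Type) (f : S -> R) (a : nat -> R) :
  (forall y, exists x, f x = y) -> exists a', a = f \o a'.
Proof.
move=> f_surj.
exists (fun n => proj1_sig (constructive_indefinite_description _ (f_surj (a n)))).
apply: functional_extensionality => n /=.
by rewrite (proj2_sig (constructive_indefinite_description _ (f_surj (a n)))).
Qed.

Lemma cov_lift_seq (R : comPzRingType) (cov : tf_cover R) (a : nat -> R) :
  exists a' : nat -> cov_ring cov, a = cov_map cov \o a'.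
Proof. exact: lift_seq (cov_surj cov). Qed.

Section WittRing.
Variable q : int.

Section GhostMorphism.
Variable R : comPzRingType.
Implicit Types a b : nat -> R.

Lemma ghost_add a b n : (0 < n)%N ->
  ghost q (witt_add q a b) n = ghost q a n + ghost q b n.
Proof. exact: (witt_add_polyP q a b). Qed.

Lemma ghost_mul a b n : (0 < n)%N ->
  ghost q (witt_mul q a b) n = ghost q a n * ghost q b n.
Proof. exact: (witt_mul_polyP q a b). Qed.

Lemma ghost_frob r a n : (0 < r)%N -> (0 < n)%N ->
  ghost q (witt_frob q r a) n = ghost q a (r * n).
Proof. by move=> r0; apply: (witt_frob_polyP q r0). Qed.

Lemma ghost_ver r a n : (0 < r)%N -> (0 < n)%N ->
  ghost q (seqV r a) n = if (r %| n)%N then r%:R * ghost q a (n %/ r) else 0.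
Proof.
move=> r0 n0; pose F d := d%:R * q%:~R ^+ (n %/ d).-1 * a (d %/ r)%N ^+ (n %/ d).
have -> : ghost q (seqV r a) n = \sum_(d <- divisors n | (r %| d)%N) F d.
  rewrite [RHS]big_mkcond; apply: eq_sum_divisors => // d dn; rewrite /seqV.
  case: ifP => // _; rewrite expr0n eqn0Ngt dvdn_div_gt0 //= mulr0 //.
case: ifP => [/dvdnP[m em]|/negbT rn]; last first.
  rewrite big_seq_cond big1 // => d; rewrite -dvdn_divisors // => /andP[dn rd].
  by move: rn; rewrite (dvdn_trans rd dn).
have m0 : (0 < m)%N by move: n0; rewrite em muln_gt0 => /andP[].
rewrite /F em mulnK // [(m * r)%N]mulnC sum_divisors_mul // mulr_sumr.
apply: eq_sum_divisors => // d dm.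
by rewrite divnMl // mulKn // natrM !mulrA.
Qed.

Lemma ghost0 n : (0 < n)%N -> ghost q (fun=> 0 : R) n = 0.
Proof.
move=> n0; rewrite /ghost (eq_sum_divisors (G := fun=> 0)) ?big1 // => d dn.
by rewrite expr0n eqn0Ngt dvdn_div_gt0 //= mulr0.
Qed.

End GhostMorphism.

Section Functoriality.
Variables (R T : comPzRingType) (f : {rmorphism R -> T}).

Lemma comp_vars2 k (a b : nat -> R) : f \o @vars2 R k a b =1 vars2 (f \o a) (f \o b).
Proof. by move=> i; rewrite /vars2 /=; case: (split i). Qed.

Lemma witt_add_comp (a b : nat -> R) : f \o witt_add q a b = witt_add q (f \o a) (f \o b).
Proof.
apply: functional_extensionality => n.
by rewrite /= rmorph_upoly_eval; apply: eq_upoly_eval; apply: comp_vars2.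
Qed.

Lemma witt_mul_comp (a b : nat -> R) : f \o witt_mul q a b = witt_mul q (f \o a) (f \o b).
Proof.
apply: functional_extensionality => n.
by rewrite /= rmorph_upoly_eval; apply: eq_upoly_eval; apply: comp_vars2.
Qed.

Lemma witt_frob_comp r (a : nat -> R) : f \o witt_frob q r a = witt_frob q r (f \o a).
Proof. by apply: functional_extensionality => n; rewrite /= rmorph_upoly_eval. Qed.

Lemma seqV_comp r (a : nat -> R) : f \o seqV r a = seqV r (f \o a).
Proof.
by apply: functional_extensionality => n; rewrite /seqV /=; case: ifP; rewrite ?rmorph0.
Qed.

End Functoriality.

Section Laws.
Variable R : comPzRingType.
Implicit Types a b c : nat -> R.

Lemma eq_witt_add a a' b b' : eqseq a a' -> eqseq b b' -> witt_add q a b = witt_add q a' b'.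
Proof.
move=> aa' bb'; apply: functional_extensionality => n; apply: eq_upoly_eval => i.
by rewrite /vars2; case: (split i) => j; [apply: aa'|apply: bb'].
Qed.

Lemma eq_witt_mul a a' b b' : eqseq a a' -> eqseq b b' -> witt_mul q a b = witt_mul q a' b'.
Proof.
move=> aa' bb'; apply: functional_extensionality => n; apply: eq_upoly_eval => i.
by rewrite /vars2; case: (split i) => j; [apply: aa'|apply: bb'].
Qed.

Lemma eq_witt_frob r a a' : eqseq a a' -> witt_frob q r a = witt_frob q r a'.
Proof.
by move=> aa'; apply: functional_extensionality => n; apply: eq_upoly_eval => i; apply: aa'.
Qed.

Lemma eq_seqV (A : zmodType) r (a a' : nat -> A) : (0 < r)%N -> eqseq a a' ->
  eqseq (seqV r a) (seqV r a').
Proof.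
move=> r0 aa' n n0; rewrite /seqV; case: ifP => // rn.
by apply: aa'; apply: dvdn_div_gt0.
Qed.

End Laws.

Definition witt_zero (R : comPzRingType) : nat -> R := fun=> 0.

Lemma witt_zero_comp (R T : comPzRingType) (f : {rmorphism R -> T}) :
  f \o witt_zero R = witt_zero T.
Proof. by apply: functional_extensionality => n; rewrite /= rmorph0. Qed.

Lemma eqseq_comp (S R : comPzRingType) (f : {rmorphism S -> R}) (a b : nat -> S) :
  eqseq a b -> eqseq (f \o a) (f \o b).
Proof. by move=> ab n n0; rewrite /= ab. Qed.

Lemma witt_opp (R : comPzRingType) (a : nat -> R) :
  exists b, eqseq (witt_add q a b) (witt_zero R).
Proof.
have [cov] := cov_exists R; have [a' ->] := cov_lift_seq cov a.
have [p pP] := witt_opp_exists q.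
exists (cov_map cov \o (fun m => upoly_eval (vars2 a' a') (p m))).
rewrite -witt_add_comp -(witt_zero_comp (cov_map cov)); apply: eqseq_comp.
apply: (@ghost_inj q _ _ _ (cov_tf (t := cov))) => n n0.
by rewrite ghost_add // pP // ghost0 // subrr.
Qed.

(** Each axiom is checked on lifts to a torsion-free cover, where it follows from the same axiom for
    the ghost components, and is then pushed down along the covering map. *)
Lemma witt_ring_comring (R : comPzRingType) : is_comring (witt_ring q R).
Proof.
have [cov] := cov_exists R; have inj a b := @ghost_inj q _ a b (cov_tf (t := cov)).
have lift := cov_lift_seq cov.
split=> //=.
- by move=> x y _ _ xy n n0; rewrite xy.
- by move=> x y z _ _ _ xy yz n n0; rewrite xy ?yz.
- by split=> // x x' y y' _ _ _ _ xx' yy'; rewrite (eq_witt_add xx' yy').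
- by split=> // x x' y y' _ _ _ _ xx' yy'; rewrite (eq_witt_mul xx' yy').
- move=> x y z _ _ _; have [x' ->] := lift x; have [y' ->] := lift y.
  have [z' ->] := lift z; rewrite -!witt_add_comp; apply/eqseq_comp/inj => n n0.
  by rewrite !ghost_add // addrA.
- move=> x y _ _; have [x' ->] := lift x; have [y' ->] := lift y.
  rewrite -!witt_add_comp; apply/eqseq_comp/inj => n n0.
  by rewrite !ghost_add // addrC.
- exists (witt_zero R) => // x _; split; last by have [y] := witt_opp x; exists y.
  have [x' ->] := lift x; rewrite -(witt_zero_comp (cov_map cov)) -witt_add_comp.
  by apply/eqseq_comp/inj => n n0; rewrite ghost_add // ghost0 // add0r.
- move=> x y z _ _ _; have [x' ->] := lift x; have [y' ->] := lift y.
  have [z' ->] := lift z; rewrite -!witt_mul_comp; apply/eqseq_comp/inj => n n0.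
  by rewrite !ghost_mul // mulrA.
- move=> x y _ _; have [x' ->] := lift x; have [y' ->] := lift y.
  rewrite -!witt_mul_comp; apply/eqseq_comp/inj => n n0.
  by rewrite !ghost_mul // mulrC.
- move=> x y z _ _ _; have [x' ->] := lift x; have [y' ->] := lift y.
  have [z' ->] := lift z; rewrite -!(witt_mul_comp, witt_add_comp).
  apply/eqseq_comp/inj => n n0.
  by rewrite !(ghost_mul, ghost_add) // mulrDl.
Qed.

End WittRing.

(** * Curves and logarithmic derivatives *)

Section LogarithmicDerivative.
Variable q : int.

(* With g(t) = sum_n g_n t^n, this is the equation G (1 - q g) = t g'(t), so
   that G is t g' / (1 - q g), the derivation t d/dt applied to the logarithm of
   F_q at g.  The dlog of H^q(a) is the ghost vector of a. *)
Definition is_dlog (R : comPzRingType) (g G : nat -> R) : Prop :=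
  forall n, G n - q%:~R * \sum_(i < n.+1) G i * g (n - i)%N = g n *+ n.

Section Truncation.
Variable R : comNzRingType.

(** Power series are replaced by polynomials that agree with them up to degree n. This is compatible
    with sums, products and t d/dt, so that identities of series become identities of
    polynomials. *)
Definition truncates n (P : {poly R}) (g : nat -> R) : Prop :=
  forall i, (i <= n)%N -> P`_i = g i.

Lemma truncates_poly n g : truncates n (\poly_(i < n.+1) g i) g.
Proof. by move=> i le_in; rewrite coef_poly ltnS le_in. Qed.

Definition dlog_defect (P D : {poly R}) := D - q%:~R *: (D * P) - 'X * P^`().

Lemma coef_dlog_defect n P D (g G : nat -> R) i :
  truncates n P g -> truncates n D G -> (i <= n)%N ->
  (dlog_defect P D)`_i = G i - q%:~R * (\sum_(j < i.+1) G j * g (i - j)%N) - g i *+ i.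
Proof.
move=> Pg DG le_in; rewrite !coefB coefZ coefM DG //; congr (_ - _ * _ - _).
  apply: eq_bigr => j _; rewrite DG ?Pg //; first by rewrite (leq_trans (leq_subr _ _)).
  by apply: leq_trans le_in; rewrite -ltnS ltn_ord.
rewrite coefXM; case: i le_in => [|i] le_in /=; first by rewrite mulr0n.
by rewrite coef_deriv Pg.
Qed.

Lemma is_dlog_truncates n P D g G : is_dlog g G -> truncates n P g -> truncates n D G ->
  truncates n (dlog_defect P D) (fun=> 0).
Proof.
by move=> gG Pg DG i le_in; rewrite (coef_dlog_defect Pg DG) // gG subrr.
Qed.

Lemma truncates_is_dlog g G :
  (forall n, exists P D, [/\ truncates n P g, truncates n D G &
     truncates n (dlog_defect P D) (fun=> 0)]) -> is_dlog g G.
Proof.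
move=> H n; have [P [D [Pg DG PD0]]] := H n; apply/eqP.
by rewrite -subr_eq0 -(coef_dlog_defect Pg DG) // PD0.
Qed.

Lemma truncates0_mul n (P Q : {poly R}) :
  truncates n P (fun=> 0) -> truncates n (P * Q) (fun=> 0).
Proof.
move=> P0 i le_in; rewrite coefM big1 // => j _; rewrite P0 ?mul0r //.
by apply: leq_trans le_in; rewrite -ltnS ltn_ord.
Qed.

Lemma truncates_mul n (P Q : {poly R}) g h : truncates n P g -> truncates n Q h ->
  truncates n (P * Q) (fun i => \sum_(j < i.+1) g j * h (i - j)%N).
Proof.
move=> Pg Qh i le_in; rewrite coefM; apply: eq_bigr => j _; rewrite Pg ?Qh //.
  by rewrite (leq_trans (leq_subr _ _)).
by apply: leq_trans le_in; rewrite -ltnS ltn_ord.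
Qed.

(** This is the additivity of the logarithm of F_q. It rests on 1 - q F_q(P, Q) = (1 - q P)(1 - q
    Q), which expresses the defect of the formal sum through the two given defects. *)
Lemma is_dlog_fgl_nz (g h G H : nat -> R) : is_dlog g G -> is_dlog h H ->
  is_dlog (fgl q g h) (fun n => G n + H n).
Proof.
move=> gG hH; apply: truncates_is_dlog => n.
set P := \poly_(i < n.+1) g i; set Q := \poly_(i < n.+1) h i.
set D := \poly_(i < n.+1) G i; set E := \poly_(i < n.+1) H i.
have [tP tQ tD tE] : [/\ truncates n P g, truncates n Q h, truncates n D G & truncates n E H].
  by split; apply: truncates_poly.
exists (P + Q - q%:~R *: (P * Q)), (D + E); split=> i le_in.
- by rewrite !coefB coefD coefZ (truncates_mul tP tQ) // tP // tQ.
- by rewrite coefD tD // tE.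
have -> : dlog_defect (P + Q - q%:~R *: (P * Q)) (D + E)
    = dlog_defect P D * (1 - q%:~R *: Q) + dlog_defect Q E * (1 - q%:~R *: P).
  by rewrite /dlog_defect derivB derivZ derivD derivM -!mul_polyC; ring.
have gG0 := is_dlog_truncates gG tP tD; have hH0 := is_dlog_truncates hH tQ tE.
by rewrite coefD (truncates0_mul _ gG0) // (truncates0_mul _ hH0) // addr0.
Qed.

Lemma truncates_ver n r (P : {poly R}) g : (0 < r)%N -> truncates n P g ->
  truncates n (P \Po 'X^r) (seqV r g).
Proof.
move=> r0 Pg i le_in; rewrite coef_comp_poly_Xn // /seqV; case: ifP => // _.
by rewrite Pg // (leq_trans (leq_div _ _)).
Qed.

(** The chain rule: t d/dt of g(t^r) is r times t g'(t) taken at t^r. *)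
Lemma is_dlog_ver_nz r (g G : nat -> R) : (0 < r)%N -> is_dlog g G ->
  is_dlog (seqV r g) (fun n => r%:R * seqV r G n).
Proof.
move=> r0 gG; apply: truncates_is_dlog => n.
set P := \poly_(i < n.+1) g i; set D := \poly_(i < n.+1) G i.
have [tP tD] : truncates n P g /\ truncates n D G by split; apply: truncates_poly.
exists (P \Po 'X^r), (r%:R *: (D \Po 'X^r)); split; first exact: truncates_ver.
  by move=> i le_in; rewrite coefZ (truncates_ver r0 tD).
have -> : dlog_defect (P \Po 'X^r) (r%:R *: (D \Po 'X^r)) = r%:R *: (dlog_defect P D \Po 'X^r).
  rewrite /dlog_defect !comp_polyB comp_polyZ !comp_polyM comp_polyX deriv_comp derivXn.
  set A := D \Po _; set B := P \Po _; set C := P^`() \Po _.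
  have -> : ('X : {poly R}) ^+ r = 'X * 'X ^+ r.-1 by rewrite -exprS prednK.
  by rewrite -!mul_polyC polyC_natr -['X ^+ _ *+ r]mulr_natl; ring.
have := truncates_ver r0 (is_dlog_truncates gG tP tD).
by move=> t0 i le_in; rewrite coefZ t0 // /seqV if_same mulr0.
Qed.

End Truncation.

Lemma is_dlog_fgl (R : comPzRingType) (g h G H : nat -> R) :
  is_dlog g G -> is_dlog h H -> is_dlog (fgl q g h) (fun n => G n + H n).
Proof.
elim/comPz_ind: R g h G H => [R|R zR] g h G H; first exact: is_dlog_fgl_nz.
by move=> _ _ n; apply: zR.
Qed.

Lemma is_dlog_ver (R : comPzRingType) r (g G : nat -> R) : (0 < r)%N -> is_dlog g G ->
  is_dlog (seqV r g) (fun n => r%:R * seqV r G n).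
Proof.
elim/comPz_ind: R g G => [R|R zR] g G; first exact: is_dlog_ver_nz.
by move=> _ _ n; apply: zR.
Qed.

Lemma is_dlog0 (R : comPzRingType) : is_dlog (fun=> 0 : R) (fun=> 0).
Proof. by move=> n; rewrite big1 => [|i _]; rewrite ?mulr0 // subrr mul0rn. Qed.

Lemma is_dlog_sum (R : comPzRingType) (I : Type) (s : seq I) (g G : I -> nat -> R) :
  (forall i, is_dlog (g i) (G i)) ->
  is_dlog (\big[@fgl q R / fun=> 0]_(i <- s) g i) (fun n => \sum_(i <- s) G i n).
Proof.
move=> gG; elim: s => [|i s IHs].
  rewrite big_nil [X in is_dlog _ X](_ : _ = fun=> 0); first exact: is_dlog0.
  by apply: functional_extensionality => n; rewrite big_nil.
rewrite big_cons [X in is_dlog _ X](_ : _ = fun n => G i n + \sum_(j <- s) G j n).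
  exact: is_dlog_fgl.
by apply: functional_extensionality => n; rewrite big_cons.
Qed.

(** The coefficients of k c t^k / (1 - q c t^k), the logarithmic derivative of the curve c t^k. *)
Definition monomial_ghost (R : comPzRingType) (c : R) k n : R :=
  if (0 < n)%N && (k %| n)%N then k%:R * q%:~R ^+ (n %/ k).-1 * c ^+ (n %/ k) else 0.

Lemma is_dlog_monomial (R : comPzRingType) (c : R) k : (0 < k)%N ->
  is_dlog (monomial c k) (monomial_ghost c k).
Proof.
move=> k0 n; set G := monomial_ghost c k.
have -> : \sum_(i < n.+1) G i * monomial c k (n - i) = if (k <= n)%N then G (n - k)%N * c else 0.
  case: leqP => [kn|nk]; last first.
    rewrite big1 // => i _; rewrite /monomial; case: eqP => [e|]; last by rewrite mulr0.
    by have := leq_subr i n; rewrite e leqNgt nk.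
  have lt : (n - k < n.+1)%N by rewrite ltnS leq_subr.
  rewrite (bigD1 (Ordinal lt)) //= big1 ?addr0; first by rewrite /monomial subKn // eqxx.
  move=> i ne; rewrite /monomial; case: eqP => [e|]; last by rewrite mulr0.
  case/eqP: ne; apply: val_inj => /=; move: (ltn_ord i); lia.
rewrite /G /monomial_ghost /monomial; case: (ltngtP n k) => [nk|kn|->] /=.
- case: n nk => [|n] nk; first by rewrite mulr0 subr0 mul0rn.
  by rewrite gtnNdvd // mulr0 subr0 mul0rn.
- rewrite mul0rn subn_gt0 kn (ltn_trans k0 kn) /= dvdn_subl // 1?ltnW //.
  case: (boolP (k %| n)%N) => kdn; last by rewrite mul0r mulr0 subrr.
  have [m em] := dvdnP kdn; move: kn; rewrite em mulnK // -{1}[k]mul1n ltn_pmul2r // => m1.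
  have -> : (m * k - k = (m - 1) * k)%N by rewrite mulnBl mul1n.
  rewrite mulnK //.
  case: m m1 {em} => [|[|m]] // _; rewrite subn1 /=; rewrite !exprS; ring.
- by rewrite k0 dvdnn divnn k0 subnn /= mul0r mulr0 subr0 expr0 expr1 mulr1 mulr_natl.
Qed.

(** Because G_0 = 0, the term G_0 g_n drops out of the equation at n, and n g_n is determined by the
    earlier coefficients. *)
Lemma is_dlog_inj (R : comPzRingType) (g h G : nat -> R) : torsion_free R ->
  g 0%N = h 0%N -> G 0%N = 0 -> is_dlog g G -> is_dlog h G -> g = h.
Proof.
move=> tf gh0 G0 gG hG; apply: functional_extensionality; elim/ltn_ind => n IHn.
case: n IHn => // n IHn; apply/eqP; rewrite -subr_eq0; apply/eqP.
apply: (tf n.+1) => //; rewrite mulrnBl -gG -hG [\sum_(i < n.+2) G i * g _]big_ord_recl.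
rewrite [\sum_(i < n.+2) G i * h _]big_ord_recl G0 !mul0r !add0r.
apply/eqP; rewrite subr_eq0; apply/eqP; congr (_ - _ * _); apply: eq_bigr => i _.
by rewrite IHn // /bump /= ltn_subrL.
Qed.

End LogarithmicDerivative.

(** * The bijection H^q *)

Section Curves.
Variable q : int.

Section CurveSum.
Variable R : comPzRingType.
Implicit Types (a b g h : nat -> R).

(** In [Hmap] the number of summands grows with the coefficient read; here it is fixed, so that this
    is a formal sum of curves to which [is_dlog_sum] applies. *)
Definition curve_sum a N : nat -> R :=
  \big[@fgl q R / fun=> 0]_(1 <= n < N.+1) monomial (a n) n.

(** As f has no constant term, a change of x in degree N affects the product f x only in higher
    degrees. *)
Lemma fgl_change_r N (c : R) f x y : f 0%N = 0 ->
  (forall i, (i < N)%N -> x i = y i) -> x N = y N + c ->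
  (forall i, (i < N)%N -> fgl q f x i = fgl q f y i) /\ fgl q f x N = fgl q f y N + c.
Proof.
move=> f0 xy xyN; rewrite /fgl; split=> [i iN|].
  rewrite xy //; congr (_ - _ * _); apply: eq_bigr => j _.
  by rewrite xy // (leq_ltn_trans (leq_subr _ _)).
rewrite xyN !big_ord_recl f0 !mul0r !add0r addrA [LHS]addrAC; congr (_ - _ * _ + _).
by apply: eq_bigr => j _; rewrite xy // ltn_subrL; case: (N) j => [[]|].
Qed.

(** The formal sum is folded from the right, so a new last summand is a new initial value of the
    fold; its effect in degree N passes unchanged through all the outer summands. *)
Lemma curve_sum_change_idx N (c : R) x y (s : seq nat) a :
  (forall n, n \in s -> (0 < n)%N) ->
  (forall i, (i < N)%N -> x i = y i) -> x N = y N + c ->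
  let S x := \big[@fgl q R / x]_(n <- s) monomial (a n) n in
  (forall i, (i < N)%N -> S x i = S y i) /\ S x N = S y N + c.
Proof.
move=> s0 xy xyN; elim: s s0 => [|n s IHs] s0 S; first by rewrite /S !big_nil.
have [|IHlt IHN] := IHs; first by move=> m ms; apply: s0; rewrite inE ms orbT.
have n0 : (0 < n)%N by apply: s0; rewrite inE eqxx.
by rewrite /S !big_cons; apply: fgl_change_r => //; rewrite /monomial ltn_eqF.
Qed.

Lemma fgl_monomial0 (c : R) n : (0 < n)%N -> fgl q (monomial c n) (fun=> 0) = monomial c n.
Proof.
move=> n0; apply: functional_extensionality => i; rewrite /fgl addr0 big1 ?mulr0 ?subr0 //.
by move=> j _; rewrite mulr0.
Qed.

Lemma curve_sumS a N :
  (forall i, (i <= N)%N -> curve_sum a N.+1 i = curve_sum a N i) /\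
  curve_sum a N.+1 N.+1 = curve_sum a N N.+1 + a N.+1.
Proof.
have iotaS : index_iota 1 N.+2 = rcons (index_iota 1 N.+1) N.+1.
  by rewrite /index_iota !subSS !subn0 -[N.+1 in LHS]addn1 iotaD add1n cats1.
rewrite /curve_sum iotaS big_rcons_op /= fgl_monomial0 //.
apply: (@curve_sum_change_idx N.+1 (a N.+1) (monomial (a N.+1) N.+1) (fun=> 0)
  (index_iota 1 N.+1) a) => [n|i iN|]; first by rewrite mem_index_iota => /andP[].
  by rewrite /monomial ltn_eqF.
by rewrite /monomial eqxx add0r.
Qed.

Lemma curve_sum_Hmap a N i : (i <= N)%N -> curve_sum a N i = Hmap q a i.
Proof.
move=> iN; rewrite -[LHS]/(curve_sum a N i) -[RHS]/(curve_sum a i i).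
elim: N iN => [|N IHN]; first by rewrite leqn0 => /eqP->.
rewrite leq_eqVlt => /orP[/eqP-> //|iN].
by rewrite (proj1 (curve_sumS a N)) // IHN.
Qed.

Lemma Hmap_recr a N : Hmap q a N.+1 = curve_sum a N N.+1 + a N.+1.
Proof. by rewrite -(proj2 (curve_sumS a N)). Qed.

Lemma Hmap0 a : Hmap q a 0 = 0.
Proof. by rewrite /Hmap big_geq. Qed.

Lemma eq_curve_sum a a' N : (forall n, (0 < n <= N)%N -> a n = a' n) ->
  curve_sum a N = curve_sum a' N.
Proof. by move=> aa'; apply: eq_big_nat => n nN; rewrite aa'. Qed.

Lemma eq_Hmap_upto a a' n : (forall m, (0 < m <= n)%N -> a m = a' m) ->
  Hmap q a n = Hmap q a' n.
Proof. by move=> aa'; rewrite -!(curve_sum_Hmap _ (leqnn n)) (eq_curve_sum aa'). Qed.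

Lemma eq_Hmap a a' : eqseq a a' -> Hmap q a = Hmap q a'.
Proof.
move=> aa'; apply: functional_extensionality => n.
by apply: eq_Hmap_upto => m /andP[m0 _]; apply: aa'.
Qed.

Lemma Hmap_inj_upto a a' N : (forall n, (n <= N)%N -> Hmap q a n = Hmap q a' n) ->
  forall n, (0 < n <= N)%N -> a n = a' n.
Proof.
move=> H; elim/ltn_ind => -[|n] IHn //= nN; have := H _ nN; rewrite !Hmap_recr.
rewrite (@eq_curve_sum a a'); first by move/addrI.
by move=> m /andP[m0 mn]; apply: IHn; rewrite ?m0 ?(leq_trans mn) // ltnW.
Qed.

Lemma Hmap_inj a a' : (forall n, Hmap q a n = Hmap q a' n) -> eqseq a a'.
Proof.
by move=> H n n0; apply: (@Hmap_inj_upto a a' n) => //; rewrite n0 leqnn.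
Qed.

(** The system is triangular: by [Hmap_recr] the coefficient of index n is a_n plus an expression in
    the earlier entries. *)
Lemma Hmap_surj g : g 0%N = 0 -> exists a, forall n, Hmap q a n = g n.
Proof.
move=> g0.
pose step a n := if n is n'.+1 then g n - curve_sum a n' n else 0.
have loc a b n : (forall m, (m < n)%N -> a m = b m) -> step a n = step b n.
  case: n => // n ab; rewrite /step (@eq_curve_sum a b) // => m /andP[_ mn].
  exact: ab.
have [a aE] := seq_recursion 0 loc.
exists a => -[|n]; first by rewrite Hmap0 g0.
by rewrite Hmap_recr [a _]aE /step addrC subrK.
Qed.

Lemma HinvK g : g 0%N = 0 -> Hmap q (Hinv q g) = g.
Proof.
move=> /Hmap_surj ex; apply: functional_extensionality.
exact: (epsilon_spec (inhabits (fun=> 0 : R)) _ ex).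
Qed.

Lemma Hinv_Hmap a : eqseq (Hinv q (Hmap q a)) a.
Proof. by apply: Hmap_inj => n; rewrite HinvK ?Hmap0. Qed.

(** A logarithmic derivative t g' / (1 - q g) has constant term 0, which the value of [ghost] at the
    irrelevant index 0 need not be. *)
Definition curve_ghost a n : R := if n is 0 then 0 else ghost q a n.

Lemma curve_ghostE a n : (0 < n)%N -> curve_ghost a n = ghost q a n.
Proof. by case: n. Qed.

(** The logarithmic derivatives of the monomials a_k t^k add up, and the coefficient of t^n in their
    sum collects the divisors k of n. *)
Lemma is_dlog_Hmap a : is_dlog q (Hmap q a) (curve_ghost a).
Proof.
move=> N.
have dl : is_dlog q (curve_sum a N)
    (fun n => \sum_(1 <= k < N.+1) (if (0 < k)%N then monomial_ghost q (a k) k n else 0)).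
  (* The test on k, true throughout the range, is inserted because [is_dlog_sum] asks for a
     logarithmic derivative at every index. *)
  have -> : curve_sum a N =
      \big[@fgl q R/fun=> 0]_(1 <= k < N.+1) (if (0 < k)%N then monomial (a k) k else fun=> 0).
    by apply: eq_big_nat => k /andP[->].
  apply: is_dlog_sum => k; case: ifP => [k0|_]; first exact: is_dlog_monomial.
  exact: is_dlog0.
have cg n : (n <= N)%N ->
  \sum_(1 <= k < N.+1) (if (0 < k)%N then monomial_ghost q (a k) k n else 0) = curve_ghost a n.
  case: n => [|n] nN.
    by rewrite big1 // => k _; case: ifP => //; rewrite /monomial_ghost.
  rewrite /curve_ghost /ghost (@sum_divisors_nat _ _ n.+1 N) // [RHS]big_mkcond.
  by apply: eq_big_nat => k /andP[-> _].
rewrite -cg // -(curve_sum_Hmap a (leqnn N)) -dl cg //; congr (_ - _ * _).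
apply: eq_bigr => i _; rewrite (curve_sum_Hmap a (leq_subr i N)) cg //.
by rewrite -ltnS.
Qed.

End CurveSum.

Section Naturality.
Variables (R T : comPzRingType) (f : {rmorphism R -> T}).

Lemma fgl_comp (g h : nat -> R) : f \o fgl q g h = fgl q (f \o g) (f \o h).
Proof.
apply: functional_extensionality => n; rewrite /fgl /= rmorphB rmorphD rmorphM rmorph_int.
by rewrite rmorph_sum; congr (_ - _ * _); apply: eq_bigr => i _; rewrite rmorphM.
Qed.

Lemma Hmap_comp (a : nat -> R) : f \o Hmap q a = Hmap q (f \o a).
Proof.
have sumE s : f \o \big[@fgl q R / fun=> 0]_(k <- s) monomial (a k) k
    = \big[@fgl q T / fun=> 0]_(k <- s) monomial (f (a k)) k.
  elim: s => [|k s IHs].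
    by apply: functional_extensionality => m; rewrite !big_nil /= rmorph0.
  rewrite !big_cons fgl_comp IHs; congr (fgl _ _ _).
  by apply: functional_extensionality => m; rewrite /monomial /=; case: eqP; rewrite ?rmorph0.
by apply: functional_extensionality => n; apply: (congr1 (fun g => g n) (sumE _)).
Qed.

End Naturality.

Section HmapMorphism.
Variable R : comPzRingType.

(** Over a torsion-free cover both sides have constant term 0 and the same logarithmic
    derivative. *)
Lemma Hmap_add (a b : nat -> R) : Hmap q (witt_add q a b) = fgl q (Hmap q a) (Hmap q b).
Proof.
have [cov] := cov_exists R; have [a' ->] := cov_lift_seq cov a; have [b' ->] := cov_lift_seq cov b.
rewrite -witt_add_comp -!Hmap_comp -fgl_comp; congr (_ \o _).
apply: (@is_dlog_inj q _ _ _ _ (cov_tf (t := cov)) _ _ (is_dlog_Hmap _)) => //.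
  by rewrite /fgl !Hmap0 big_ord1 Hmap0 !mul0r mulr0 subr0 addr0.
rewrite [X in is_dlog _ _ X](_ : _ = fun n => curve_ghost a' n + curve_ghost b' n).
  by apply: is_dlog_fgl; apply: is_dlog_Hmap.
by apply: functional_extensionality => -[|n] /=; rewrite ?addr0 // ghost_add.
Qed.

Lemma Hmap_ver r (a : nat -> R) : (0 < r)%N -> Hmap q (seqV r a) = seqV r (Hmap q a).
Proof.
move=> r0; have [cov] := cov_exists R; have [a' ->] := cov_lift_seq cov a.
rewrite -seqV_comp -!Hmap_comp -seqV_comp; congr (_ \o _).
apply: (@is_dlog_inj q _ _ _ _ (cov_tf (t := cov)) _ _ (is_dlog_Hmap _)) => //.
  by rewrite /seqV dvdn0 div0n !Hmap0.
rewrite [X in is_dlog _ _ X](_ : _ = fun n => r%:R * seqV r (curve_ghost a') n).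
  by apply: is_dlog_ver => //; apply: is_dlog_Hmap.
apply: functional_extensionality => -[|n] /=; first by rewrite /seqV dvdn0 div0n /= mulr0.
rewrite ghost_ver // /seqV; case: ifP => [rn|]; last by rewrite mulr0.
by rewrite curve_ghostE // dvdn_div_gt0.
Qed.

End HmapMorphism.
End Curves.

(** * The Frobenius of curves *)

Lemma Cyclotomic_dvd_Xn_sub1 r : (0 < r)%N ->
  exists U : {poly int}, 'X^r - 1 = U * 'Phi_r.
Proof.
move=> r0; rewrite -prod_Cyclotomic // (bigD1_seq r) ?divisors_uniq //=.
  by rewrite mulrC; eexists.
by rewrite -dvdn_divisors.
Qed.

(* (X^N - 1) sum_(i < r) X^(i N) = X^(r N) - 1 is the product of the Phi_d with
   d %| r N, and Phi_r is not one of the factors of X^N - 1. *)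
Lemma Cyclotomic_dvd_geometric r N : (0 < r)%N -> ~~ (r %| N)%N ->
  exists U : {poly int}, \sum_(0 <= i < r) 'X^(i * N) = U * 'Phi_r.
Proof.
move=> r0 rN; have N0 : (0 < N)%N by case: N rN => //; rewrite dvdn0.
have rN0 : (0 < r * N)%N by rewrite muln_gt0 r0.
have XN0 : 'X^N - 1 != 0 :> {poly int} by rewrite -size_poly_gt0 size_XnsubC.
suff -> : \sum_(0 <= i < r) 'X^(i * N) =
    \prod_(d <- divisors (r * N) | ~~ (d %| N)%N) 'Phi_d :> {poly int}.
  rewrite -big_filter (bigD1_seq r) ?filter_uniq ?divisors_uniq //=.
    by rewrite mulrC; eexists.
  by rewrite mem_filter rN -dvdn_divisors // dvdn_mulr.
apply: (mulfI XN0).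
transitivity ('X^(r * N) - 1 : {poly int}).
  rewrite [(r * N)%N]mulnC exprM [RHS]subrX1 big_mkord; congr (_ * _).
  by apply: eq_bigr => i _; rewrite mulnC exprM.
rewrite -!prod_Cyclotomic // (bigID (fun d => d %| N)%N) /=; congr (_ * _).
rewrite -big_filter; apply: perm_big; apply: uniq_perm.
- by rewrite filter_uniq ?divisors_uniq.
- exact: divisors_uniq.
move=> d; rewrite mem_filter -!dvdn_divisors //.
by case: (boolP (d %| N)%N) => //= dN; rewrite dvdn_mull.
Qed.

(** * Adjunction of a formal primitive root of unity *)

Section RootAdjunction.
Variables (R : comNzRingType) (r : nat).
Hypothesis r0 : (0 < r)%N.
Let Phi : {poly R} := map_poly intr 'Phi_r.
Let zeta : {poly %/ Phi} := 'qX.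

(** The quotient [{poly %/ Phi}] is taken modulo [mk_monic Phi], which is [Phi] itself when [Phi] is
    monic and nonconstant; its degree is [totient r]. *)
Let mk_monic_Phi : mk_monic Phi = Phi.
Proof.
have Phi_monic : Phi \is monic by apply: monic_map; apply: Cyclotomic_monic.
rewrite /mk_monic Phi_monic andbT.
rewrite size_map_poly_id0 ?size_Cyclotomic ?ltnS ?totient_gt0 ?r0 //.
by rewrite (monicP (Cyclotomic_monic r)) oner_eq0.
Qed.

Definition root_eval : {rmorphism {poly int} -> {poly %/ Phi}} :=
  in_qpoly Phi \o map_poly intr.

Lemma root_eval_Cyclotomic : root_eval 'Phi_r = 0.
Proof.
apply: val_inj; rewrite /= mk_monic_Phi -/Phi Pdiv.RingMonic.rmodpp //.
by rewrite -mk_monic_Phi monic_mk_monic.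
Qed.

Lemma root_evalX : root_eval 'X = zeta.
Proof. by rewrite /root_eval /= map_polyX. Qed.

(** Orthogonality of roots of unity. The quotient ring may have zero divisors, so the relation comes
    from divisibility by the cyclotomic polynomial in Z[X] and not from a division by zeta^N - 1. *)
Lemma sum_root_powers N : \sum_(0 <= i < r) zeta ^+ (i * N) = if (r %| N)%N then r%:R else 0.
Proof.
case: (boolP (r %| N)%N) => [/dvdnP[m ->]|rN].
  rewrite (eq_bigr (fun=> 1)) ?big_const_nat ?subn0 ?iter_addr_0 // => i _.
  have [U eU] := Cyclotomic_dvd_Xn_sub1 r0.
  have : root_eval ('X^r - 1) = 0 by rewrite eU rmorphM root_eval_Cyclotomic mulr0.
  rewrite rmorphB rmorphXn rmorph1 root_evalX => /eqP; rewrite subr_eq0 => /eqP zr.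
  by rewrite mulnA mulnC exprM zr expr1n.
have [U eU] := Cyclotomic_dvd_geometric r0 rN.
transitivity (root_eval (\sum_(0 <= i < r) 'X^(i * N))).
  by rewrite rmorph_sum; apply: eq_bigr => i _; rewrite rmorphXn root_evalX.
by rewrite eU rmorphM root_eval_Cyclotomic mulr0.
Qed.

Lemma quotient_torsion_free : torsion_free R -> torsion_free {poly %/ Phi}.
Proof.
move=> tf n x n0 xn0; apply/npolyP => i; rewrite coef0; apply: (tf n) => //.
have := congr1 (fun y : {poly %/ Phi} => (y : {poly R})`_i) xn0.
by rewrite raddfMn /= coefMn coef0.
Qed.

Definition qpolyC_morphism : {rmorphism R -> {poly %/ Phi}} := in_qpoly Phi \o polyC.

Lemma qpolyC_morphismE c : qpolyC_morphism c = qpolyC Phi c.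
Proof.
apply: val_inj; rewrite /= Pdiv.Ring.rmodp_small // size_polyC.
by apply: leq_ltn_trans (leq_b1 _) _; apply: size_mk_monic_gt1.
Qed.

Lemma qpolyC_inj : injective (qpolyC Phi).
Proof. by move=> x y /(congr1 val) /= /polyC_inj. Qed.

End RootAdjunction.

Section CurveFrobenius.
Variable q : int.

Lemma is_dlog_scale (R : comPzRingType) (z : R) g G : is_dlog q g G ->
  is_dlog q (fun n => g n * z ^+ n) (fun n => G n * z ^+ n).
Proof.
move=> gG n; rewrite -mulrnAl -gG mulrBl -mulrA mulr_suml; congr (_ - _ * _).
apply: eq_bigr => i _; rewrite mulrACA -exprD subnKC //.
by rewrite -ltnS.
Qed.

Lemma big_fgl_at0 (R : comPzRingType) (I : Type) (s : seq I) (g : I -> nat -> R) :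
  (forall i, g i 0%N = 0) -> (\big[@fgl q R / fun=> 0]_(i <- s) g i) 0%N = 0.
Proof.
move=> g0; elim: s => [|i s IHs]; first by rewrite big_nil.
by rewrite big_cons /fgl big_ord1 IHs g0 mul0r mulr0 subr0 addr0.
Qed.

(** The i-th twisted curve has logarithmic derivative Phi(a)_n z^(i n). Summation over i keeps the
    indices n divisible by r, with a factor r, which gives the ghost vector of V_r f_r a. *)
Lemma sum_twisted_curves (R : comPzRingType) r (z : R) (a : nat -> R) :
  torsion_free R -> (0 < r)%N ->
  (forall N, \sum_(0 <= i < r) z ^+ (i * N) = if (r %| N)%N then r%:R else 0) ->
  \big[@fgl q R / fun=> 0]_(0 <= i < r) (fun n => Hmap q a n * z ^+ (i * n))
    = seqV r (Hmap q (witt_frob q r a)).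
Proof.
move=> tf r0 sumz; rewrite -Hmap_ver //.
apply: (@is_dlog_inj q _ _ _ (fun n => \sum_(0 <= i < r) curve_ghost q a n * (z ^+ i) ^+ n)) => //.
- by rewrite Hmap0 big_fgl_at0 // => i; rewrite Hmap0 mul0r.
- by rewrite big1 // => i _; rewrite mul0r.
- apply: is_dlog_sum => i; have := is_dlog_scale (z ^+ i) (is_dlog_Hmap q a).
  by congr (is_dlog _ _ _); apply: functional_extensionality => n; rewrite -exprM.
have -> : (fun n => \sum_(0 <= i < r) curve_ghost q a n * (z ^+ i) ^+ n)
    = curve_ghost q (seqV r (witt_frob q r a)); last exact: is_dlog_Hmap.
apply: functional_extensionality => n; rewrite -mulr_sumr.
under eq_bigr do rewrite -exprM; rewrite sumz.
case: (posnP n) => [->|n0]; first by rewrite /= mul0r.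
rewrite !curve_ghostE // ghost_ver //; case: ifP => [rn|_]; last by rewrite mulr0.
by rewrite ghost_frob ?dvdn_div_gt0 // [(r * _)%N]mulnC divnK // mulrC.
Qed.

Lemma sum_twisted_curves_quotient (R : comNzRingType) r (a : nat -> R) N :
  torsion_free R -> (0 < r)%N ->
  let Phi : {poly R} := map_poly intr 'Phi_r in
  (\big[@fgl q {poly %/ Phi} / fun=> 0]_(0 <= i < r)
     (fun n => qpolyC Phi (Hmap q a n) * 'qX ^+ (i * n))) N
  = if (r %| N)%N then qpolyC Phi (Hmap q (witt_frob q r a) (N %/ r)) else 0.
Proof.
move=> tf r0 Phi; pose E := qpolyC_morphism R r.
have mapE b n : qpolyC Phi (Hmap q b n) = Hmap q (E \o b) n.
  by rewrite -Hmap_comp; apply/esym/qpolyC_morphismE.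
rewrite (eq_bigr (fun i n => Hmap q (E \o a) n * 'qX ^+ (i * n))); last first.
  by move=> i _; apply: functional_extensionality => n; rewrite mapE.
rewrite (sum_twisted_curves _ (@quotient_torsion_free R r tf) r0 (@sum_root_powers R r r0)).
by rewrite /seqV mapE witt_frob_comp.
Qed.

(** The polynomial of index n is the n-th coefficient of H^q(f_r b), where b is the Witt vector of
    the generic curve in r n variables. *)
Lemma curve_frob_exists r : (0 < r)%N -> exists p, @curve_frob_spec q r p.
Proof.
move=> r0; pose g n := generic_seq (@id 'I_(r * n)).
pose b n := Hinv q (g n).
exists (fun n => Hmap q (witt_frob q r (b n)) n) => R tf Phi zeta h h0 N.
have [a aE] := Hmap_surj q h0.
have -> : h = Hmap q a by apply: functional_extensionality => n; rewrite aE.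
rewrite sum_twisted_curves_quotient //; case: ifP => // rN; congr (qpolyC _ _).
set n := (N %/ r)%N.
have [e [eE eX]] := upoly_eval_morphism (vars1 (k := r * n) (Hmap q a)).
rewrite -eE -[RHS]/((e \o _) n) Hmap_comp witt_frob_comp.
apply: eq_Hmap_upto => m /andP[m0 mn].
(* Specialization sends the generic curve to h up to degree r n, and by injectivity of H^q it sends
   b to a up to that index. *)
have ab : forall j, (0 < j <= r * n)%N -> a j = (e \o b n) j.
  apply: (@Hmap_inj_upto q) => j jn; rewrite -Hmap_comp /b HinvK //.
  case: j jn => [|j] jn; first by rewrite Hmap0 /= rmorph0.
  by rewrite -[RHS]/(e (g n j.+1)) /g (generic_seqE _ jn) eX.
apply: eq_upoly_eval => i; apply: ab => /=.
by apply: leq_trans (ltn_ord i) _; rewrite leq_mul2l mn orbT.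
Qed.

Lemma curve_frob_comp (R T : comPzRingType) (f : {rmorphism R -> T}) r g :
  f \o curve_frob q r g = curve_frob q r (f \o g).
Proof. by apply: functional_extensionality => n; rewrite /= rmorph_upoly_eval. Qed.

(** The coefficient of u^(r n) in the twisted sum is given by the specification of [curve_frob_poly]
    and also by [sum_twisted_curves_quotient]. The comparison is made over a torsion-free cover. *)
Lemma curve_frob_Hmap (R : comPzRingType) r (a : nat -> R) : (0 < r)%N ->
  curve_frob q r (Hmap q a) = Hmap q (witt_frob q r a).
Proof.
move=> r0; have [cov] := cov_exists R; have [a' ->] := cov_lift_seq cov a.
rewrite -witt_frob_comp -!Hmap_comp -curve_frob_comp; congr (_ \o _).
move: (cov_ring cov) (cov_tf (t := cov)) a' => S.
elim/comPz_ind: S => [S|S zS] tf a'; last by apply: functional_extensionality => n; apply: zS.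
apply: functional_extensionality => n; apply: (@qpolyC_inj S r).
have spec : curve_frob_spec q (curve_frob_poly q r).
  by apply: epsilon_spec; apply: curve_frob_exists.
have := spec S tf (Hmap q a') (Hmap0 q a') (r * n)%N.
by rewrite sum_twisted_curves_quotient // dvdn_mulr // mulKn.
Qed.

End CurveFrobenius.

(** * Necklace numbers *)

Lemma moebius_prime_mul p n : prime p -> (0 < n)%N ->
  moebius (p * n) = if (p %| n)%N then 0 else - moebius n.
Proof.
move=> pp n0; have p0 := prime_gt0 pp; rewrite /moebius.
have lognE r : logn r (p * n) = ((r == p) + logn r n)%N.
  by rewrite lognM // logn_prime.
have p_in : p \in primes (p * n) by rewrite mem_primes pp muln_gt0 p0 n0 dvdn_mulr.
case: (boolP (p %| n)%N) => pn.
  case: ifP => // all1; have : logn p (p * n) == 1%N by exact: (allP all1 p p_in).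
  rewrite lognE eqxx add1n eqSS => /eqP e; by have := logn_gt0 p n; rewrite e mem_primes pp n0 pn.
have p_notin : p \notin primes n by rewrite mem_primes pp n0 pn.
have pr : perm_eq (primes (p * n)) (p :: primes n).
  apply: uniq_perm; rewrite /= ?primes_uniq ?p_notin //.
  by move=> r; rewrite primesM // primes_prime // !inE.
rewrite (perm_all _ pr) (perm_size pr) /= lognE eqxx.
have -> : logn p n = 0%N by apply/eqP; rewrite -leqn0 leqNgt logn_gt0.
rewrite /= (eq_in_all (a2 := fun r => logn r n == 1%N)); last first.
  move=> r rn; rewrite lognE; have [e|//] := eqVneq r p.
  by move: p_notin; rewrite -e rn.
by case: ifP; rewrite ?oppr0 // exprS mulN1r.
Qed.

(** For n = p m with p prime, the divisors p d with d prime to p cancel the divisors prime to p, and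
    those with p dividing d contribute 0. *)
Lemma sum_moebius n : (0 < n)%N -> \sum_(d <- divisors n) moebius d = (n == 1%N)%:R.
Proof.
move=> n0; have [->|n1] := eqVneq n 1%N; first by rewrite big_seq1.
have pp : prime (pdiv n) by rewrite pdiv_prime // ltn_neqAle eq_sym n1.
have [m em] := dvdnP (pdiv_dvd n); set p := pdiv n in pp em; have p0 := prime_gt0 pp.
have m0 : (0 < m)%N by move: n0; rewrite em muln_gt0 => /andP[].
rewrite (bigID (fun d => p %| d)%N) /= em [(m * p)%N]mulnC sum_divisors_mul //.
rewrite (eq_sum_divisors (G := fun d => if ~~ (p %| d)%N then - moebius d else 0)) //; last first.
  by move=> d dm; rewrite moebius_prime_mul ?(dvdn_gt0 m0 dm) //; case: ifP.
rewrite -big_mkcond sumrN /=; apply/eqP; rewrite addrC subr_eq0; apply/eqP.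
rewrite -[LHS]big_filter -[RHS]big_filter; apply: perm_big.
apply: uniq_perm; rewrite ?filter_uniq ?divisors_uniq //.
move=> d; rewrite !mem_filter -!dvdn_divisors ?muln_gt0 ?p0 ?m0 //.
case: (boolP (p %| d)%N) => //= pd.
by rewrite Gauss_dvdr // coprime_sym prime_coprime.
Qed.

(** Moebius inversion of the definition of S(x, d). *)
Lemma sum_necklaceS (K : comUnitRingType) (x : K) n : (0 < n)%N ->
  \sum_(d <- divisors n) necklaceS x d = x ^+ n.
Proof.
move=> n0; transitivity (\sum_(d <- divisors n) \sum_(e <- divisors d)
    (moebius (d %/ e))%:~R * x ^+ e).
  apply: eq_sum_divisors => // d dn; rewrite /necklaceS.
  by rewrite (sum_divisorsC (fun e k => (moebius e)%:~R * x ^+ k)) // (dvdn_gt0 n0 dn).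
rewrite (sum_divisors3 (fun e k _ => (moebius k)%:~R * x ^+ e)) //.
rewrite -[RHS](sum_divisors_delta (fun e => x ^+ e)) //.
apply: eq_sum_divisors => // e en; rewrite -mulr_suml mulrC; congr (_ * _).
rewrite -(rmorph_sum (intmul (1 : K))) sum_moebius ?dvdn_div_gt0 //.
by case: eqP.
Qed.

(** * The Dirichlet inverse of n |-> q^(n-1) *)

Section DirichletInverse.
Variables (K : pzRingType) (q : K).

Lemma dirichlet_inverse_exists :
  exists nu : nat -> K, forall n, (0 < n)%N ->
    \sum_(d <- divisors n) q ^+ (n %/ d).-1 * nu d = (n == 1%N)%:R.
Proof.
pose step (nu : nat -> K) n :=
  (n == 1%N)%:R - \sum_(d <- divisors n | (d < n)%N) q ^+ (n %/ d).-1 * nu d.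
have loc a b n : (forall m, (m < n)%N -> a m = b m) -> step a n = step b n.
  by move=> ab; congr (_ - _); apply: eq_bigr => d dn; rewrite ab.
have [nu nuE] := seq_recursion 0 loc; exists nu => n n0.
by rewrite sum_divisors_lt // divnn n0 expr0 mul1r [nu n]nuE subrK.
Qed.

Definition dirichlet_inverse : nat -> K :=
  proj1_sig (constructive_indefinite_description _ dirichlet_inverse_exists).

Lemma dirichlet_inverseP n : (0 < n)%N ->
  \sum_(d <- divisors n) q ^+ (n %/ d).-1 * dirichlet_inverse d = (n == 1%N)%:R.
Proof. exact: (proj2_sig (constructive_indefinite_description _ dirichlet_inverse_exists)). Qed.

End DirichletInverse.

(** By associativity of convolution. The inverse nu is a parameter so that it can also be the image
    of a rational one under a morphism. *)
Lemma dirichlet_inverse_conv (K : comPzRingType) (q : K) (nu g : nat -> K) n :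
  (forall n, (0 < n)%N ->
     \sum_(d <- divisors n) q ^+ (n %/ d).-1 * nu d = (n == 1%N)%:R) ->
  (0 < n)%N ->
  \sum_(d <- divisors n) q ^+ (n %/ d).-1 * (\sum_(e <- divisors d) nu e * g (d %/ e)%N) = g n.
Proof.
move=> nuP n0; transitivity (\sum_(d <- divisors n) \sum_(e <- divisors d)
    q ^+ (n %/ d).-1 * nu (d %/ e)%N * g e).
  apply: eq_sum_divisors => // d dn; rewrite mulr_sumr.
  rewrite (sum_divisorsC (fun e k => q ^+ (n %/ d).-1 * (nu e * g k))) ?(dvdn_gt0 n0 dn) //.
  by apply: eq_bigr => e _; rewrite mulrA.
rewrite (sum_divisors3 (fun e k m => q ^+ m.-1 * nu k * g e)) //.
rewrite -[RHS]sum_divisors_delta //; apply: eq_sum_divisors => // e en.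
by rewrite -mulr_suml nuP ?dvdn_div_gt0 // mulrC.
Qed.

Section NumbersTheory.
Variables (K : comUnitRingType) (q : K).
Hypothesis natU : forall n, (0 < n)%N -> (n%:R : K) \is a GRing.unit.
Let nu := dirichlet_inverse q.

(** Up to conjugation by a diagonal matrix, zeta^q is convolution with n |-> q^(n-1), so its inverse
    is the same matrix built from [nu]. It suffices that M is a right inverse, the matrices being
    square. *)
Lemma muqE d n : (0 < n)%N -> (d %| n)%N -> muq q d n = d%:R / n%:R * nu (n %/ d).
Proof.
move=> n0 dn; rewrite /muq; set D := divisors n; set k := (size D).-1.
set Z := \matrix_(i, j) _.
have memD e : (e \in D) = (e %| n)%N by rewrite dvdn_divisors.
have sizeD : size D = k.+1.
  by rewrite prednK // lt0n size_eq0; apply/eqP => e; have := memD n; rewrite e dvdnn.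
pose M : 'M[K]_k.+1 := \matrix_(i, j)
  let x := nth 0%N D i in let y := nth 0%N D j in
  if (x %| y)%N then x%:R / y%:R * nu (y %/ x)%N else 0.
have ZM : Z *m M = 1%:M.
  apply/matrixP => i j; rewrite !mxE.
  transitivity (\sum_(e <- D) zetaq q (nth 0%N D i) e *
      (if (e %| nth 0%N D j)%N then e%:R / (nth 0%N D j)%:R * nu (nth 0%N D j %/ e)%N else 0)).
    rewrite (big_nth 0%N) sizeD big_mkord; apply: eq_bigr => l _; by rewrite !mxE.
  have xD : nth 0%N D i \in D by rewrite mem_nth // sizeD.
  have yD : nth 0%N D j \in D by rewrite mem_nth // sizeD.
  have -> : (i == j) = (nth 0%N D i == nth 0%N D j).
    by rewrite nth_uniq ?sizeD ?divisors_uniq.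
  move: (nth 0%N D i) (nth 0%N D j) xD yD => x y; rewrite !memD => xn yn.
  have x0 := dvdn_gt0 n0 xn; have y0 := dvdn_gt0 n0 yn.
  transitivity (\sum_(e <- divisors y | (x %| e)%N)
      x%:R / y%:R * (q ^+ (e %/ x).-1 * nu (y %/ e)%N)).
    transitivity (\sum_(e <- D | (e %| y)%N)
        zetaq q x e * (e%:R / y%:R * nu (y %/ e)%N)).
      by rewrite [RHS]big_mkcond; apply: eq_bigr => e _; case: ifP; rewrite ?mulr0.
    rewrite sum_divisors_dvd // [RHS]big_mkcond; apply: eq_sum_divisors => // e ey.
    rewrite /zetaq; case: ifP => _; last by rewrite mul0r.
    have eV := mulVr (natU (dvdn_gt0 y0 ey)).
    move: (q ^+ _) (e%:R) (e%:R^-1) (y%:R^-1) eV => Q u v w uv.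
    by transitivity ((v * u) * (x%:R * w * (Q * nu (y %/ e)%N))); [ring|rewrite uv mul1r].
  case: (boolP (x %| y)%N) => [/dvdnP[m em]|xy]; last first.
    rewrite big_seq_cond big1 => [|e]; first by case: eqP xy => // ->; rewrite dvdnn.
    rewrite -dvdn_divisors // => /andP[ey xe]; by rewrite (dvdn_trans xe ey) in xy.
  have m0 : (0 < m)%N by move: y0; rewrite em muln_gt0 => /andP[].
  rewrite em mulnC sum_divisors_mul // -mulr_sumr.
  rewrite (eq_sum_divisors (G := fun d => q ^+ d.-1 * nu (m %/ d)%N)) //; last first.
    by move=> e _; rewrite mulKn // divnMl.
  rewrite -(sum_divisorsC (fun d e => q ^+ e.-1 * nu d)) // dirichlet_inverseP //.
  have [->|m1] := eqVneq m 1%N; first by rewrite muln1 eqxx mulr1 divrr ?natU.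
  by rewrite mulr0 -[X in X == _]muln1 eqn_pmul2l // eq_sym (negPf m1).
have -> : invmx Z = M.
  have [Zu _] := mulmx1_unit ZM.
  by rewrite -[LHS]mulmx1 -ZM mulKmx.
have dD : d \in D by rewrite memD.
have nD : n \in D by rewrite memD.
by rewrite mxE !inordK -?sizeD ?index_mem // !nth_index //= dn.
Qed.

Lemma tauqE k n : (0 < n)%N -> (k %| n)%N ->
  tauq q k n = n%:R^-1 * \sum_(d <- divisors k) nu d * q ^+ (n %/ d).-1.
Proof.
move=> n0 kn; have k0 := dvdn_gt0 n0 kn; rewrite /tauq mulr_sumr.
apply: eq_sum_divisors => // d dk; have d0 := dvdn_gt0 k0 dk.
rewrite muqE ?dvd1n // divn1 /zetaq (dvdn_trans dk kn) mul1r.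
have dV := mulVr (natU d0); move: (q ^+ _) (d%:R) (d%:R^-1) (n%:R^-1) dV => Q u v w uv.
by transitivity ((v * u) * (w * (nu d * Q))); [ring|rewrite uv mul1r].
Qed.

End NumbersTheory.

(** * The polynomials P_(n,i,j) *)

Section NecklacePolynomials.
Local Notation PX := ({poly rat}).

Lemma polyrat_natU n : (0 < n)%N -> (n%:R : PX) \is a GRing.unit.
Proof.
move=> n0; rewrite -polyC_natr poly_unitE size_polyC coefC eqxx unitfE.
by rewrite Num.Theory.pnatr_eq0 -lt0n n0.
Qed.

(** This is q P_(n,i,j)(q) with q the indeterminate, that is, [Ppoly] before its division by
    ['X]. *)
Definition Pnumerator (n i j : nat) : PX :=
  j%:R / (gcdn i j)%:R *
   \sum_(d <- divisors (n %/ lcmn i j))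
     tauq 'X (n %/ (lcmn i j * d)) (n %/ i)
       * necklaceS ('X ^+ (lcmn i j %/ j)) d.

Lemma Ppoly_mulX n i j : (0 < n)%N -> (lcmn i j %| n)%N -> Ppoly n i j * 'X = Pnumerator n i j.
Proof.
move=> n0 ln; have l0 := dvdn_gt0 n0 ln; have m0 := dvdn_div_gt0 n0 ln.
have j0 : (0 < j)%N by move: l0; rewrite lcmn_gt0 => /andP[].
have b0 : (0 < lcmn i j %/ j)%N by rewrite dvdn_div_gt0 ?dvdn_lcmr.
suff root0 : root (Pnumerator n i j) 0.
  have e : 'X = 'X - 0%:P :> PX by rewrite polyC0 subr0.
  by rewrite /Ppoly -/(Pnumerator n i j) divpK // [X in X %| _]e dvdp_XsubCl.
rewrite /root hornerM horner_sum big_seq big1 ?mulr0 // => d.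
rewrite -dvdn_divisors // => dm; have d0 := dvdn_gt0 m0 dm.
suff S0 : (necklaceS ('X^(lcmn i j %/ j) : PX) d).[0] = 0 by rewrite hornerM S0 mulr0.
rewrite horner_sum big_seq big1 // => e; rewrite -dvdn_divisors // => ed.
by rewrite hornerM -exprM hornerXn expr0n eqn0Ngt muln_gt0 b0 dvdn_div_gt0 // mulr0.
Qed.

(** Put l = [i,j], n = l M, a = l/i and b = l/j. The left side is a triple convolution in which
    q^(m-1) cancels against nu; what is left is l q^(M a - 1) sum_(d | M) S(q^b, d) = l q^(M a - 1)
    q^(b M). *)
Lemma sum_Pnumerator n i j : (0 < n)%N -> (lcmn i j %| n)%N ->
  \sum_(d <- divisors n | (lcmn i j %| d)%N) d%:R * 'X ^+ (n %/ d).-1 * Pnumerator d i j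
    = (lcmn i j)%:R * 'X ^+ (n %/ i).-1 * 'X ^+ (n %/ j).
Proof.
move=> n0 ln; set l := lcmn i j in ln *.
have l0 := dvdn_gt0 n0 ln.
have [i0 j0] : (0 < i)%N /\ (0 < j)%N by move: l0; rewrite lcmn_gt0 => /andP.
have g0 : (0 < gcdn i j)%N by rewrite gcdn_gt0 i0.
have [M eM] := dvdnP ln; have M0 : (0 < M)%N by move: n0; rewrite eM muln_gt0 => /andP[].
have [a ea] := dvdnP (dvdn_lcml i j); have [b eb] := dvdnP (dvdn_lcmr i j).
rewrite -/l in ea eb.
have a0 : (0 < a)%N by move: l0; rewrite ea muln_gt0 => /andP[].
have b0 : (0 < b)%N by move: l0; rewrite eb muln_gt0 => /andP[].
have eag : (a * gcdn i j = j)%N.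
  have := muln_lcm_gcd i j; rewrite -/l ea mulnAC [(i * j)%N]mulnC.
  by move/eqP; rewrite eqn_pmul2r // => /eqP.
pose nu := dirichlet_inverse ('X : PX).
rewrite eM [(M * l)%N]mulnC sum_divisors_mul //.
(* The summation index is now l m. The factor 1/(m a) of tau cancels against m and against j/(i,j) =
   a. *)
transitivity (\sum_(m <- divisors M) \sum_(d <- divisors m)
   l%:R * necklaceS ('X ^+ b) d * ('X ^+ (M %/ m).-1 *
     \sum_(e <- divisors (m %/ d)) nu e * 'X ^+ (m %/ d %/ e * (d * a)).-1)).
  apply: eq_sum_divisors => // m mM; have m0 := dvdn_gt0 M0 mM.
  rewrite divnMl // /Pnumerator -/l mulKn // !mulr_sumr; apply: eq_sum_divisors => // d dm.
  have d0 := dvdn_gt0 m0 dm.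
  have -> : (l * m %/ i = m * a)%N by rewrite ea mulnAC mulnK // mulnC.
  have -> : (l %/ j = b)%N by rewrite eb mulnK.
  rewrite divnMl // tauqE ?muln_gt0 ?m0 //; last first.
  - by rewrite dvdn_mulr // dvdn_div.
  - exact: polyrat_natU.
  rewrite (eq_sum_divisors (G := fun e => nu e * 'X ^+ (m %/ d %/ e * (d * a)).-1)); last first.
  - move=> e /dvdnP[k ek]; congr (_ * 'X ^+ _.-1).
    have ed0 := dvdn_div_gt0 m0 dm; move: (ed0); rewrite ek muln_gt0 => /andP[_ e0].
    by rewrite -[in LHS](divnK dm) ek mulnK // -!mulnA mulnCA mulKn // mulnA.
  - exact: dvdn_div_gt0.
  move: (\sum_(e <- _) _) (necklaceS _ _) ('X ^+ _) => S1 S2 Q.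
  rewrite -[in j%:R]eag !natrM.
  have := mulVr (polyrat_natU g0); have := mulVr (polyrat_natU (n := m * a) _).
  rewrite muln_gt0 m0 a0 natrM => /(_ isT).
  move: (l%:R : PX) (m%:R : PX) (a%:R : PX) ((gcdn i j)%:R : PX) => L' M' A' G'.
  move: (M' * A')^-1 (G'^-1) => U V eU eV.
  transitivity ((U * (M' * A')) * (V * G') * (L' * S2 * (Q * S1))); first by ring.
  by rewrite eU eV !mul1r.
rewrite (sum_divisors3 (fun d k m => l%:R * necklaceS ('X ^+ b) d * ('X ^+ m.-1 *
     \sum_(e <- divisors k) nu e * 'X ^+ (k %/ e * (d * a)).-1))) //.
transitivity (\sum_(d <- divisors M)
  l%:R * necklaceS ('X ^+ b) d * 'X ^+ (M * a).-1 : PX).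
  apply: eq_sum_divisors => // d dM; have d0 := dvdn_gt0 M0 dM.
  rewrite -mulr_sumr; congr (_ * _).
  rewrite (dirichlet_inverse_conv (fun k => 'X ^+ (k * (d * a)).-1)
    (dirichlet_inverseP ('X : PX)) (dvdn_div_gt0 M0 dM)).
  by rewrite mulnA divnK.
have -> : (l * M %/ i = M * a)%N by rewrite ea mulnAC mulnK // mulnC.
have -> : (l * M %/ j = b * M)%N by rewrite eb mulnAC mulnK.
by rewrite -mulr_suml -mulr_sumr sum_necklaceS // -exprM mulrAC.
Qed.

Variable q : int.

(** The identity for the numerators is divided by the indeterminate before it is evaluated at q, so
    it holds for q = 0 too. *)
Lemma sum_Pnum n i j : (0 < n)%N -> (lcmn i j %| n)%N ->
  \sum_(d <- divisors n | (lcmn i j %| d)%N) d%:R * q%:~R ^+ (n %/ d).-1 * Pnum q d i j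
    = (lcmn i j)%:R * q%:~R ^+ (n %/ i).-1 * q%:~R ^+ (n %/ j).-1.
Proof.
move=> n0 ln; have l0 := dvdn_gt0 n0 ln.
have [i0 j0] : (0 < i)%N /\ (0 < j)%N by move: l0; rewrite lcmn_gt0 => /andP.
have jn : (j %| n)%N := dvdn_trans (dvdn_lcmr i j) ln.
have e : \sum_(d <- divisors n | (lcmn i j %| d)%N) d%:R * 'X ^+ (n %/ d).-1 * Ppoly d i j
    = (lcmn i j)%:R * 'X ^+ (n %/ i).-1 * 'X ^+ (n %/ j).-1 :> PX.
  have X0 : 'X != 0 :> PX by rewrite polyX_eq0.
  apply: (mulIf X0); rewrite mulr_suml -[RHS]mulrA -exprSr prednK ?dvdn_div_gt0 //.
  rewrite -sum_Pnumerator // big_seq_cond [RHS]big_seq_cond; apply: eq_bigr => d.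
  rewrite -dvdn_divisors // => /andP[dn ld].
  by rewrite -Ppoly_mulX ?(dvdn_gt0 n0 dn) // mulrA.
have hornerN k : (k%:R : PX).[q%:~R] = k%:R by rewrite -polyC_natr hornerC.
have := congr1 (fun p : PX => p.[q%:~R]) e.
rewrite /= horner_sum !hornerM !hornerXn hornerN => <-.
by apply: eq_bigr => d _; rewrite !hornerM hornerXn hornerN.
Qed.
End NecklacePolynomials.

(** * The linear ghost map *)

Section LinearGhost.
Variables (q : int) (A : comPzRingType) (phi : {rmorphism rat -> A}).
Implicit Types x y : nat -> A.

Lemma rat_natU n : (0 < n)%N -> (n%:R : rat) \is a GRing.unit.
Proof. by move=> n0; rewrite unitfE Num.Theory.pnatr_eq0 -lt0n. Qed.

(** Compares the coefficients of x_d in Psi(f_r x)_n and Psi(x)_(r n). With s = [r,d]/r and a =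
    [r,d]/d, the condition d | r m reads s | m, nu cancels, and the remaining factor s r / a is
    d. *)
Lemma sum_tauq r d n : (0 < r)%N -> (0 < n)%N -> (d %| r * n)%N ->
  \sum_(m <- divisors n | (d %| r * m)%N) m%:R * q%:~R ^+ (n %/ m).-1 *
      (r%:R * tauq q%:~R (r * m %/ lcmn r d) (r * m %/ d))
    = d%:R * q%:~R ^+ (r * n %/ d).-1 :> rat.
Proof.
move=> r0 n0 drn; have rn0 : (0 < r * n)%N by rewrite muln_gt0 r0.
have d0 := dvdn_gt0 rn0 drn; set l := lcmn r d.
have l0 : (0 < l)%N by rewrite lcmn_gt0 r0.
have [s es] := dvdnP (dvdn_lcml r d); have [a ea] := dvdnP (dvdn_lcmr r d).
rewrite -/l in es ea.
have s0 : (0 < s)%N by move: l0; rewrite es muln_gt0 => /andP[].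
have a0 : (0 < a)%N by move: l0; rewrite ea muln_gt0 => /andP[].
have dE m : (d %| r * m)%N = (s %| m)%N.
  have : (l %| r * m)%N = (d %| r * m)%N by rewrite dvdn_lcm dvdn_mulr.
  by rewrite es mulnC dvdn_pmul2l // => <-.
rewrite (eq_bigl _ _ dE); move: drn; rewrite dE => /dvdnP[M eM].
have M0 : (0 < M)%N by move: n0; rewrite eM muln_gt0 => /andP[].
rewrite eM [(M * s)%N]mulnC sum_divisors_mul //.
have rsE m : (r * (s * m) = l * m)%N by rewrite es mulnA [(r * s)%N]mulnC.
have daE m : (l * m %/ d = m * a)%N by rewrite ea mulnAC mulnK // mulnC.
rewrite rsE daE -(dirichlet_inverse_conv (fun k => q%:~R ^+ (k * a).-1)
   (dirichlet_inverseP (q%:~R : rat)) M0) mulr_sumr.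
apply: eq_sum_divisors => // m mM; have m0 := dvdn_gt0 M0 mM.
rewrite rsE daE mulKn // divnMl // tauqE ?muln_gt0 ?m0 ?dvdn_mulr //; last exact: rat_natU.
have -> : \sum_(e <- divisors m) dirichlet_inverse q%:~R e * q%:~R ^+ (m * a %/ e).-1
    = \sum_(e <- divisors m) dirichlet_inverse q%:~R e * q%:~R ^+ (m %/ e * a).-1 :> rat.
  by apply: eq_sum_divisors => // e em; rewrite divn_mulAC.
have eq_sr : s%:R * r%:R = a%:R * d%:R :> rat by rewrite -!natrM -es -ea.
have [a1 m1] : (a%:R : rat) != 0 /\ (m%:R : rat) != 0.
  by rewrite !Num.Theory.pnatr_eq0 -!lt0n.
have -> : (d%:R : rat) = s%:R * r%:R / a%:R by rewrite eq_sr mulrC mulKf.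
rewrite !natrM; move: (\sum_(e <- _) _) => S.
by field; rewrite m1 a1.
Qed.

Lemma phi_rat_torsion_free : torsion_free A.
Proof.
move=> n x n0 xn0; rewrite -[x]mul1r -(rmorph1 phi) -(mulVr (rat_natU n0)).
by rewrite rmorphM rmorph_nat -mulrA mulr_natl xn0 mulr0.
Qed.

(* This is n (x zeta^q)_n. *)
Definition linear_ghost x n : A :=
  \sum_(d <- divisors n) d%:R * q%:~R ^+ (n %/ d).-1 * x d.
Local Notation Psi := linear_ghost.

Lemma eq_linear_ghost x y n : (0 < n)%N -> (forall d, (d %| n)%N -> x d = y d) ->
  Psi x n = Psi y n.
Proof. by move=> n0 xy; apply: eq_sum_divisors => // d dn; rewrite xy. Qed.

Lemma linear_ghost_inj x y : (forall n, (0 < n)%N -> Psi x n = Psi y n) -> eqseq x y.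
Proof.
move=> xy; elim/ltn_ind => n IHn n0; have := xy n n0.
rewrite /linear_ghost !sum_divisors_lt // divnn n0 !expr0 !mulr1.
rewrite [in X in _ = _ + X]big_seq_cond [X in _ + X = _]big_seq_cond.
rewrite (eq_bigr (fun d => d%:R * q%:~R ^+ (n %/ d).-1 * y d)); last first.
  by move=> d; rewrite -dvdn_divisors // => /andP[dn lt_dn]; rewrite IHn ?(dvdn_gt0 n0 dn).
move/addIr/eqP; rewrite -subr_eq0 -mulrBr mulr_natl => /eqP/(phi_rat_torsion_free n0)/eqP.
by rewrite subr_eq0 => /eqP.
Qed.

Lemma linear_ghost_add x y n : Psi (fun m => x m + y m) n = Psi x n + Psi y n.
Proof. by rewrite -big_split; apply: eq_bigr => d _; rewrite mulrDr. Qed.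

Lemma linear_ghost_ver r x n : (0 < r)%N -> (0 < n)%N ->
  Psi (seqV r x) n = if (r %| n)%N then r%:R * Psi x (n %/ r) else 0.
Proof.
move=> r0 n0; pose F d := d%:R * q%:~R ^+ (n %/ d).-1 * x (d %/ r)%N.
have -> : Psi (seqV r x) n = \sum_(d <- divisors n | (r %| d)%N) F d.
  rewrite [RHS]big_mkcond; apply: eq_sum_divisors => // d dn; rewrite /seqV.
  by case: ifP => // _; rewrite mulr0.
case: ifP => [/dvdnP[m em]|/negbT rn]; last first.
  rewrite big_seq_cond big1 // => d; rewrite -dvdn_divisors // => /andP[dn rd].
  by move: rn; rewrite (dvdn_trans rd dn).
have m0 : (0 < m)%N by move: n0; rewrite em muln_gt0 => /andP[].
rewrite /F em mulnK // [(m * r)%N]mulnC sum_divisors_mul // mulr_sumr.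
apply: eq_sum_divisors => // d dm.
by rewrite divnMl // mulKn // natrM !mulrA.
Qed.

(** By [muqE], n M^q(x, n) is the convolution of nu with k |-> q^(k-1) x^k, and Psi cancels nu. The
    result is the ghost vector of (x, 0, 0, ...). *)
Lemma linear_ghost_necklaceM (x : A) n : (0 < n)%N ->
  Psi (necklaceM q phi x) n = q%:~R ^+ n.-1 * x ^+ n.
Proof.
move=> n0; pose nu := dirichlet_inverse (q%:~R : rat).
have nuP m : (0 < m)%N ->
    \sum_(d <- divisors m) q%:~R ^+ (m %/ d).-1 * phi (nu d) = (m == 1%N)%:R.
  move=> m0; rewrite -(rmorph_nat phi) -(dirichlet_inverseP (q%:~R : rat)) // rmorph_sum.
  by apply: eq_bigr => d _; rewrite rmorphM rmorphXn rmorph_int.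
rewrite -(dirichlet_inverse_conv (fun k => q%:~R ^+ k.-1 * x ^+ k) nuP n0).
apply: eq_sum_divisors => // m mn; have m0 := dvdn_gt0 n0 mn.
rewrite mulrAC mulrC; congr (_ * _).
rewrite (sum_divisorsC (fun d k => phi (nu d) * (q%:~R ^+ k.-1 * x ^+ k))) //.
rewrite mulr_sumr; apply: eq_sum_divisors => // d dm; have d0 := dvdn_gt0 m0 dm.
rewrite muqE //; last exact: rat_natU.
rewrite mulrA -(rmorph_nat phi m) -rmorphM [RHS]mulrA; congr (_ * _).
rewrite -(rmorph_int phi) -rmorphXn -rmorphM; congr (phi _).
have [d1 m1] : (d%:R : rat) != 0 /\ (m%:R : rat) != 0.
  by rewrite !Num.Theory.pnatr_eq0 -!lt0n.
by rewrite -/nu; field; rewrite d1 m1.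
Qed.

(** The summand V_k M^q(a_k) of T^q produces the term of index k of the ghost component. *)
Lemma linear_ghost_Tmap (a : nat -> A) n : (0 < n)%N ->
  Psi (Tmap q phi a) n = ghost q a n.
Proof.
move=> n0; transitivity (\sum_(d <- divisors n) \sum_(k <- divisors d)
    d%:R * q%:~R ^+ (n %/ d).-1 * necklaceM q phi (a k) (d %/ k)).
  apply: eq_sum_divisors => // d dn; have d0 := dvdn_gt0 n0 dn.
  rewrite -mulr_sumr; congr (_ * _).
  rewrite (@sum_divisors_nat _ _ d d) // [RHS]big_mkcond.
  by apply: eq_big_nat => k /andP[k0 _]; rewrite /seqV.
rewrite (sum_divisorsA (fun d k =>
  d%:R * q%:~R ^+ (n %/ d).-1 * necklaceM q phi (a k) (d %/ k))) //.
apply: eq_sum_divisors => // k kn; have k0 := dvdn_gt0 n0 kn.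
rewrite -mulrA -linear_ghost_necklaceM ?dvdn_div_gt0 // mulr_sumr.
apply: eq_sum_divisors => [|d dnk]; first exact: dvdn_div_gt0.
by rewrite mulKn // natrM divnMA !mulrA.
Qed.

Lemma nr_mulE x y n : (0 < n)%N -> nr_mul q phi x y n =
  \sum_(i <- divisors n) \sum_(j <- divisors n)
    phi ((gcdn i j)%:R * Pnum q n i j) * x i * y j.
Proof.
move=> n0; rewrite (sum_divisors_nat _ n0 (leqnn n)) [RHS]big_mkcond.
apply: eq_bigr => i _; case: (boolP (i %| n)%N) => iN; last first.
  by rewrite big_pred0 // => j; rewrite dvdn_lcm (negPf iN).
rewrite (sum_divisors_nat _ n0 (leqnn n)); apply: eq_bigl => j.
by rewrite dvdn_lcm iN.
Qed.

(** The coefficient of x_i y_j is evaluated by [sum_Pnum], with [i,j] (i,j) = i j. *)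
Lemma linear_ghost_mul x y n : (0 < n)%N ->
  Psi (nr_mul q phi x y) n = Psi x n * Psi y n.
Proof.
move=> n0; pose H d i j := d%:R * q%:~R ^+ (n %/ d).-1 *
  (phi ((gcdn i j)%:R * Pnum q d i j) * x i * y j).
transitivity (\sum_(d <- divisors n) \sum_(i <- divisors n | (i %| d)%N)
   \sum_(j <- divisors n | (j %| d)%N) H d i j).
  apply: eq_sum_divisors => // d dn; have d0 := dvdn_gt0 n0 dn.
  rewrite nr_mulE // mulr_sumr sum_divisors_dvd //; apply: eq_bigr => i _.
  by rewrite mulr_sumr sum_divisors_dvd.
rewrite (exchange_big_dep xpredT) //= mulr_suml; apply: eq_sum_divisors => // i iN.
rewrite (exchange_big_dep xpredT) //= mulr_sumr; apply: eq_sum_divisors => // j jN.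
have lN : (lcmn i j %| n)%N by rewrite dvdn_lcm iN.
transitivity (phi ((gcdn i j)%:R * \sum_(d <- divisors n | (lcmn i j %| d)%N)
    d%:R * q%:~R ^+ (n %/ d).-1 * Pnum q d i j) * x i * y j).
  rewrite mulr_sumr rmorph_sum !mulr_suml; apply: eq_big => [d|d _]; first by rewrite dvdn_lcm.
  rewrite /H !rmorphM rmorphXn !rmorph_nat rmorph_int; ring.
rewrite sum_Pnum // !rmorphM !rmorphXn !rmorph_nat !rmorph_int.
have -> : (gcdn i j)%:R * ((lcmn i j)%:R * q%:~R ^+ (n %/ i).-1 * q%:~R ^+ (n %/ j).-1)
    = ((lcmn i j * gcdn i j)%N)%:R * q%:~R ^+ (n %/ i).-1 * q%:~R ^+ (n %/ j).-1 :> A.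
  by rewrite natrM; ring.
by rewrite muln_lcm_gcd natrM; ring.
Qed.

Lemma linear_ghost_frob r x n : (0 < r)%N -> (0 < n)%N ->
  Psi (nr_frob q phi r x) n = Psi x (r * n).
Proof.
move=> r0 n0; have rn0 : (0 < r * n)%N by rewrite muln_gt0 r0.
pose H m d := m%:R * q%:~R ^+ (n %/ m).-1 *
  (phi r%:R * (phi (tauq q%:~R (r * m %/ lcmn r d) (r * m %/ d)) * x d)).
transitivity (\sum_(m <- divisors n) \sum_(d <- divisors (r * n) | (d %| r * m)%N) H m d).
  apply: eq_sum_divisors => // m mn; rewrite sum_divisors_dvd ?dvdn_pmul2l //.
  by rewrite /nr_frob !mulr_sumr.
rewrite (exchange_big_dep xpredT) //=; apply: eq_sum_divisors => // d drn.
have := congr1 phi (sum_tauq r0 n0 drn); rewrite rmorph_sum rmorphM rmorphXn rmorph_nat rmorph_int.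
move=> <-; rewrite mulr_suml; apply: eq_bigr => m _.
by rewrite /H !rmorphM rmorphXn !rmorph_nat rmorph_int; ring.
Qed.

Lemma Tmap_surj x : exists a, eqseq x (Tmap q phi a).
Proof.
pose step (a : nat -> A) n := phi n%:R^-1 * (Psi x n - ghost_low q a n).
have loc a b n : (forall m, (m < n)%N -> a m = b m) -> step a n = step b n.
  by move=> ab; rewrite /step (@eq_ghost_low q _ a b) // => m /andP[_]; apply: ab.
have [a aE] := seq_recursion 0 loc; exists a; apply: linear_ghost_inj => n n0.
rewrite linear_ghost_Tmap // ghost_lowE // aE /step -mulrnAl -(rmorphMn phi) -[_^-1 *+ n]mulr_natr.
by rewrite mulVr ?rat_natU // rmorph1 mul1r subrK.
Qed.

Lemma Tmap_inj a b : eqseq (Tmap q phi a) (Tmap q phi b) -> eqseq a b.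
Proof.
move=> ab; apply: (@ghost_inj q _ _ _ phi_rat_torsion_free) => n n0.
rewrite -!linear_ghost_Tmap //; apply: eq_linear_ghost => // d dn.
by rewrite ab // (dvdn_gt0 n0 dn).
Qed.

Lemma eq_Tmap a b : eqseq a b -> eqseq (Tmap q phi a) (Tmap q phi b).
Proof.
move=> ab; apply: linear_ghost_inj => n n0; rewrite !linear_ghost_Tmap //.
by apply: eq_ghost => m /andP[m0 _]; apply: ab.
Qed.

Lemma Tmap_add a b :
  eqseq (Tmap q phi (witt_add q a b)) (fun n => Tmap q phi a n + Tmap q phi b n).
Proof.
apply: linear_ghost_inj => n n0.
by rewrite linear_ghost_add !linear_ghost_Tmap // ghost_add.
Qed.

Lemma Tmap_mul a b :
  eqseq (Tmap q phi (witt_mul q a b)) (nr_mul q phi (Tmap q phi a) (Tmap q phi b)).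
Proof.
apply: linear_ghost_inj => n n0.
by rewrite linear_ghost_mul // !linear_ghost_Tmap // ghost_mul.
Qed.

Lemma Tmap_ver r a : (0 < r)%N ->
  eqseq (Tmap q phi (seqV r a)) (seqV r (Tmap q phi a)).
Proof.
move=> r0; apply: linear_ghost_inj => n n0.
rewrite linear_ghost_ver // [LHS]linear_ghost_Tmap // ghost_ver //.
by case: ifP => // rn; rewrite linear_ghost_Tmap // dvdn_div_gt0.
Qed.

Lemma Tmap_frob r a : (0 < r)%N ->
  eqseq (Tmap q phi (witt_frob q r a)) (nr_frob q phi r (Tmap q phi a)).
Proof.
move=> r0; apply: linear_ghost_inj => n n0.
by rewrite linear_ghost_frob // !linear_ghost_Tmap ?muln_gt0 ?r0 // ghost_frob.
Qed.

Lemma eq_nr_mul x x' y y' : eqseq x x' -> eqseq y y' ->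
  eqseq (nr_mul q phi x y) (nr_mul q phi x' y').
Proof.
move=> xx' yy' n n0; rewrite !nr_mulE //; apply: eq_sum_divisors => // i iN.
apply: eq_sum_divisors => // j jN.
by rewrite xx' ?yy' ?(dvdn_gt0 n0 iN) ?(dvdn_gt0 n0 jN).
Qed.

Lemma eq_nr_frob r x x' : (0 < r)%N -> eqseq x x' ->
  eqseq (nr_frob q phi r x) (nr_frob q phi r x').
Proof.
move=> r0 xx' n n0; have rn0 : (0 < r * n)%N by rewrite muln_gt0 r0.
congr (_ * _); apply: eq_sum_divisors => // d drn.
by rewrite xx' ?(dvdn_gt0 rn0 drn).
Qed.

(** The coefficients match because (i,j) n = (n/[i,j]) i j. *)
Lemma thetamap_mul x y :
  eqseq (thetamap (nr_mul q phi x y)) (ap_mul q phi (thetamap x) (thetamap y)).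
Proof.
move=> n n0; rewrite /thetamap /nr_mul /ap_mul -mulr_natr mulr_suml.
apply: eq_bigr => i _; rewrite mulr_suml; apply: eq_bigr => j ln.
rewrite -!(mulr_natr (x i)) -!(mulr_natr (y j)) !rmorphM !rmorph_nat.
transitivity ((gcdn i j * n)%N%:R * phi (Pnum q n i j) * x i * y j).
  by rewrite natrM; ring.
suff -> : (gcdn i j * n = n %/ lcmn i j * (i * j))%N by rewrite !natrM; ring.
by rewrite -(muln_lcm_gcd i j) mulnA divnK // mulnC.
Qed.

Lemma thetamap_ver r x : (0 < r)%N ->
  eqseq (thetamap (seqV r x)) (ap_ver r (thetamap x)).
Proof.
move=> r0 n n0; rewrite /thetamap /ap_ver /seqV; case: ifP => rn; last by rewrite !mul0rn.
by rewrite -mulrnA divnK.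
Qed.

Lemma thetamap_frob r x : (0 < r)%N ->
  eqseq (thetamap (nr_frob q phi r x)) (ap_frob q phi r (thetamap x)).
Proof.
move=> r0 n n0; have rn0 : (0 < r * n)%N by rewrite muln_gt0 r0.
rewrite /thetamap /nr_frob /ap_frob -mulrnAr -sumrMnl; congr (_ * _).
apply: eq_sum_divisors => // d drn; have d0 := dvdn_gt0 rn0 drn.
rewrite -[LHS]mulr_natr -[x d *+ d]mulr_natr -(rmorph_nat phi n) -(rmorph_nat phi d).
transitivity (phi (tauq q%:~R (r * n %/ lcmn r d) (r * n %/ d) * n%:R) * x d).
  by rewrite rmorphM; ring.
rewrite -[in LHS](divrK (rat_natU d0) n%:R) !rmorphM; ring.
Qed.

Lemma thetamap_inj x y : eqseq (thetamap x) (thetamap y) -> eqseq x y.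
Proof.
move=> xy n n0; apply/eqP; rewrite -subr_eq0; apply/eqP.
by apply: (phi_rat_torsion_free n0); rewrite mulrnBl -/(thetamap x n) xy // subrr.
Qed.

End LinearGhost.

(** * Presentation by Witt vectors *)

Section Presentations.
Variable q : int.

(* rep z a reads: the Witt vector a represents z, that is, z is the image of a
   under the canonical map from W^q(R). *)
Record presentation (R : comPzRingType) (B : fvring) (rep : B -> (nat -> R) -> Prop) : Prop :=
  Presentation {
  pres_dom : forall z, dom z <-> exists a, rep z a;
  pres_eqv : forall z w a b, rep z a -> rep w b -> (eqv z w <-> eqseq a b);
  pres_eqseq : forall z a b, rep z a -> eqseq a b -> rep z b;
  pres_surj : forall a, exists z, rep z a;
  pres_add : forall z w a b, rep z a -> rep w b -> rep (radd z w) (witt_add q a b);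
  pres_mul : forall z w a b, rep z a -> rep w b -> rep (rmul z w) (witt_mul q a b);
  pres_ver : forall r z a, (0 < r)%N -> rep z a -> rep (rver r z) (seqV r a);
  pres_frob : forall r z a, (0 < r)%N -> rep z a -> rep (rfrob r z) (witt_frob q r a) }.

Section PresentedRing.
Variables (R : comPzRingType) (B : fvring) (rep : B -> (nat -> R) -> Prop).
Hypothesis pres : presentation rep.

Lemma rep_eqv z w a : rep z a -> rep w a -> eqv z w.
Proof. by move=> za wa; apply/(pres_eqv pres za wa). Qed.

Lemma rep_eqseq z a b : rep z a -> rep z b -> eqseq a b.
Proof. by move=> za zb; apply/(pres_eqv pres za zb); apply: (rep_eqv za za). Qed.

Lemma rep_dom z a : rep z a -> dom z.
Proof. by move=> za; apply/(pres_dom pres); exists a. Qed.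

Lemma dom_rep z : dom z -> exists a, rep z a.
Proof. by move/(pres_dom pres). Qed.

Lemma rep_ver_compatible r : (0 < r)%N -> compatible1 (@rver B r).
Proof.
move=> r0; split=> [z /dom_rep[a za]|z w /dom_rep[a za] /dom_rep[b wb]].
  exact: (rep_dom (pres_ver pres r0 za)).
move/(pres_eqv pres za wb) => ab.
by apply/(pres_eqv pres (pres_ver pres r0 za) (pres_ver pres r0 wb)); apply: eq_seqV.
Qed.

Lemma rep_frob_compatible r : (0 < r)%N -> compatible1 (@rfrob B r).
Proof.
move=> r0; split=> [z /dom_rep[a za]|z w /dom_rep[a za] /dom_rep[b wb]].
  exact: (rep_dom (pres_frob pres r0 za)).
move/(pres_eqv pres za wb) => ab; apply: (rep_eqv (pres_frob pres r0 za) _).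
by rewrite (eq_witt_frob q r ab); apply: pres_frob.
Qed.

(** Both sides of each axiom are represented by Witt vectors that are equal in W^q(R). *)
Lemma presentation_comring : is_comring B.
Proof.
have W := witt_ring_comring q R; have add := pres_add pres; have mul := pres_mul pres.
split.
- by move=> x /dom_rep[a xa]; apply: (rep_eqv xa xa).
- move=> x y /dom_rep[a xa] /dom_rep[b yb] /(pres_eqv pres xa yb) ab.
  by apply/(pres_eqv pres yb xa); apply: (eqv_sym W).
- move=> x y z /dom_rep[a xa] /dom_rep[b yb] /dom_rep[c zc].
  move=> /(pres_eqv pres xa yb) ab /(pres_eqv pres yb zc) bc.
  by apply/(pres_eqv pres xa zc); apply: (eqv_trans W (y := b) I I I ab bc).
- split=> [x y /dom_rep[a xa] /dom_rep[b yb]|]; first exact: (rep_dom (add _ _ _ _ xa yb)).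
  move=> x x' y y' /dom_rep[a xa] /dom_rep[a' xa'] /dom_rep[b yb] /dom_rep[b' yb'].
  move=> /(pres_eqv pres xa xa') aa' /(pres_eqv pres yb yb') bb'.
  by apply: (rep_eqv (add _ _ _ _ xa yb) _); rewrite (eq_witt_add q aa' bb'); apply: add.
- split=> [x y /dom_rep[a xa] /dom_rep[b yb]|]; first exact: (rep_dom (mul _ _ _ _ xa yb)).
  move=> x x' y y' /dom_rep[a xa] /dom_rep[a' xa'] /dom_rep[b yb] /dom_rep[b' yb'].
  move=> /(pres_eqv pres xa xa') aa' /(pres_eqv pres yb yb') bb'.
  by apply: (rep_eqv (mul _ _ _ _ xa yb) _); rewrite (eq_witt_mul q aa' bb'); apply: mul.
- move=> x y z /dom_rep[a xa] /dom_rep[b yb] /dom_rep[c zc].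
  apply/(pres_eqv pres (add _ _ _ _ xa (add _ _ _ _ yb zc)) (add _ _ _ _ (add _ _ _ _ xa yb) zc)).
  exact: (raddA W).
- move=> x y /dom_rep[a xa] /dom_rep[b yb].
  by apply/(pres_eqv pres (add _ _ _ _ xa yb) (add _ _ _ _ yb xa)); apply: (raddC W).
- have [o _ oP] := radd_zero_opp W; have [z zo] := pres_surj pres o.
  exists z => [|x /dom_rep[a xa]]; first exact: (rep_dom zo).
  have [oa [b _ ab]] := oP a I; split; first by apply/(pres_eqv pres (add _ _ _ _ zo xa) xa).
  have [y yb] := pres_surj pres b; exists y; first exact: (rep_dom yb).
  by apply/(pres_eqv pres (add _ _ _ _ xa yb) zo).
- move=> x y z /dom_rep[a xa] /dom_rep[b yb] /dom_rep[c zc].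
  apply/(pres_eqv pres (mul _ _ _ _ xa (mul _ _ _ _ yb zc)) (mul _ _ _ _ (mul _ _ _ _ xa yb) zc)).
  exact: (rmulA W).
- move=> x y /dom_rep[a xa] /dom_rep[b yb].
  by apply/(pres_eqv pres (mul _ _ _ _ xa yb) (mul _ _ _ _ yb xa)); apply: (rmulC W).
- move=> x y z /dom_rep[a xa] /dom_rep[b yb] /dom_rep[c zc].
  apply/(pres_eqv pres (mul _ _ _ _ (add _ _ _ _ xa yb) zc)
    (add _ _ _ _ (mul _ _ _ _ xa zc) (mul _ _ _ _ yb zc))).
  exact: (rmulDl W).
Qed.

End PresentedRing.

Definition presented (F : fvfunctor) (rep : forall R, F R -> (nat -> R) -> Prop) : Prop :=
  (forall R, presentation (@rep R)) /\
  (forall (A B : comPzRingType) (f : {rmorphism A -> B}) (z : F A) (a : nat -> A),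
     rep A z a -> rep B (fmap F f z) (f \o a)).

Lemma presented_functor F rep : @presented F rep -> is_functor F.
Proof.
case=> pres fmapP; split.
- by move=> R; apply: (presentation_comring (pres R)).
- move=> A B f; split.
  + split=> [z /(dom_rep (pres A))[a za]|]; first exact: (rep_dom (pres B) (fmapP _ _ f _ _ za)).
    move=> z w /(dom_rep (pres A))[a za] /(dom_rep (pres A))[b wb] /(pres_eqv (pres A) za wb) ab.
    by apply/(pres_eqv (pres B) (fmapP _ _ f _ _ za) (fmapP _ _ f _ _ wb)); apply: eqseq_comp.
  + move=> z w /(dom_rep (pres A))[a za] /(dom_rep (pres A))[b wb].
    apply: (rep_eqv (pres B) (fmapP _ _ f _ _ (pres_add (pres A) za wb)) _).
    by rewrite witt_add_comp; apply: (pres_add (pres B)); apply: fmapP.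
  + move=> z w /(dom_rep (pres A))[a za] /(dom_rep (pres A))[b wb].
    apply: (rep_eqv (pres B) (fmapP _ _ f _ _ (pres_mul (pres A) za wb)) _).
    by rewrite witt_mul_comp; apply: (pres_mul (pres B)); apply: fmapP.
- move=> R x /(dom_rep (pres R))[a xa].
  exact: (rep_eqv (pres R) (fmapP _ _ idfun _ _ xa) xa).
- move=> A B C g f x /(dom_rep (pres A))[a xa].
  exact: (rep_eqv (pres C) (fmapP _ _ (g \o f) _ _ xa) (fmapP _ _ g _ _ (fmapP _ _ f _ _ xa))).
- by move=> R r; apply: (rep_ver_compatible (pres R)).
- by move=> R r; apply: (rep_frob_compatible (pres R)).
Qed.

(** A map that keeps the representing Witt vector yields, in every equation to be proved, two
    elements represented by the same vector. *)
Lemma presented_equivalence F G repF repG (eta : transformation F G) :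
  @presented F repF -> @presented G repG ->
  (forall R z a, repF R z a -> repG R (eta R z) a) ->
  natural_equivalence eta /\ frob_compatible eta /\ ver_compatible eta.
Proof.
move=> [presF fmapF] [presG fmapG] etaP; split; [split|split].
- move=> R; have [pF pG] := (presF R, presG R); split; first split.
  + split=> [z /(dom_rep pF)[a za]|z w]; first exact: (rep_dom pG (etaP _ _ _ za)).
    move=> /(dom_rep pF)[a za] /(dom_rep pF)[b wb] /(pres_eqv pF za wb) ab.
    by apply/(pres_eqv pG (etaP _ _ _ za) (etaP _ _ _ wb)).
  + move=> z w /(dom_rep pF)[a za] /(dom_rep pF)[b wb].
    apply: (rep_eqv pG (etaP _ _ _ (pres_add pF za wb)) _).
    by apply: (pres_add pG); apply: etaP.
  + move=> z w /(dom_rep pF)[a za] /(dom_rep pF)[b wb].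
    apply: (rep_eqv pG (etaP _ _ _ (pres_mul pF za wb)) _).
    by apply: (pres_mul pG); apply: etaP.
  + move=> z w /(dom_rep pF)[a za] /(dom_rep pF)[b wb].
    by move/(pres_eqv pG (etaP _ _ _ za) (etaP _ _ _ wb)) => ab; apply/(pres_eqv pF za wb).
  + move=> z /(dom_rep pG)[a za]; have [x xa] := pres_surj pF a.
    by exists x; [apply: (rep_dom pF xa)|apply: (rep_eqv pG (etaP _ _ _ xa) za)].
- move=> A B f x /(dom_rep (presF A))[a xa].
  exact: (rep_eqv (presG B) (etaP _ _ _ (fmapF _ _ f _ _ xa)) (fmapG _ _ f _ _ (etaP _ _ _ xa))).
- move=> R r x r0 /(dom_rep (presF R))[a xa].
  exact: (rep_eqv (presG R) (etaP _ _ _ (pres_frob (presF R) r0 xa))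
    (pres_frob (presG R) r0 (etaP _ _ _ xa))).
- move=> R r x r0 /(dom_rep (presF R))[a xa].
  exact: (rep_eqv (presG R) (etaP _ _ _ (pres_ver (presF R) r0 xa))
    (pres_ver (presG R) r0 (etaP _ _ _ xa))).
Qed.

Section Concrete.
Variable R : comPzRingType.

Lemma witt_presentation : presentation (B := witt_ring q R) (@eqseq R).
Proof.
split=> //=.
- by move=> z; split=> // _; exists z.
- move=> z w a b za wb; split=> h n n0; first by rewrite -za // h // wb.
  by rewrite za // h // wb.
- by move=> z a b za ab n n0; rewrite za // ab.
- by move=> a; exists a.
- by move=> z w a b za wb; rewrite (eq_witt_add q za wb).
- by move=> z w a b za wb; rewrite (eq_witt_mul q za wb).
- by move=> r z a r0 za; apply: eq_seqV.
- by move=> r z a r0 za; rewrite (eq_witt_frob q r za).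
Qed.

Lemma curve_presentation :
  presentation (B := curve_ring q R) (fun g a => g = Hmap q a).
Proof.
split=> //=.
- move=> g; split=> [g0|[a ->]]; last exact: Hmap0.
  by exists (Hinv q g); rewrite HinvK.
- move=> z w a b -> ->; split=> [|ab n]; first exact: Hmap_inj.
  by rewrite (eq_Hmap q ab).
- by move=> z a b -> ab; apply: eq_Hmap.
- by move=> a; exists (Hmap q a).
- by move=> z w a b -> ->; rewrite Hmap_add.
- move=> z w a b -> ->; rewrite /curve_mul.
  by rewrite (eq_witt_mul q (Hinv_Hmap q a) (Hinv_Hmap q b)).
- by move=> r z a r0 ->; rewrite Hmap_ver.
- by move=> r z a r0 ->; rewrite curve_frob_Hmap.
Qed.

End Concrete.
End Presentations.

(** * The subquotients Delta^q and AP^q *)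

Section Subquotients.
Variable q : int.

Lemma witt_add_zero (R : comPzRingType) (a c : nat -> R) :
  eqseq c (witt_zero R) -> eqseq (witt_add q a c) a.
Proof.
move=> c0; have [cov] := cov_exists R; have [a' ->] := cov_lift_seq cov a.
rewrite (eq_witt_add q (a := cov_map cov \o a') (a' := cov_map cov \o a') _ c0) //.
rewrite -(witt_zero_comp (cov_map cov)) -witt_add_comp; apply: eqseq_comp.
apply: (@ghost_inj q _ _ _ (cov_tf (t := cov))) => n n0.
by rewrite ghost_add // ghost0 // addr0.
Qed.

Section Subquotient.
Variables (A S R : comPzRingType) (phi : {rmorphism rat -> A}).
Variables (iota : {rmorphism S -> A}) (rho : {rmorphism S -> R}).
Hypothesis rho_surj : forall y, exists x, rho x = y.

(** Covers the three cases at once: [iota] and [rho] are identities when R contains Q, only [rho] is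
    when R is torsion-free without containing Q, and S is the cover of R otherwise. *)
Definition delta_rep (z : nat -> A) (a : nat -> R) : Prop :=
  exists a', eqseq a (rho \o a') /\ eqseq z (Tmap q phi (iota \o a')).

Definition ap_rep (z : nat -> A) (a : nat -> R) : Prop :=
  exists2 y, delta_rep y a & eqseq z (thetamap y).

Lemma eqseq_trans (T : Type) (x y z : nat -> T) : eqseq x y -> eqseq y z -> eqseq x z.
Proof. by move=> xy yz n n0; rewrite xy // yz. Qed.

Lemma eqseq_sym (T : Type) (x y : nat -> T) : eqseq x y -> eqseq y x.
Proof. by move=> xy n n0; rewrite xy. Qed.

Lemma delta_rep_add z w a b : delta_rep z a -> delta_rep w b ->
  delta_rep (fun n => z n + w n) (witt_add q a b).
Proof.
move=> [a' [aa' za']] [b' [bb' wb']]; exists (witt_add q a' b'); split.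
  by rewrite witt_add_comp (eq_witt_add q aa' bb').
by rewrite witt_add_comp => n n0; rewrite za' // wb' // Tmap_add.
Qed.

Lemma delta_rep_mul z w a b : delta_rep z a -> delta_rep w b ->
  delta_rep (nr_mul q phi z w) (witt_mul q a b).
Proof.
move=> [a' [aa' za']] [b' [bb' wb']]; exists (witt_mul q a' b'); split.
  by rewrite witt_mul_comp (eq_witt_mul q aa' bb').
rewrite witt_mul_comp; apply: eqseq_trans (eq_nr_mul q phi za' wb') _.
by apply: eqseq_sym; apply: Tmap_mul.
Qed.

Lemma delta_rep_ver r z a : (0 < r)%N -> delta_rep z a -> delta_rep (seqV r z) (seqV r a).
Proof.
move=> r0 [a' [aa' za']]; exists (seqV r a'); rewrite !seqV_comp; split.
  exact: eq_seqV.
apply: eqseq_trans (eq_seqV r0 za') _.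
by apply: eqseq_sym; apply: Tmap_ver.
Qed.

Lemma delta_rep_frob r z a : (0 < r)%N -> delta_rep z a ->
  delta_rep (nr_frob q phi r z) (witt_frob q r a).
Proof.
move=> r0 [a' [aa' za']]; exists (witt_frob q r a'); rewrite !witt_frob_comp; split.
  by rewrite (eq_witt_frob q r aa').
apply: eqseq_trans (eq_nr_frob q phi r0 za') _.
by apply: eqseq_sym; apply: Tmap_frob.
Qed.

Lemma delta_rep_eqseq z a b : delta_rep z a -> eqseq a b -> delta_rep z b.
Proof.
by move=> [a' [aa' za']] ab; exists a'; split=> // n n0; rewrite -ab // aa'.
Qed.

Lemma delta_presentation (D : (nat -> A) -> Prop) (E : (nat -> A) -> (nat -> A) -> Prop) :
  (forall z, D z <-> exists a', eqseq z (Tmap q phi (iota \o a'))) ->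
  (forall z w a' b', eqseq z (Tmap q phi (iota \o a')) -> eqseq w (Tmap q phi (iota \o b')) ->
     (E z w <-> eqseq (rho \o a') (rho \o b'))) ->
  presentation q (B := nr_subquotient q phi D E) delta_rep.
Proof.
move=> DP EP; split=> /=.
- move=> z; split=> [/DP[a' za']|[a [a' [_ za']]]]; last by apply/DP; exists a'.
  by exists (rho \o a'), a'.
- move=> z w a b [a' [aa' za']] [b' [bb' wb']]; split=> [/(EP _ _ _ _ za' wb') ab|ab].
    by apply: (eqseq_trans aa'); apply: (eqseq_trans ab); apply: eqseq_sym.
  apply/(EP _ _ _ _ za' wb'); apply: eqseq_trans (eqseq_sym aa') _.
  exact: eqseq_trans ab bb'.
- exact: delta_rep_eqseq.
- by move=> a; have [a' ->] := lift_seq a rho_surj; exists (Tmap q phi (iota \o a')), a'.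
- exact: delta_rep_add.
- exact: delta_rep_mul.
- exact: delta_rep_ver.
- exact: delta_rep_frob.
Qed.

Lemma eq_thetamap (x y : nat -> A) : eqseq x y -> eqseq (thetamap x) (thetamap y).
Proof. by move=> xy n n0; rewrite /thetamap xy. Qed.

Lemma eq_ap_mul (x x' y y' : nat -> A) : eqseq x x' -> eqseq y y' ->
  eqseq (ap_mul q phi x y) (ap_mul q phi x' y').
Proof.
move=> xx' yy' n n0; apply: eq_big_nat => i /andP[i0 _]; rewrite xx' //.
rewrite big_nat_cond [RHS]big_nat_cond; apply: eq_bigr => j /andP[/andP[j0 _] _].
by rewrite yy'.
Qed.

Lemma eq_ap_frob r (x x' : nat -> A) : (0 < r)%N -> eqseq x x' ->
  eqseq (ap_frob q phi r x) (ap_frob q phi r x').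
Proof.
move=> r0 xx' n n0; have rn0 : (0 < r * n)%N by rewrite muln_gt0 r0.
congr (_ * _); apply: eq_sum_divisors => // d drn.
by rewrite xx' ?(dvdn_gt0 rn0 drn).
Qed.

Lemma ap_presentation (D : (nat -> A) -> Prop) (E : (nat -> A) -> (nat -> A) -> Prop) :
  (forall z, D z <-> exists a', eqseq z (thetamap (Tmap q phi (iota \o a')))) ->
  (forall z w a' b', eqseq z (thetamap (Tmap q phi (iota \o a'))) ->
     eqseq w (thetamap (Tmap q phi (iota \o b'))) ->
     (E z w <-> eqseq (rho \o a') (rho \o b'))) ->
  presentation q (B := ap_subquotient q phi D E) ap_rep.
Proof.
move=> DP EP; split=> /=.
- move=> z; split=> [/DP[a' za']|[a [y [a' [_ ya']] zy]]].
    by exists (rho \o a'), (Tmap q phi (iota \o a')) => //; exists a'.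
  by apply/DP; exists a'; apply: (eqseq_trans zy); apply: eq_thetamap.
- move=> z w a b [y [a' [aa' ya']] zy] [v [b' [bb' vb']] wv].
  have za' := eqseq_trans zy (eq_thetamap ya').
  have wb' := eqseq_trans wv (eq_thetamap vb').
  split=> [/(EP _ _ _ _ za' wb') ab|ab].
    by apply: (eqseq_trans aa'); apply: (eqseq_trans ab); apply: eqseq_sym.
  apply/(EP _ _ _ _ za' wb'); apply: eqseq_trans (eqseq_sym aa') _.
  exact: eqseq_trans ab bb'.
- by move=> z a b [y ya zy] ab; exists y => //; apply: delta_rep_eqseq ab.
- move=> a; have [a' ->] := lift_seq a rho_surj; exists (thetamap (Tmap q phi (iota \o a'))).
  by exists (Tmap q phi (iota \o a')) => //; exists a'.
- move=> z w a b [y ya zy] [v vb wv]; exists (fun n => y n + v n); first exact: delta_rep_add.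
  by move=> n n0; rewrite zy // wv // /thetamap mulrnDl.
- move=> z w a b [y ya zy] [v vb wv]; exists (nr_mul q phi y v); first exact: delta_rep_mul.
  apply: eqseq_trans (eq_ap_mul zy wv) _.
  by apply: eqseq_sym; apply: thetamap_mul.
- move=> r z a r0 [y ya zy]; exists (seqV r y); first exact: delta_rep_ver.
  apply: (eqseq_trans (y := ap_ver r (thetamap y))).
    by move=> n n0; rewrite /ap_ver (eq_seqV r0 zy).
  by apply: eqseq_sym; apply: thetamap_ver.
- move=> r z a r0 [y ya zy]; exists (nr_frob q phi r y); first exact: delta_rep_frob.
  apply: eqseq_trans (eq_ap_frob r0 zy) _.
  by apply: eqseq_sym; apply: thetamap_frob.
Qed.

End Subquotient.

Lemma Tmap_zero (A : comPzRingType) (phi : {rmorphism rat -> A}) :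
  eqseq (Tmap q phi (witt_zero A)) (fun=> 0).
Proof.
apply: (@linear_ghost_inj q A phi) => n n0.
rewrite linear_ghost_Tmap // ghost0 // /linear_ghost big1 // => d _.
by rewrite mulr0.
Qed.

(** The quotient by Delta^q(ker rho) identifies T^q(a) and T^q(b) exactly when a and b have the same
    image in W^q(R), since a difference of values of T^q is the value at a Witt difference. *)
Lemma Tmap_kernel (A S R : comPzRingType) (phi : {rmorphism rat -> A})
    (iota : {rmorphism S -> A}) (rho : {rmorphism S -> R}) (a b : nat -> S) :
  injective iota ->
  (T_image q phi iota (fun c => forall n, (0 < n)%N -> rho (c n) = 0)
     (fun n => Tmap q phi (iota \o a) n - Tmap q phi (iota \o b) n))
  <-> eqseq (rho \o a) (rho \o b).
Proof.
move=> iota_inj; split=> [[c c0 cE]|ab].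
  have abc : eqseq a (witt_add q b c).
    move=> n n0; apply: iota_inj; move: n n0; apply: (@Tmap_inj q _ phi (iota \o a) (iota \o _)).
    rewrite witt_add_comp => n n0; rewrite Tmap_add // -cE // addrC subrK //.
  apply: eqseq_trans (eqseq_comp rho abc) _.
  by rewrite witt_add_comp; apply: witt_add_zero.
(* Conversely, the required kernel element is the Witt difference of a and b, e being the negative
   of b. *)
have [e be0] := witt_opp q b; exists (witt_add q a e).
  have /eqseq_trans H : eqseq (rho \o witt_add q a e) (rho \o witt_add q b e).
    by rewrite !witt_add_comp (eq_witt_add q ab (fun n _ => erefl)).
  by move=> n n0; have := H _ (eqseq_comp rho be0) n n0; rewrite /= rmorph0.
have be : eqseq (Tmap q phi (witt_add q (iota \o b) (iota \o e))) (fun=> 0).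
  apply: eqseq_trans (Tmap_zero phi); apply: eq_Tmap.
  by rewrite -witt_add_comp -(witt_zero_comp iota); apply: eqseq_comp.
rewrite witt_add_comp => n n0; rewrite Tmap_add //; congr (_ + _).
by apply/eqP; rewrite eq_sym -addr_eq0 addrC -Tmap_add // be.
Qed.

End Subquotients.

(** * The four functors and their canonical equivalences *)

Section NamedFunctors.
Variables (q : int) (cover : forall R : comPzRingType, tf_cover R).

Definition delta_case_rep (R : comPzRingType) (c : ring_case R) :
    delta_case q cover c -> (nat -> R) -> Prop :=
  match c with
  | ContainsQ phi => delta_rep q phi idfun idfun
  | TorsionFree tf _ => delta_rep q (tensQ_ratR tf) (tensQ_inR tf) idfun
  | HasTorsion _ =>
      delta_rep q (tensQ_ratR (@cov_tf R (cover R))) (tensQ_inR (@cov_tf R (cover R)))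
        (cov_map (cover R))
  end.

Definition ap_case_rep (R : comPzRingType) (c : ring_case R) :
    ap_case q cover c -> (nat -> R) -> Prop :=
  match c with
  | ContainsQ phi => ap_rep q phi idfun idfun
  | TorsionFree tf _ => ap_rep q (tensQ_ratR tf) (tensQ_inR tf) idfun
  | HasTorsion _ =>
      ap_rep q (tensQ_ratR (@cov_tf R (cover R))) (tensQ_inR (@cov_tf R (cover R)))
        (cov_map (cover R))
  end.

Lemma tensQ_in_inj (R : comPzRingType) (tf : torsion_free R) : injective (tensQ_inR tf).
Proof. by move=> x y /eqP/qfracP; rewrite !mulr1n. Qed.

Lemma Tmap_iota_inj (A S : comPzRingType) (phi : {rmorphism rat -> A})
    (iota : {rmorphism S -> A}) (z w : nat -> A) (a b : nat -> S) : injective iota ->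
  eqseq z (Tmap q phi (iota \o a)) -> eqseq w (Tmap q phi (iota \o b)) ->
  (eqseq z w <-> eqseq a b).
Proof.
move=> iota_inj za wb; split=> [zw|ab].
  move=> n n0; apply: iota_inj; move: n n0.
  apply: (@Tmap_inj q _ phi (iota \o a) (iota \o b)).
  exact: eqseq_trans (eqseq_sym za) (eqseq_trans zw wb).
apply: eqseq_trans za (eqseq_trans _ (eqseq_sym wb)).
by apply: eq_Tmap; apply: eqseq_comp.
Qed.

Lemma thetamap_Tmap_iota_inj (A S : comPzRingType) (phi : {rmorphism rat -> A})
    (iota : {rmorphism S -> A}) (z w : nat -> A) (a b : nat -> S) : injective iota ->
  eqseq z (thetamap (Tmap q phi (iota \o a))) ->
  eqseq w (thetamap (Tmap q phi (iota \o b))) ->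
  (eqseq z w <-> eqseq a b).
Proof.
move=> iota_inj za wb.
have <- := @Tmap_iota_inj _ _ phi iota _ _ a b iota_inj (fun n _ => erefl) (fun n _ => erefl).
split=> [zw|ab].
  apply: (thetamap_inj phi); exact: eqseq_trans (eqseq_sym za) (eqseq_trans zw wb).
by apply: eqseq_trans za (eqseq_trans _ (eqseq_sym wb)); apply: eq_thetamap.
Qed.

Lemma delta_case_presentation (R : comPzRingType) (c : ring_case R) :
  presentation q (@delta_case_rep R c).
Proof.
case: c => [phi|tf notQ|ntf] /=; apply: delta_presentation => /=.
- by move=> y; exists y.
- by move=> z; split=> // _; apply: Tmap_surj.
- by move=> z w a b; apply: (@Tmap_iota_inj _ _ phi idfun).
- by move=> y; exists y.
- by move=> z; split=> [[a _ za]|[a za]]; exists a.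
- move=> z w a b; apply: Tmap_iota_inj; exact: tensQ_in_inj.
- exact: cov_surj.
- by move=> z; split=> [[a _ za]|[a za]]; exists a.
- move=> z w a b za wb; rewrite -(Tmap_kernel q (tensQ_ratR (@cov_tf R (cover R))) _ a b
    (@tensQ_in_inj _ _)).
  by split=> -[c c0 cE]; exists c => // n n0; rewrite -cE // za // wb.
Qed.

Lemma ap_case_presentation (R : comPzRingType) (c : ring_case R) :
  presentation q (@ap_case_rep R c).
Proof.
case: c => [phi|tf notQ|ntf] /=; apply: ap_presentation => /=.
- by move=> y; exists y.
- move=> z; split=> // _.
  (* Over a ring containing Q, theta^q is inverted by dividing the entry n by n. *)
  pose y n := phi n%:R^-1 * z n.
  have [a ya] := Tmap_surj q phi y; exists a => n n0.
  rewrite /thetamap -ya // /y -mulrnAl -(rmorphMn phi) -[_^-1 *+ n]mulr_natr.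
  by rewrite mulVr ?rat_natU // rmorph1 mul1r.
- by move=> z w a b; apply: (@thetamap_Tmap_iota_inj _ _ phi idfun).
- by move=> y; exists y.
- move=> z; split=> [[y [a _ ya] zy]|[a za]].
    by exists a; apply: eqseq_trans zy (eq_thetamap ya).
  by exists (Tmap q (tensQ_ratR tf) (tensQ_inR tf \o a)) => //; exists a.
- move=> z w a b; apply: thetamap_Tmap_iota_inj; exact: tensQ_in_inj.
- exact: cov_surj.
- move=> z; split=> [[y [a _ ya] zy]|[a za]].
    by exists a; apply: eqseq_trans zy (eq_thetamap ya).
  by eexists; [exists a|exact: za].
- move=> z w a b za wb; rewrite -(Tmap_kernel q (tensQ_ratR (@cov_tf R (cover R))) _ a b
    (@tensQ_in_inj _ _)).
  split=> [[y [c c0 yc] zwy]|[c c0 cE]].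
    exists c => //; apply: eqseq_trans yc; apply: (thetamap_inj (tensQ_ratR (@cov_tf R (cover R)))).
    by move=> n n0; rewrite -zwy // za // wb // /thetamap mulrnBl.
  eexists; first by exists c; [exact: c0|exact: cE].
  by move=> n n0; rewrite za // wb // /thetamap mulrnBl.
Qed.

Lemma T_case_rep (R : comPzRingType) (c : ring_case R) (a : nat -> R) :
  delta_case_rep (T_case q cover c a) a.
Proof.
case: c => [phi|tf notQ|ntf] /=; [by exists a|by exists a|].
exists (@cov_lift cover R \o a); split=> // n n0 /=.
by rewrite (proj2_sig (constructive_indefinite_description _ (cov_surj (cover R) (a n)))).
Qed.

Lemma theta_case_rep (R : comPzRingType) (c : ring_case R) z (a : nat -> R) :
  delta_case_rep z a -> ap_case_rep (theta_case (c := c) z) a.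
Proof. by case: c z => [phi|tf notQ|ntf] /= z za; exists z. Qed.

Definition named_rep (X : functor_name) :
    forall R : comPzRingType, named_functor q cover X R -> (nat -> R) -> Prop :=
  match X with
  | FW => fun R z a => eqseq z a
  | FC => fun R z a => z = Hmap q a
  | FDelta => fun R => @delta_case_rep R (ring_caseP R)
  | FAP => fun R => @ap_case_rep R (ring_caseP R)
  end.

(* The last two functors act on morphisms through a chosen preimage under an
   isomorphism h from W. *)
Lemma fmap_epsilon_rep (A B : comPzRingType) (FA FB : fvring)
    (repA : FA -> (nat -> A) -> Prop) (repB : FB -> (nat -> B) -> Prop)
    (hA : (nat -> A) -> FA) (hB : (nat -> B) -> FB) (f : {rmorphism A -> B}) z a :
  presentation q repA -> presentation q repB ->
  (forall a, repA (hA a) a) -> (forall b, repB (hB b) b) -> repA z a ->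
  repB (hB (f \o epsilon (inhabits (fun=> 0)) (fun a => eqv z (hA a)))) (f \o a).
Proof.
move=> pA pB hAP hBP za; apply: (pres_eqseq pB (hBP _)); apply: eqseq_comp.
have ex : exists a, eqv z (hA a) by exists a; apply: (rep_eqv pA za (hAP a)).
have /(pres_eqv pA za (hAP _)) := epsilon_spec (inhabits (fun=> 0)) _ ex.
exact: eqseq_sym.
Qed.

Lemma named_presented (X : functor_name) : presented q (@named_rep X).
Proof.
case: X; split=> /=.
- exact: witt_presentation.
- by move=> A B f z a za; apply: eqseq_comp.
- exact: curve_presentation.
- by move=> A B f z a ->; rewrite Hmap_comp.
- by move=> R; apply: delta_case_presentation.
- move=> A B f z a.
  exact: (fmap_epsilon_rep (hA := @T_map q cover A) (hB := @T_map q cover B) f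
    (@delta_case_presentation _ _) (@delta_case_presentation _ _)
    (@T_case_rep _ _) (@T_case_rep _ _)).
- by move=> R; apply: ap_case_presentation.
- move=> A B f z a; apply: (fmap_epsilon_rep
    (hA := fun a => theta_map (@T_map q cover A a))
    (hB := fun b => theta_map (@T_map q cover B b)) f
    (@ap_case_presentation _ _) (@ap_case_presentation _ _)).
    by move=> b; apply: theta_case_rep; apply: T_case_rep.
  by move=> b; apply: theta_case_rep; apply: T_case_rep.
Qed.

(** By induction on the construction. For an inverse [eps], some b represents [eps R z]; then both b
    and a represent z up to equality, so they agree. *)
Lemma canonical_equivalence_rep X Y (eta : transformation (named_functor q cover X)
    (named_functor q cover Y)) :
  @canonical_equivalence q cover X Y eta ->
  forall R z a, @named_rep X R z a -> @named_rep Y R (eta R z) a.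
Proof.
elim=> {X Y eta} [R z a za|R z a za|R z a|X Y Z eta eps _ IHeta _ IHeps R z a za|
    X Y eta eps _ IHeta inv R z a za] /=.
- exact: eq_Hmap.
- exact: (pres_eqseq (delta_case_presentation _) (T_case_rep _ z) za).
- exact: theta_case_rep.
- by apply: IHeps; apply: IHeta.
have pX := (named_presented X).1 R; have pY := (named_presented Y).1 R.
have [_ /(_ z (rep_dom pY za)) [/(dom_rep pX)[b zb] ezz]] := inv R.
have /(pres_eqv pY (IHeta _ _ _ zb) za) ba := ezz.
exact: (pres_eqseq pX zb ba).
Qed.

(** The inverse sends an element to a chosen Witt vector that represents it. *)
Lemma canonical_equivalence_inverse X (eta : transformation (named_functor q cover FW)
    (named_functor q cover X)) :
  @canonical_equivalence q cover FW X eta ->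
  exists eps, @canonical_equivalence q cover X FW eps.
Proof.
move=> can; have etaP := canonical_equivalence_rep can.
have pX R := (named_presented X).1 R.
pose eps R (z : named_functor q cover X R) : named_functor q cover FW R :=
  epsilon (inhabits (fun=> 0)) (fun a => @named_rep X R z a).
have epsP R z a : @named_rep X R z a -> @named_rep X R z (eps R z).
  by move=> za; apply: epsilon_spec; exists a.
exists eps; apply: (canonical_inv can) => R; split=> [a _|z /(dom_rep (pX R))[a za]].
  have ra := etaP R a a (fun n _ => erefl).
  exact: (rep_eqseq (pX R) (epsP _ _ _ ra) ra).
split=> //; apply: (rep_eqv (pX R) _ (epsP _ _ _ za)).
by apply: etaP.
Qed.

Lemma canonical_equivalence_exists X Y :
  exists eta, @canonical_equivalence q cover X Y eta.
Proof.
have H := canonical_H q cover; have T := canonical_T q cover.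
have from_W Z : exists eta, @canonical_equivalence q cover FW Z eta.
  case: Z; [|by exists (@Hmap q)|by exists (@T_map q cover)|].
    (* The identity is not among the generators; from W^q to itself, H^q followed by its inverse is
       used. *)
    have [eps epsP] := canonical_equivalence_inverse H.
    by eexists; apply: canonical_comp H epsP.
  by eexists; apply: canonical_comp T (canonical_theta q cover).
have [etaX canX] := from_W X; have [etaY canY] := from_W Y.
have [eps epsP] := canonical_equivalence_inverse canX.
by eexists; apply: canonical_comp epsP canY.
Qed.

End NamedFunctors.

Theorem theorem6p7 (q : int) (cover : forall R : comPzRingType, tf_cover R) :
  (forall X : functor_name, is_functor (named_functor q cover X)) /\
  (forall X Y : functor_name,
     exists eta : transformation (named_functor q cover X)
                                 (named_functor q cover Y),
       @canonical_equivalence q cover X Y eta) /\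
  (forall (X Y : functor_name)
     (eta : transformation (named_functor q cover X)
                           (named_functor q cover Y)),
     @canonical_equivalence q cover X Y eta ->
     natural_equivalence eta /\ frob_compatible eta /\ ver_compatible eta).
Proof.
split=> [X|]; first exact: presented_functor (named_presented q cover X).
split=> [X Y|X Y eta can]; first exact: canonical_equivalence_exists.
exact: presented_equivalence (named_presented q cover X) (named_presented q cover Y)
  (canonical_equivalence_rep can).
Qed.
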